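(* Let $\psi:(0,\infty)\to(0,\infty)$ be a non-decreasing function such that $\sum_{k=1}^{\infty}\frac{1}{\psi(k)}=\infty$. Then for Lebesgue-almost every $\alpha\in\mathbb{R}$, the set \[\{N\in\mathbb{N}:\ \log P_N(\alpha)\ge \psi(\log N)\}\] has upper density at least $1/2$. Moreover, there is an absolute constant $C>0$ such that if in addition $\liminf_{k\to\infty}\frac{\psi(k)}{k\log k}\ge C$, then for Lebesgue-almost every $\alpha$ this set has upper density exactly $1/2$.
   Context: For $\alpha\in\mathbb{R}$ and $N\in\mathbb{N}$, the Sudler product is $P_N(\alpha):=\prod_{r=1}^{N}\lvert 2\sin(\pi r\alpha)\rvert$. The upper density of a set $A\subseteq\mathbb{N}$ is $\limsup_{M\to\infty}\frac{\#(A\cap\{1,\dots,M\})}{M}$. *)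

(* Defs.v *)
From HB Require Import structures.
From mathcomp Require Import all_boot all_order all_algebra.
From mathcomp Require Import all_classical all_reals all_analysis.
Set Implicit Arguments. Unset Strict Implicit. Unset Printing Implicit Defensive.
Import Order.TTheory GRing.Theory Num.Theory.
Local Open Scope ring_scope.

Definition sudler {R : realType} (N : nat) (alpha : R) : R :=
  \prod_(1 <= r < N.+1) `|2 * sin (pi * r%:R * alpha)|.

Definition count_upto (A : set nat) (M : nat) : nat :=
  \sum_(1 <= n < M.+1) (if `[< A n >] then 1 else 0)%N.

Definition upper_density (R : realType) (A : set nat) : \bar R :=
  limn_esup (fun M : nat => ((count_upto A M)%:R / M%:R : R)%:E).

(* the set {N : log P_N(alpha) >= psi(log N)}; N >= 2 so that log N lies in
   the domain (0,oo) of psi *)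
Definition sudler_set {R : realType} (psi : R -> R) (alpha : R) : set nat :=
  fun N => (2 <= N)%N /\ psi (ln N%:R) <= ln (sudler N alpha).

(* Main.v *)
Require Import Defs.
From HB Require Import structures.
From mathcomp Require Import all_boot all_order all_algebra.
From mathcomp Require Import all_classical all_reals all_analysis.
From mathcomp Require Import measurable_realfun.
From mathcomp Require Import ring lra zify.
Import Order.TTheory GRing.Theory Num.Theory.
Import numFieldNormedType.Exports.
Local Open Scope ring_scope.

(** Write ||x|| for the distance to the nearest integer. Truncating the Fourier series
    log|2 sin(pi x)| = - sum_h cos(2 pi h x)/h at H and summing over r <= N turns log P_N(alpha)
    into - sum_{h <= H} sin((2N+1) pi h alpha) / (2h sin(pi h alpha)), up to O(log H) when H ~ 1/beta
    with beta = ||q alpha|| for a convergent-like p/q. The multiples h = jq form a sum of sines with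
    phase N beta which is of size 1/(q beta) and whose sign is that of the second half of the period
    (Abel summation and the Fejer-Jackson inequality): this is where the density 1/2 comes from.
    The other h contribute a term X_N that is small for most N by a mean square estimate.
    Lower bound: by a Borel-Cantelli argument (second moments on intervals plus Lebesgue density),
    almost every alpha has infinitely many p/q, with q ~ 64^k and small sum_h (h ||hp/q||)^-2, for
    which q beta is as small as 1/psi(ck); about half of the N < 1/beta then have
    log P_N >= psi(log N).
    Upper bound: at each scale log M ~ 2^j, outside sets of summable measure at most one reduced
    fraction n/m satisfies |alpha - n/m| < 1/(m^2 tau) with tau = 2^j j^(3/4), and the sum of
    (h ||h alpha||)^-2 over the h with h ||h alpha|| >= 1/tau is o(4^j j^2). Hence
    log P_N = O(2^j j) for most of the N in the first half of the period of m alpha. *)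

(** * The truncated Fourier series of log|2 sin| *)

(** At a fraction with q ~ 64^k the errors in log P_N are of order k, while psi may grow more slowly
    than k. The size aimed at for 1/(q beta) is therefore a large multiple of max(k, psi(9k));
    monotonicity of psi keeps the series of reciprocals divergent. Scales with psi(9k) > k^2 are
    dropped at the cost of a convergent series: they would make beta so small that log H is no
    longer O(k). The 9 comes from log N <= log H <= 9k. Bounding X_N termwise would cost the sum of
    1/(h ||h alpha||), typically of order (log q)^2, which is more than the log N loglog N allowed
    in the upper bound; a mean square costs only the l2 norm of the coefficients. Continued
    fractions are avoided: fractions come from the pigeonhole principle, and one uses only that p/q
    is reduced, the size of beta, and H beta <= 1 - eps. The last makes ||h alpha|| comparable from
    below with ||hp/q|| whenever q does not divide h, so that sums over such h reduce to sums over
    residues mod q. *)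

Lemma nondecreasing_of_derive (R : realType) (f df : R -> R) (a b : R) :
  a <= b -> (forall x, a <= x <= b -> is_derive x 1 f (df x)) ->
  (forall x, a <= x <= b -> 0 <= df x) -> f a <= f b.
Proof.
move=> ab fd df0.
have fd' x : x \in `]a, b[ -> is_derive x 1 f (df x).
  by rewrite in_itv/= => /andP[ax xb]; apply: fd; rewrite !ltW.
have [|c] := @MVT_segment R f df a b ab fd'.
  apply: derivable_within_continuous => x; rewrite in_itv/= => xab.
  by have [] := fd x xab.
rewrite in_itv /= => cab e.
rewrite -subr_ge0 e mulr_ge0 ?df0//; lra.
Qed.

Lemma derive_eq (R : realType) (f : R -> R) (df df' t : R) :
  is_derive t 1 f df -> df = df' -> is_derive t 1 f df'.
Proof. by move=> h <-. Qed.

Lemma is_derive_expn (R : realType) (n : nat) (t : R) :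
  is_derive t 1 (fun t : R => t ^+ n) (n%:R * t ^+ n.-1).
Proof.
have h := @is_deriveX R R id n t 1 1 (is_derive_id t 1).
rewrite exprfctE in h.
refine (derive_eq _ _ _ _ _ h _).
by rewrite /GRing.scale /= mulr1.
Qed.

Lemma is_derive_cmul (R : realType) (f : R -> R) (df k t : R) :
  is_derive t 1 f df -> is_derive t 1 (fun t : R => k * f t) (k * df).
Proof. exact: is_deriveZ. Qed.

Lemma is_derive_add (R : realType) (f g : R -> R) (df dg t : R) :
  is_derive t 1 f df -> is_derive t 1 g dg ->
  is_derive t 1 (fun t : R => f t + g t) (df + dg).
Proof. exact: is_deriveD. Qed.

Lemma is_derive_cos_series (R : realType) (phi : R) (H : nat) (t : R) :
  is_derive t 1 (fun t : R => \sum_(1 <= h < H.+1) t ^+ h * cos (h%:R * phi) / h%:R)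
    (\sum_(1 <= h < H.+1) t ^+ h.-1 * cos (h%:R * phi)).
Proof.
elim: H => [|H IH].
  rewrite big_nil [X in is_derive _ _ X](_ : _ = cst 0); first exact: is_derive_cst.
  by apply/funext => u; rewrite big_nil.
rewrite big_nat_recr//=.
rewrite [X in is_derive _ _ X](_ : _ = (fun t : R =>
    \sum_(1 <= h < H.+1) t ^+ h * cos (h%:R * phi) / h%:R +
   (cos (H.+1%:R * phi) / H.+1%:R) * (t ^+ H.+1))); last first.
  by apply/funext => u; rewrite big_nat_recr//=; congr (_ + _); ring.
have h1 := is_derive_cmul R (fun u => u ^+ H.+1) (H.+1%:R * t ^+ H) (cos (H.+1%:R * phi) / H.+1%:R) t (is_derive_expn R H.+1 t).
refine (derive_eq _ _ _ _ _ (is_derive_add _ _ _ _ _ _ IH h1) _); congr (_ + _).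
have h0 : (H.+1%:R : R) != 0 by rewrite pnatr_eq0.
rewrite /= mulrA divfK; [exact: mulrC|exact: h0].
Qed.

Lemma cos_double (R : realType) (y : R) : cos (2 * y) = 1 - 2 * sin y ^+ 2.
Proof. rewrite mulr_natl cos_mulr2n cos2sin2; ring. Qed.

(** Real part of the finite geometric sum of t^(h-1) e^(i h phi), with the denominator |1 - t e^(i
    phi)|^2 = 1 - 2 t cos phi + t^2 cleared. *)
Lemma cos_geometric (R : realType) (phi t : R) (H : nat) :
  (1 - 2 * t * cos phi + t ^+ 2) * (\sum_(1 <= h < H.+1) t ^+ h.-1 * cos (h%:R * phi))
  = cos phi - t - t ^+ H * cos (H.+1%:R * phi) + t ^+ H.+1 * cos (H%:R * phi).
Proof.
elim: H => [|H IH].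
  by rewrite big_nil mulr0 mul0r cos0 expr0 expr1 !mul1r mulr1; ring.
rewrite big_nat_recr//= mulrDr IH.
have -> : H.+2%:R * phi = H.+1%:R * phi + phi by rewrite -(natr1 H.+1); ring.
have -> : H%:R * phi = H.+1%:R * phi - phi by rewrite -(natr1 H); ring.
rewrite cosB cosD !exprS; ring.
Qed.

Lemma log_kernel_pos (R : realType) (y t : R) : 0 <= t <= 1 ->
  sin y ^+ 2 <= 1 - 2 * t * cos (2 * y) + t ^+ 2.
Proof.
move=> /andP[t0 t1].
rewrite cos_double -subr_ge0.
have -> : 1 - 2 * t * (1 - 2 * sin y ^+ 2) + t ^+ 2 - sin y ^+ 2
  = (1 - t) ^+ 2 * (1 - sin y ^+ 2) + (2 * t + t ^+ 2) * sin y ^+ 2 by ring.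
rewrite -cos2sin2; apply: addr_ge0; apply: mulr_ge0; rewrite ?sqr_ge0//; nra.
Qed.

(* The left-hand side is the value at t = 1 of a function of t that vanishes at 0 and whose
   derivative is at most t^H / |sin y|. *)
Lemma log_sin_fourier (R : realType) (y : R) (H : nat) : sin y != 0 ->
  `|ln `|2 * sin y| + \sum_(1 <= h < H.+1) cos (h%:R * (2 * y)) / h%:R|
  <= (H.+1%:R * `|sin y|)^-1.
Proof.
move=> s0; set phi := 2 * y.
pose D : R -> R := fun t => 1 - 2 * t * cos phi + t ^+ 2.
pose S : R -> R := fun t => \sum_(1 <= h < H.+1) t ^+ h * cos (h%:R * phi) / h%:R.
pose n : R -> R := fun t => cos (H.+1%:R * phi) - t * cos (H%:R * phi).
have sgt : 0 < `|sin y| by rewrite normr_gt0.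
have s2gt : 0 < sin y ^+ 2 by rewrite exprn_even_gt0.
have Dge (t : R) : 0 <= t <= 1 -> sin y ^+ 2 <= D t by exact: log_kernel_pos.
have Dgt (t : R) : 0 <= t <= 1 -> 0 < D t by move=> /Dge; exact: lt_le_trans.
(* [n t] is the real part of e^(i H phi) (e^(i phi) - t), a number of squared modulus [D t]; the
   difference is the square of its imaginary part. *)
have n2 (t : R) : n t ^+ 2 <= D t.
  rewrite /n; have -> : H.+1%:R * phi = H%:R * phi + phi by rewrite -(natr1 H); ring.
  rewrite cosD /D; set a := cos _; set b := sin _.
  have ab : a ^+ 2 + b ^+ 2 = 1 by rewrite cos2Dsin2.
  have cc : cos phi ^+ 2 + sin phi ^+ 2 = 1 by rewrite cos2Dsin2.
  rewrite -subr_ge0.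
  have -> : 1 - 2 * t * cos phi + t ^+ 2 - (a * cos phi - b * sin phi - t * a) ^+ 2
    = (b * (cos phi - t) + a * sin phi) ^+ 2.
    transitivity ((a^+2 + b^+2) * ((cos phi ^+ 2 + sin phi ^+ 2) - 2 * t * cos phi + t ^+ 2) - (a * cos phi - b * sin phi - t * a) ^+ 2).
      by rewrite ab cc mul1r.
    ring.
  exact: sqr_ge0.
have dF (t : R) : 0 <= t <= 1 ->
    is_derive t 1 (fun t : R => 2^-1 * ln (D t) + S t) (- (t ^+ H * (n t / D t))).
  move=> t01; have Dt := Dgt _ t01.
  have dD : is_derive t 1 D (2 * (t - cos phi)).
    rewrite [D](_ : _ = (fun t => (1 + (- (2 * cos phi)) * t ^+ 1) + t ^+ 2)); last first.
      by apply/funext => u; rewrite /D; ring.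
    have h1 := is_derive_add _ (cst 1) _ _ _ _ (is_derive_cst _ _ _)
      (is_derive_cmul R (fun u => u ^+ 1) (1%:R * t ^+ 0) (- (2 * cos phi)) t (is_derive_expn R 1 t)).
    have h2 := is_derive_add _ _ _ _ _ _ h1 (is_derive_expn R 2 t).
    refine (derive_eq _ _ _ _ _ h2 _) => /=.
    by rewrite expr0 expr1; ring.
  have dl : is_derive t 1 (fun t => ln (D t)) ((D t)^-1 * (2 * (t - cos phi))).
    by apply: (is_derive1_comp (f := @ln R) (g := D)) dD; exact: is_derive1_ln.
  have h := is_derive_add _ _ _ _ _ _ (is_derive_cmul R (fun t => ln (D t)) _ 2^-1 t dl)
    (is_derive_cos_series R phi H t).
  refine (derive_eq _ _ _ _ _ h _).
  have := cos_geometric R phi t H; rewrite -/(D t) => e.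
  have -> : \sum_(1 <= h0 < H.+1) t ^+ h0.-1 * cos (h0%:R * phi) =
    (D t)^-1 * (cos phi - t - t ^+ H * cos (H.+1%:R * phi) + t ^+ H.+1 * cos (H%:R * phi)).
    by rewrite -e mulrA mulVf ?mul1r// gt_eqF.
  rewrite /n exprS; field. by rewrite gt_eqF.
pose G : R -> R := fun t => (H.+1%:R * `|sin y|)^-1 * t ^+ H.+1.
have H1 : (H.+1%:R : R) != 0 by rewrite pnatr_eq0.
have dG (t : R) : is_derive t 1 G (t ^+ H / `|sin y|).
  have h := is_derive_cmul R (fun u => u ^+ H.+1) (H.+1%:R * t ^+ H) (H.+1%:R * `|sin y|)^-1 t (is_derive_expn R H.+1 t).
  refine (derive_eq _ _ _ _ _ h _).
  have e (a b c : R) : a != 0 -> b != 0 -> (a * b)^-1 * (a * c) = c / b.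
    by move=> a0 b0; field; rewrite ?a0 ?b0.
  by apply: e => //; rewrite gt_eqF.
have bnd (t : R) : 0 <= t <= 1 -> `|n t / D t| <= `|sin y|^-1.
  move=> t01; have Dt := Dgt _ t01.
  rewrite normrM normfV (gtr0_norm Dt) ler_pdivrMr// mulrC ler_pdivlMr//.
  rewrite -ler_sqr ?nnegrE ?normr_ge0 ?mulr_ge0 ?(ltW Dt)// exprMn !real_normK ?num_real//.
  rewrite expr2 [X in _ <= X]expr2; apply: ler_pM; rewrite ?sqr_ge0//; first exact: n2.
  by have := Dge _ t01; rewrite expr2.
have S0 : S 0 = 0.
  rewrite /S big_nat_cond big1// => h /andP[/andP[h1 _] _].
  by rewrite expr0n; case: h h1 => //= h _; rewrite mul0r mul0r.
have D0 : D 0 = 1 by rewrite /D; ring.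
have D1 : ln (D 1) = 2 * ln `|2 * sin y|.
  have -> : D 1 = `|2 * sin y| ^+ 2.
    by rewrite real_normK ?num_real// /D /phi cos_double; ring.
  have h : 0 < `|2 * sin y| by rewrite normr_gt0 mulf_neq0 // pnatr_eq0.
  by rewrite lnXn // [RHS]mulr_natl.
have S1 : S 1 = \sum_(1 <= h < H.+1) cos (h%:R * phi) / h%:R.
  by apply: eq_bigr => h _; rewrite expr1n mul1r.
(* [G] integrates the bound t^H / |sin y| for the derivative, so [G] plus k times the function is
   nondecreasing from the value 0 at t = 0; the signs k = 1 and k = -1 give the two inequalities. *)
have key (k : R) : `|k| = 1 -> 0 <= (H.+1%:R * `|sin y|)^-1 +
    k * (ln `|2 * sin y| + \sum_(1 <= h < H.+1) cos (h%:R * phi) / h%:R).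
  move=> k1.
  have := @nondecreasing_of_derive R (fun t => G t + k * (2^-1 * ln (D t) + S t))
    (fun t => t ^+ H / `|sin y| + k * (- (t ^+ H * (n t / D t)))) 0 1 ler01.
  rewrite S0 D0 ln1 /G expr0n /= D1 S1 expr1n !mulr0 addr0 mulr0 addr0 mulr1.
  rewrite [2^-1 * _]mulrA mulVf ?mul1r//; apply.
    by move=> t t01; exact: (is_derive_add _ _ _ _ _ _ (dG t) (is_derive_cmul R _ _ k t (dF t t01))).
  move=> t t01; have /andP[t0 _] := t01.
  have -> : t ^+ H / `|sin y| + k * - (t ^+ H * (n t / D t)) =
    t ^+ H * (`|sin y|^-1 - k * (n t / D t)) by ring.
  apply: mulr_ge0; first exact: exprn_ge0.
  rewrite subr_ge0; apply: le_trans (bnd _ t01).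
  by apply: le_trans (ler_norm _) _; rewrite normrM k1 mul1r.
rewrite ler_norml; have := key 1 (normr1 _); have := key (-1); rewrite normrN1 => /(_ erefl).
move: (_^-1) (ln _ + _) => Z W h1 h2; apply/andP; split; lra.
Qed.

(** * Dirichlet kernels and the sine expansion of log P_N *)

Lemma dirichlet_cos (R : realType) (y : R) (N : nat) :
  sin y * \sum_(1 <= r < N.+1) (2 * cos (r%:R * (2 * y))) =
  sin ((2 * N%:R + 1) * y) - sin y.
Proof.
elim: N => [|N IH]; first by rewrite big_nil mulr0 mulr0 add0r mul1r subrr.
rewrite big_nat_recr//= mulrDr IH -(natr1 N).
have -> : (2 * (N%:R + 1) + 1) * y = (N%:R + 1) * (2 * y) + y :> R by ring.
have -> : (2 * N%:R + 1) * y = (N%:R + 1) * (2 * y) - y :> R by ring.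
rewrite sinB sinD; ring.
Qed.

Lemma dirichlet_phase (R : realType) (y psi : R) (n : nat) :
  sin y * \sum_(0 <= v < n) cos (v%:R * (2 * y) + psi) =
  sin (n%:R * y) * cos ((n%:R - 1) * y + psi).
Proof.
elim: n => [|n IH]; first by rewrite big_nil mulr0 mul0r sin0 mul0r.
rewrite big_nat_recr//= mulrDr IH -(natr1 n) addrK.
have -> : n%:R * (2 * y) + psi = (n%:R * y + psi) + n%:R * y :> R by ring.
have -> : (n%:R - 1) * y + psi = (n%:R * y + psi) - y :> R by ring.
have -> : (n%:R + 1) * y = n%:R * y + y :> R by ring.
move: (n%:R * y + psi) => B; move: (n%:R * y) => A.
rewrite cosB cosD sinD; ring.
Qed.

Lemma ln_prod_norm (R : realType) (f : nat -> R) (N : nat) :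
  (forall r, (1 <= r <= N)%N -> f r != 0) ->
  ln (\prod_(1 <= r < N.+1) `|f r|) = \sum_(1 <= r < N.+1) ln `|f r|.
Proof.
move=> f0; have [] : ln (\prod_(1 <= r < N.+1) `|f r|) = \sum_(1 <= r < N.+1) ln `|f r|
  /\ 0 < \prod_(1 <= r < N.+1) `|f r| => //.
elim: N f0 => [|N IH] f0; first by rewrite !big_nil ln1.
have [|IH1 IH2] := IH.
  by move=> r /andP[r1 rN]; apply: f0; rewrite r1 ltnW.
have fN : 0 < `|f N.+1| by rewrite normr_gt0 f0 //= leqnn.
by rewrite !(big_nat_recr N.+1)//= mulr_gt0// lnM ?posrE// IH1.
Qed.

(** Sum of [log_sin_fourier] over r <= N with the two sums exchanged: by [dirichlet_cos] the sum of
    cos(2 pi r h alpha) over r is (sin((2N+1) pi h alpha) / sin(pi h alpha) - 1) / 2, and the -1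
    produces the harmonic sum that is subtracted. *)
Lemma ln_sudler_expansion (R : realType) (alpha : R) (N H : nat) :
  (forall r, (1 <= r <= N)%N -> sin (pi * (r%:R * alpha)) != 0) ->
  (forall h, (1 <= h <= H)%N -> sin (pi * (h%:R * alpha)) != 0) ->
  `|ln (sudler N alpha) +
    (\sum_(1 <= h < H.+1) sin ((2 * N%:R + 1) * (pi * (h%:R * alpha))) /
        (2 * h%:R * sin (pi * (h%:R * alpha)))
     - \sum_(1 <= h < H.+1) (2 * h%:R)^-1)|
  <= H.+1%:R^-1 * \sum_(1 <= r < N.+1) `|sin (pi * (r%:R * alpha))|^-1.
Proof.
move=> sN sH.
have -> : ln (sudler N alpha) = \sum_(1 <= r < N.+1) ln `|2 * sin (pi * (r%:R * alpha))|.
  rewrite -ln_prod_norm; last by move=> r rN; rewrite mulf_neq0// sN.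
  by congr ln; apply: eq_bigr => r _; rewrite mulrA.
have -> : \sum_(1 <= h < H.+1) sin ((2 * N%:R + 1) * (pi * (h%:R * alpha))) /
        (2 * h%:R * sin (pi * (h%:R * alpha))) - \sum_(1 <= h < H.+1) (2 * h%:R)^-1
  = \sum_(1 <= r < N.+1) \sum_(1 <= h < H.+1) cos (h%:R * (2 * (pi * (r%:R * alpha)))) / h%:R.
  rewrite exchange_big_nat -sumrB /=.
  apply: eq_big_nat => h hH; have h0 : (h%:R : R) != 0.
    by case/andP: hH; case: h.
  have s0 := sH h hH.
  have := dirichlet_cos R (pi * (h%:R * alpha)) N; set y := pi * _ => e.
  have -> : sin ((2 * N%:R + 1) * y) = sin y + sin y * \sum_(1 <= r < N.+1) (2 * cos (r%:R * (2 * y))).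
    by rewrite e addrCA subrr addr0.
  rewrite -mulr_sumr.
  have -> : \sum_(1 <= i < N.+1) cos (h%:R * (2 * (pi * (i%:R * alpha)))) / h%:R =
     h%:R^-1 * \sum_(1 <= r < N.+1) cos (r%:R * (2 * y)).
    rewrite mulr_sumr; apply: eq_bigr => r _; rewrite mulrC; congr (_ * cos _).
    rewrite /y; ring.
  move: (\sum_(1 <= r < N.+1) cos (r%:R * (2 * y))) (sin y) s0 => A B B0.
  by field; rewrite ?h0 ?B0.
rewrite -big_split/=; apply: le_trans (ler_norm_sum _ _ _) _.
rewrite mulr_sumr; apply: ler_sum_nat => r rN.
by rewrite -invfM; apply: log_sin_fourier; exact: sN.
Qed.

(** * Nonnegative sine sums and Abel summation *)

Lemma sin_natpi (R : realType) (n : nat) : sin (n%:R * pi) = 0 :> R.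
Proof.
elim: n => [|n IH]; first by rewrite mul0r sin0.
by rewrite -natr1 mulrDl mul1r sinD IH sinpi mul0r mulr0 addr0.
Qed.

Lemma is_derive_sin_series (R : realType) (n : nat) (t : R) :
  is_derive t 1 (fun t : R => \sum_(1 <= j < n.+1) sin (j%:R * t) / j%:R)
    (\sum_(1 <= j < n.+1) cos (j%:R * t)).
Proof.
elim: n => [|n IH].
  rewrite big_nil [X in is_derive _ _ X](_ : _ = cst 0); first exact: is_derive_cst.
  by apply/funext => u; rewrite big_nil.
rewrite big_nat_recr//=.
rewrite [X in is_derive _ _ X](_ : _ = (fun t : R =>
    \sum_(1 <= j < n.+1) sin (j%:R * t) / j%:R + n.+1%:R^-1 * sin (n.+1%:R * t))); last first.
  by apply/funext => u; rewrite big_nat_recr//=; congr (_ + _); rewrite mulrC.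
have h1 := is_derive_cmul R id 1 n.+1%:R t (is_derive_id _ _).
have h2 := @is_derive1_comp R sin (fun u => n.+1%:R * u) t _ _ (is_derive_sin _) h1.
have h3 := is_derive_cmul R _ _ n.+1%:R^-1 t h2.
refine (derive_eq _ _ _ _ _ (is_derive_add _ _ _ _ _ _ IH h3) _); congr (_ + _).
have n0 : (n.+1%:R : R) != 0 by rewrite pnatr_eq0.
by rewrite mulr1 mulrCA mulVf// mulr1.
Qed.

(* Induction on n: at an interior minimum the derivative vanishes, which forces the last
   term to be nonnegative there. *)
Lemma fejer_jackson (R : realType) (n : nat) (phi : R) : 0 <= phi <= pi ->
  0 <= \sum_(1 <= j < n.+1) sin (j%:R * phi) / j%:R.
Proof.
elim: n phi => [|n IH] phi phi01; first by rewrite big_nil.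
set f := fun t : R => \sum_(1 <= j < n.+2) sin (j%:R * t) / j%:R.
have [||c cI cmin] := @EVT_min R f 0 pi.
- exact: pi_ge0.
- apply: derivable_within_continuous => x _; have [] := is_derive_sin_series R n.+1 x.
  by [].
suff : 0 <= f c by move=> fc; apply: le_trans fc (cmin phi _); rewrite in_itv.
have [c0|c0] := eqVneq c 0.
  by rewrite /f c0 big1// => j _; rewrite mulr0 sin0 mul0r.
have [cp|cp] := eqVneq c pi.
  by rewrite /f cp big1// => j _; rewrite sin_natpi mul0r.
move: cI; rewrite in_itv/= => /andP[c_0 c_pi].
have cgt : 0 < c by rewrite lt_neqAle eq_sym c0.
have clt : c < pi by rewrite lt_neqAle cp.
have cI : c \in `]0, pi[ by rewrite in_itv/= cgt.
have dc : is_derive c 1 f 0.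
  apply: (derive1_at_min (pi_ge0 R)) cI _ => t.
    by move=> _; have [] := is_derive_sin_series R n.+1 t.
  by rewrite in_itv/= => /andP[t0 tp]; apply: cmin; rewrite in_itv/= !ltW.
have d0 : \sum_(1 <= j < n.+2) cos (j%:R * c) = 0.
  have := is_derive_sin_series R n.+1 c => d.
  by rewrite -(@derive_val _ _ _ _ _ _ _ d) (@derive_val _ _ _ _ _ _ _ dc).
rewrite /f big_nat_recr//=; apply: addr_ge0; first by apply: IH; rewrite c_0.
apply: divr_ge0 => //.
have := dirichlet_cos R (c / 2) n.+1.
have -> : 2 * (c / 2) = c :> R by field.
rewrite -mulr_sumr d0 !mulr0 => /esym /eqP; rewrite subr_eq0 => /eqP e.
have -> : n.+1%:R * c = (2 * n.+1%:R + 1) * (c / 2) - c / 2 by field.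
rewrite sinB e; set C := cos ((2 * _ + 1) * _); set a := sin (c / 2); set b := cos (c / 2).
have b0 : 0 <= b by apply: cos_ge0_pihalf; have := pi_gt0 R; lra.
have a0 : 0 <= a by apply: sin_ge0_pi; have := pi_gt0 R; lra.
have CC : C ^+ 2 = b ^+ 2.
  by rewrite /C cos2sin2 e -/a /a -cos2sin2.
have Cb : C <= b.
  rewrite leNgt; apply/negP => bC; move: CC; nra.
nra.
Qed.

(** Induction on a_n B_n <= sum_{j <= n} a_j b_j, where B_n is the partial sum of b: passing from
    a_n to the smaller a_{n+1} in front of B_n >= 0 only lowers the left side. *)
Lemma abel_ge0 (R : realType) (a b : nat -> R) (J : nat) :
  (forall n, (1 <= n <= J)%N -> 0 <= \sum_(1 <= j < n.+1) b j) ->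
  (forall n, (1 <= n < J)%N -> a n.+1 <= a n) ->
  (forall n, (1 <= n <= J)%N -> 0 <= a n) ->
  0 <= \sum_(1 <= j < J.+1) a j * b j.
Proof.
move=> b0 am a0.
suff H n : (1 <= n <= J)%N -> a n * \sum_(1 <= j < n.+1) b j <= \sum_(1 <= j < n.+1) a j * b j.
  case: J b0 am a0 H => [|J] b0 am a0 H; first by rewrite big_nil.
  by apply: le_trans (H J.+1 _); rewrite ?leqnn ?andbT// mulr_ge0// ?a0 ?b0 ?leqnn ?andbT.
elim: n => [//|n IH] /andP[_ nJ].
have [->|n0] := posnP n; first by rewrite !big_nat1.
rewrite big_nat_recr//= [X in _ <= X]big_nat_recr//= mulrDr lerD2r.
have h1 : (1 <= n <= J)%N by rewrite n0 ltnW.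
apply: le_trans (IH h1); apply: ler_wpM2r; first exact: b0.
by apply: am; rewrite n0.
Qed.

(** Lowering [a 1] to [a 2] keeps the sequence nonincreasing, so [abel_ge0] still applies; what was
    removed is the lower bound. *)
Lemma abel_ge (R : realType) (a b : nat -> R) (J : nat) : (2 <= J)%N ->
  (forall n, (1 <= n <= J)%N -> 0 <= \sum_(1 <= j < n.+1) b j) ->
  (forall n, (1 <= n < J)%N -> a n.+1 <= a n) ->
  (forall n, (1 <= n <= J)%N -> 0 <= a n) ->
  (a 1%N - a 2) * b 1%N <= \sum_(1 <= j < J.+1) a j * b j.
Proof.
move=> J2 b0 am a0.
pose a' n := if n == 1%N then a 2 else a n.
have := @abel_ge0 R a' b J b0.
have -> : \sum_(1 <= j < J.+1) a j * b j = (a 1%N - a 2) * b 1%N + \sum_(1 <= j < J.+1) a' j * b j.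
  case: J J2 {b0 am a0} => // J J2.
  rewrite big_nat_recl// [X in _ = _ + X]big_nat_recl//= /a' /= addrA -mulrDl subrK.
  congr (_ + _); rewrite big_nat [RHS]big_nat; apply: eq_bigr => i /andP[i1 _].
  by case: i i1.
move=> h; rewrite lerDl; apply: h => n.
  move=> /andP[n1 nJ]; rewrite /a'; have [->|n_1] := eqVneq n 1%N; first by [].
  by rewrite (_ : (n.+1 == 1)%N = false) ?am ?n1//; case: n n1 n_1 {nJ}.
by move=> nJ; rewrite /a'; case: eqP => _; apply: a0.
Qed.

(** * Mean squares of sine polynomials *)

(** With truncated subtraction [(h - k) + (k - h)] is |h - k|, and each positive distance occurs for
    at most two k. *)
Lemma sum_dist_le (R : realType) (g : nat -> R) (H h : nat) :
  (forall d, (1 <= d)%N -> 0 <= g d) -> (1 <= h <= H)%N ->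
  \sum_(1 <= k < H.+1) g ((h - k) + (k - h))%N <=
  g 0%N + 2 * \sum_(1 <= d < H.+1) g d.
Proof.
move=> g0 /andP[h1 hH].
have sub m : (m <= H)%N -> \sum_(1 <= d < m.+1) g d <= \sum_(1 <= d < H.+1) g d.
  move=> mH; rewrite (@big_cat_nat _ _ _ m.+1 1 H.+1)//= lerDl big_nat sumr_ge0// => i /andP[i1 _].
  by apply: g0; apply: leq_trans i1.
rewrite (@big_cat_nat _ _ _ h 1 H.+1)//=; last exact: leqW.
rewrite [X in _ + X <= _]big_ltn// subnn addn0.
have -> : \sum_(1 <= k < h) g (h - k + (k - h))%N = \sum_(1 <= d < h) g d.
  rewrite big_nat_rev /=; apply: eq_big_nat => i /andP[i1 ih].
  by congr g; lia.
have -> : \sum_(h.+1 <= k < H.+1) g (h - k + (k - h))%N = \sum_(1 <= d < (H - h).+1) g d.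
  rewrite -{1}(add1n h) big_addn subSn//; apply: eq_big_nat => i /andP[i1 ih].
  by congr g; lia.
have -> : \sum_(1 <= d < h) g d = \sum_(1 <= d < h.-1.+1) g d by rewrite prednK.
have := sub h.-1; have := sub (H - h)%N.
move=> /(_ (leq_subr _ _)) s1 /(_ (leq_trans (leq_pred _) hH)) s2; lra.
Qed.

(** Summing over v and then over u with [dirichlet_phase] gives sin(2Ly) sin(Ly) cos(...) /
    sin(y)^2. The average over the shifts u is what gains the second factor 1 / sin y. *)
Lemma double_kernel_le (R : realType) (L : nat) (y : R) :
  `|\sum_(0 <= u < L) \sum_(0 <= v < 2 * L) cos ((2 * (v%:R - u%:R) + 1) * y)| * sin y ^+ 2
  <= 1 :> R.
Proof.
have -> : sin y ^+ 2 = `|sin y ^+ 2| by rewrite ger0_norm// sqr_ge0.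
rewrite -normrM.
have -> : (\sum_(0 <= u < L) \sum_(0 <= v < 2 * L) cos ((2 * (v%:R - u%:R) + 1) * y)) * sin y ^+ 2
  = sin ((2 * L)%N%:R * y) * (sin (L%:R * y) * cos ((L%:R - 1) * y - (2 * L)%N%:R * y)).
  have e1 := dirichlet_phase R y (- ((2 * L)%N%:R * y)) L.
  rewrite -e1 [RHS]mulrCA expr2 mulrA [LHS]mulrC; congr (_ * _).
  rewrite mulr_suml mulr_sumr; apply: eq_bigr => u _.
  have -> : cos (u%:R * (2 * y) - (2 * L)%N%:R * y) =
    cos (((2 * L)%N%:R - 1) * y + (1 - 2 * u%:R) * y).
    by rewrite -cosN; congr cos; ring.
  rewrite -dirichlet_phase mulrC; congr (_ * _); apply: eq_bigr => v _; congr cos; ring.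
rewrite !normrM; apply: mulr_ile1; rewrite ?normr_ge0 ?sin_max ?mulr_ge0//.
by apply: mulr_ile1; rewrite ?normr_ge0 ?sin_max ?cos_max.
Qed.

(* Duality: add the corresponding cosine sum, average over L shifts and apply Schur's test to
   the resulting double Dirichlet kernel. *)
Lemma mean_square_sin (R : realType) (alpha : R) (c : nat -> R) (H L : nat) :
  (1 <= L)%N ->
  (forall d, (1 <= d <= H)%N -> sin (pi * (d%:R * alpha)) != 0) ->
  \sum_(0 <= N < L)
     (\sum_(1 <= h < H.+1) c h * sin ((2 * N%:R + 1) * (pi * (h%:R * alpha)))) ^+ 2
  <= (\sum_(1 <= h < H.+1) c h ^+ 2) *
     (2 * L%:R + 2 / L%:R * \sum_(1 <= d < H.+1) (sin (pi * (d%:R * alpha)) ^+ 2)^-1).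
Proof.
move=> L1 sH.
pose th h : R := pi * (h%:R * alpha).
pose X (t : R) : R := \sum_(1 <= h < H.+1) c h * sin (t * th h).
pose Y (t : R) : R := \sum_(1 <= h < H.+1) c h * cos (t * th h).
have L0 : 0 < L%:R :> R by rewrite ltr0n.
pose kap d : R := if d == 0%N then 2 * L%:R ^+ 2 else (sin (pi * (d%:R * alpha)) ^+ 2)^-1.
have kap0 d : 0 <= kap d.
  rewrite /kap; case: ifP => _; first by rewrite mulr_ge0// sqr_ge0.
  by rewrite invr_ge0 sqr_ge0.
have XY t : X t ^+ 2 + Y t ^+ 2 =
    \sum_(1 <= h < H.+1) \sum_(1 <= k < H.+1) c h * c k * cos (t * (th h - th k)).
  rewrite !expr2 /X /Y !mulr_suml -big_split/=; apply: eq_bigr => h _.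
  rewrite !mulr_sumr -big_split/=; apply: eq_bigr => k _.
  rewrite mulrBr cosB; ring.
(* For each shift u < L the window u <= v < u + L lies in [0, 2L) and reproduces all N < L, so the
   double sum dominates L copies of the sum over N. *)
have step1 : L%:R * \sum_(0 <= N < L) X (2 * N%:R + 1) ^+ 2 <=
    \sum_(0 <= u < L) \sum_(0 <= v < 2 * L)
       (X (2 * (v%:R - u%:R) + 1) ^+ 2 + Y (2 * (v%:R - u%:R) + 1) ^+ 2).
  have -> : L%:R * \sum_(0 <= N < L) X (2 * N%:R + 1) ^+ 2 =
    \sum_(0 <= u < L) \sum_(0 <= N < L) X (2 * N%:R + 1) ^+ 2.
    by rewrite sumr_const_nat subn0 mulr_natl.
  apply: ler_sum_nat => u /andP[_ uL].
  have pos m n (P : nat -> R) : (forall i, 0 <= P i) -> 0 <= \sum_(m <= i < n) P i.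
    by move=> P0; apply: sumr_ge0.
  have nn i : 0 <= X (2 * (i%:R - u%:R) + 1) ^+ 2 + Y (2 * (i%:R - u%:R) + 1) ^+ 2.
    by rewrite addr_ge0// sqr_ge0.
  rewrite (@big_cat_nat _ _ _ u 0 (2 * L))//=; last by lia.
  rewrite (@big_cat_nat _ _ _ (u + L) u (2 * L))//=; [|lia|lia].
  apply: ler_wpDl; first exact: pos.
  apply: ler_wpDr; first exact: pos.
  rewrite -{1}(add0n u) big_addn addKn; apply: ler_sum => N _.
  by rewrite natrD addrK lerDl sqr_ge0.
have Kle h k : (1 <= h <= H)%N -> (1 <= k <= H)%N ->
   `|\sum_(0 <= u < L) \sum_(0 <= v < 2 * L) cos ((2 * (v%:R - u%:R) + 1) * (th h - th k))|
   <= kap ((h - k) + (k - h))%N.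
  move=> hH kH; rewrite /kap; have [e|ne] := eqVneq h k.
    rewrite e subnn /= subrr.
    apply: le_trans (ler_norm_sum _ _ _) _.
    apply: le_trans (_ : \sum_(0 <= u < L) (2 * L)%N%:R <= _).
      apply: ler_sum => u _; apply: le_trans (ler_norm_sum _ _ _) _.
      apply: le_trans (_ : \sum_(0 <= v < 2 * L) 1 <= _).
        by apply: ler_sum => v _; exact: cos_max.
      by rewrite sumr_const_nat subn0.
    rewrite sumr_const_nat subn0 -mulr_natl natrM; lra.
  have dn0 : ((h - k) + (k - h) == 0)%N = false by apply/negP => /eqP; lia.
  rewrite dn0.
  have s2 : sin (pi * (((h - k) + (k - h))%N%:R * alpha)) ^+ 2 = sin (th h - th k) ^+ 2.
    have [hk|kh] := leqP h k.
      have -> : pi * (((h - k) + (k - h))%N%:R * alpha) = - (th h - th k) :> R.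
        have -> : ((h - k) + (k - h) = k - h)%N by lia.
        rewrite natrB// /th; ring.
      by rewrite sinN sqrrN.
    have -> : pi * (((h - k) + (k - h))%N%:R * alpha) = th h - th k :> R.
      have -> : ((h - k) + (k - h) = h - k)%N by lia.
      rewrite natrB ?(ltnW kh)// /th; ring.
    by [].
  rewrite s2.
  have sg : 0 < sin (th h - th k) ^+ 2.
    rewrite -s2 exprn_even_gt0//= sH//; lia.
  by rewrite -[X in _ <= X]mul1r ler_pdivlMr//; exact: double_kernel_le.
rewrite -(@ler_pM2l _ L%:R)//; apply: le_trans step1 _.
have -> : \sum_(0 <= u < L) \sum_(0 <= v < 2 * L)
       (X (2 * (v%:R - u%:R) + 1) ^+ 2 + Y (2 * (v%:R - u%:R) + 1) ^+ 2) =
   \sum_(1 <= h < H.+1) \sum_(1 <= k < H.+1) c h * c k *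
     \sum_(0 <= u < L) \sum_(0 <= v < 2 * L) cos ((2 * (v%:R - u%:R) + 1) * (th h - th k)).
  under eq_bigr => u _ do under eq_bigr => v _ do rewrite XY.
  under eq_bigr => u _ do (rewrite exchange_big_nat /=; under eq_bigr => h _ do rewrite exchange_big_nat /=).
  rewrite exchange_big_nat /=; apply: eq_bigr => h _; rewrite exchange_big_nat /=.
  apply: eq_bigr => k _; rewrite mulr_sumr; apply: eq_bigr => u _.
  by rewrite mulr_sumr.
pose S := \sum_(1 <= d < H.+1) (sin (pi * (d%:R * alpha)) ^+ 2)^-1.
have ksum h : (1 <= h <= H)%N -> \sum_(1 <= k < H.+1) kap ((h - k) + (k - h))%N <= 2 * L%:R ^+ 2 + 2 * S.
  move=> hH; apply: le_trans (sum_dist_le _ kap H h _ hH) _.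
    by move=> d _; exact: kap0.
  rewrite /kap eqxx lerD2l ler_pM2l// le_eqVlt; apply/orP; left; apply/eqP.
  by apply: eq_big_nat => d /andP[d1 _]; case: d d1.
(* Schur's test: |c_h c_k| <= (c_h^2 + c_k^2) / 2, after which the kernel is summed over one index
   with the other fixed. *)
apply: le_trans (_ : \sum_(1 <= h < H.+1) \sum_(1 <= k < H.+1)
   (2^-1 * (c h ^+ 2 * kap ((h - k) + (k - h))%N) + 2^-1 * (c k ^+ 2 * kap ((h - k) + (k - h))%N)) <= _).
  apply: ler_sum_nat => h hH; apply: ler_sum_nat => k kH.
  apply: le_trans (ler_norm _) _; rewrite normrM.
  apply: le_trans (_ : `|c h * c k| * kap ((h - k) + (k - h))%N <= _).
    by apply: ler_wpM2l; [exact: normr_ge0|exact: Kle].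
  have k0 : 0 <= kap ((h - k) + (k - h))%N by exact: kap0.
  rewrite !(mulrA 2^-1) -mulrDl; apply: ler_wpM2r => //.
  rewrite ler_norml; have := sqr_ge0 (c h - c k); have := sqr_ge0 (c h + c k).
  move=> h1 h2; apply/andP; split; nra.
under eq_bigr => h _ do rewrite big_split/=.
rewrite big_split/= [X in _ + X]exchange_big_nat /=.
have -> : \sum_(1 <= j < H.+1) \sum_(1 <= i < H.+1) 2^-1 * (c j ^+ 2 * kap (i - j + (j - i))%N)
  = \sum_(1 <= j < H.+1) \sum_(1 <= i < H.+1) 2^-1 * (c j ^+ 2 * kap (j - i + (i - j))%N).
  by apply: eq_bigr => j _; apply: eq_bigr => i _; rewrite addnC.
rewrite -big_split/=.
apply: le_trans (_ : \sum_(1 <= h < H.+1) c h ^+ 2 * (2 * L%:R ^+ 2 + 2 * S) <= _).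
  apply: ler_sum_nat => h hH.
  rewrite -big_split/=.
  have -> : \sum_(1 <= i < H.+1) (2^-1 * (c h ^+ 2 * kap (h - i + (i - h))%N) +
       2^-1 * (c h ^+ 2 * kap (h - i + (i - h))%N)) = c h ^+ 2 * \sum_(1 <= i < H.+1) kap (h - i + (i - h))%N.
    by rewrite mulr_sumr; apply: eq_bigr => i _; field.
  by apply: ler_wpM2l; [exact: sqr_ge0|exact: ksum].
rewrite -mulr_suml -/S; set A := \sum_(1 <= i < H.+1) c i ^+ 2.
suff -> : L%:R * (A * (2 * L%:R + 2 / L%:R * S)) = A * (2 * L%:R ^+ 2 + 2 * S) by exact: lexx.
by field; rewrite ?gt_eqF.
Qed.

(** * The distance to the nearest integer *)

Definition dint {R : realType} (x : R) : R := `|x - (Num.floor (x + 2^-1))%:~R|.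

Section Dint.
Context {R : realType}.
Implicit Types x y : R.

Lemma dint_ge0 x : 0 <= dint x. Proof. exact: normr_ge0. Qed.

Lemma dint_le_half x : dint x <= 2^-1.
Proof.
rewrite /dint; have := floor_itv (x + 2^-1); rewrite intrD => /andP[h1 h2].
rewrite ler_norml; apply/andP; split; lra.
Qed.

Lemma dint_le x (n : int) : dint x <= `|x - n%:~R|.
Proof.
have [h|h] := leP (2^-1) `|x - n%:~R|; first exact: le_trans (dint_le_half _) h.
have -> : dint x = `|x - n%:~R| => //.
rewrite /dint (_ : Num.floor _ = n)//; apply: floor_def; rewrite intrD.
move: h; rewrite ltr_norml => /andP[h1 h2]; apply/andP; split; lra.
Qed.

Lemma dint_ex x : exists n : int, dint x = `|x - n%:~R|.
Proof. by exists (Num.floor (x + 2^-1)). Qed.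

Lemma dint_small x (n : int) : `|x - n%:~R| <= 2^-1 -> dint x = `|x - n%:~R|.
Proof.
move=> h; apply/eqP; rewrite eq_le dint_le /=.
have [m ->] := dint_ex x.
have [->|mn] := eqVneq m n; first exact: lexx.
have : 1 <= `|(m - n)%:~R : R|.
  by rewrite -intr_norm ler1z -gtz0_ge1 normr_gt0 subr_eq0.
rewrite intrB; set a : R := m%:~R; set b : R := n%:~R => ab.
have : `|a - b| <= `|x - a| + `|x - b|.
  by rewrite [`|x - a|]distrC; apply: le_trans (ler_normD _ _); rewrite addrA subrK lexx.
lra.
Qed.

Lemma dintD x y : dint (x + y) <= dint x + `|y|.
Proof.
have [n ->] := dint_ex x; apply: le_trans (dint_le _ n) _.
by rewrite addrAC; exact: ler_normD.
Qed.

Lemma dintDz x (n : int) : dint (x + n%:~R) = dint x.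
Proof.
apply/eqP; rewrite eq_le; apply/andP; split.
  have [m ->] := dint_ex x; apply: le_trans (dint_le _ (m + n)) _.
  by rewrite intrD opprD addrACA subrr addr0.
have [m ->] := dint_ex (x + n%:~R); apply: le_trans (dint_le _ (m - n)) _.
rewrite intrB; suff -> : x - (m%:~R - n%:~R) = x + n%:~R - m%:~R by [].
ring.
Qed.

Lemma abs_sin_Dnatpi x (n : nat) : `|sin (pi * (x + n%:R))| = `|sin (pi * x)| :> R.
Proof.
elim: n => [|n IH]; first by rewrite addr0.
by rewrite -natr1 addrA mulrDr mulr1 sinDpi normrN.
Qed.

Lemma abs_sin_Dzpi x (n : int) : `|sin (pi * (x + n%:~R))| = `|sin (pi * x)| :> R.
Proof.
case: n => n; first exact: abs_sin_Dnatpi.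
by rewrite NegzE -(abs_sin_Dnatpi _ n.+1) mulrNz subrK.
Qed.

Lemma sin_le x : 0 <= x -> sin x <= x.
Proof.
move=> x0.
have := @nondecreasing_of_derive R (fun t => t + (-1) * sin t) (fun t => 1 + (-1) * cos t) 0 x x0.
rewrite sin0 mulr0 addr0 => h; rewrite -subr_ge0 -mulN1r.
have hd (t : R) : 0 <= t <= x -> is_derive t 1 (fun t : R => t + -1 * sin t) (1 + -1 * cos t).
  move=> _; have h1 := is_derive_cmul R sin _ (-1) t (is_derive_sin t).
  exact: (is_derive_add R id _ _ _ t (is_derive_id _ _) h1).
by apply: (h hd) => t _; have := cos_le1 t; lra.
Qed.

(** Weaker than Jordan's bound 2x, but elementary: with y = pi x, y cos y <= sin y and 1 - cos y <=
    sin y add up to y <= (1 + y) sin y <= 3 sin y, and y >= 2x. *)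
Lemma sin_ge_half x : 0 <= x <= 2^-1 -> x / 2 <= sin (pi * x).
Proof.
move=> /andP[x0 x1].
have pi2 := pi_ge2 R; have pi4 : pi <= 4 :> R by have := pihalf_lt2 R; lra.
set y := pi * x.
have y0 : 0 <= y by rewrite mulr_ge0// pi_ge0.
have yp : y <= pi / 2 by rewrite /y ler_pM2l ?pi_gt0//; lra.
have c0 : 0 <= cos y by apply: cos_ge0_pihalf; lra.
have s0 : 0 <= sin y by apply: sin_ge0_pi; have := pi_ge0 R; lra.
have h1 : y * cos y <= sin y.
  have := @nondecreasing_of_derive R (fun t => sin t + (- cos y) * t) (fun t => cos t + (- cos y) * 1) 0 y y0.
  rewrite sin0 mulr0 addr0 => h; rewrite -subr_ge0 mulrC -mulNr.
  have hd (t : R) : 0 <= t <= y -> is_derive t 1 (fun t : R => sin t + - cos y * t) (cos t + - cos y * 1).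
    move=> _; have h1' := is_derive_cmul R id 1 (- cos y) t (is_derive_id _ _).
    exact: (is_derive_add R sin _ _ _ t (is_derive_sin _) h1').
  apply: (h hd) => t /andP[t0 ty]; rewrite mulr1 subr_ge0.
  have [<-//|tny] := eqVneq t y.
  apply: ltW; rewrite ltr_cos ?in_itv//=; [by rewrite lt_neqAle tny|lra|]; have := pi_ge0 R; lra.
have h2 : 1 - cos y <= sin y.
  have : sin y ^+ 2 = 1 - cos y ^+ 2 by rewrite sin2cos2.
  have := cos_le1 y; have := sin_le1 y; nra.
have h3 : y <= sin y * (1 + y) by nra.
have y2 : y <= 2 by lra.
have : y <= 3 * sin y by nra.
have : 2 * x <= y by rewrite /y ler_wpM2r.
lra.
Qed.

Lemma dint_le_sin x : dint x / 2 <= `|sin (pi * x)|.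
Proof.
have [n e] := dint_ex x; have h := dint_le_half x; move: h; rewrite e.
have -> : `|sin (pi * x)| = `|sin (pi * (x - n%:~R))|.
  by rewrite -[in LHS](subrK n%:~R x) abs_sin_Dzpi.
move: (x - n%:~R) => y h.
have -> : `|sin (pi * y)| = `|sin (pi * `|y|)|.
  by have [y0|y0] := ger0P y => //; rewrite mulrN sinN normrN.
apply: le_trans (ler_norm _); apply: sin_ge_half; by rewrite normr_ge0.
Qed.

Lemma inv_sin_le_dint x : 0 < dint x -> `|sin (pi * x)|^-1 <= 2 / dint x.
Proof.
move=> d0; have h := dint_le_sin x.
rewrite -[2 / _]invrK invf_div lef_pV2 ?posrE ?divr_gt0//.
by apply: lt_le_trans h; rewrite divr_gt0.
Qed.

Lemma sin_neq0_dint x : 0 < dint x -> sin (pi * x) != 0.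
Proof.
move=> d0; rewrite -normr_gt0; apply: lt_le_trans (dint_le_sin x).
by rewrite divr_gt0.
Qed.

Lemma sum_inv_le (n : nat) : \sum_(1 <= r < n.+1) (r%:R : R)^-1 <= 1 + ln n%:R.
Proof.
elim: n => [|n IH]; first by rewrite big_nil ln0// addr0.
rewrite big_nat_recr//=; have [->|n0] := posnP n.
  by rewrite big_nil add0r invr1 ln1 addr0.
apply: le_trans (lerD IH (lexx _)) _; rewrite -addrA lerD2l.
have n0' : 0 < n%:R :> R by rewrite ltr0n.
have n1' : 0 < n.+1%:R :> R by rewrite ltr0n.
have := @le_ln1Dx R (- n.+1%:R^-1).
have -> : 1 + - n.+1%:R^-1 = n%:R / n.+1%:R :> R.
  by rewrite -(natr1 n); field; rewrite natr1 gt_eqF.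
rewrite ltrNl opprK invf_lt1// ltr1n ltnS => /(_ n0).
rewrite ln_div ?posrE//.
move: (ln n%:R) (ln n.+1%:R) (n.+1%:R^-1) => a b c; lra.
Qed.

Lemma sum_inv2_le (n : nat) : \sum_(1 <= r < n.+1) (r%:R ^+ 2 : R)^-1 <= 2.
Proof.
suff : \sum_(1 <= r < n.+2) (r%:R ^+ 2 : R)^-1 <= 2 - n.+1%:R^-1.
  rewrite big_nat_recr//= => h; apply: le_trans (_ : 2 - n.+1%:R^-1 <= _).
    apply: le_trans h; rewrite lerDl invr_ge0 sqr_ge0//.
  by rewrite gerDl oppr_le0 invr_ge0.
elim: n => [|n IH]; first by rewrite big_nat1 expr1n invr1; lra.
rewrite big_nat_recr//=; apply: le_trans (lerD IH (lexx _)) _.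
have n0 : 0 < n.+1%:R :> R by rewrite ltr0n.
rewrite -subr_ge0 -(natr1 n.+1); move: (n.+1%:R) n0 => a a0.
have -> : 2 - (a + 1)^-1 - (2 - a^-1 + ((a + 1) ^+ 2)^-1) = (a * (a + 1) ^+ 2)^-1.
  by field; apply/andP; split; rewrite gt_eqF// addr_gt0.
by rewrite invr_ge0 mulr_ge0 ?sqr_ge0// ltW.
Qed.

Lemma dint_natdiv (q r : nat) : (1 <= r < q)%N ->
  Num.min (r%:R / q%:R) ((q - r)%:R / q%:R) <= dint (r%:R / q%:R : R).
Proof.
move=> /andP[r1 rq]; have q0 : 0 < q%:R :> R by rewrite ltr0n; lia.
have [n ->] := dint_ex (r%:R / q%:R).
rewrite natrB ?(ltnW rq)// mulrBl divff ?gt_eqF//.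
have x0 : 0 <= r%:R / q%:R :> R by rewrite divr_ge0.
have x1 : r%:R / q%:R <= 1 :> R by rewrite ler_pdivrMr// mul1r ler_nat ltnW.
move: (r%:R / q%:R) x0 x1 => x x0 x1.
have [n0|n1] := leP n 0.
  rewrite ge_min; apply/orP; left.
  have n0' : n%:~R <= 0 :> R by rewrite lerz0.
  apply: le_trans (ler_norm _); lra.
have n1' : 1 <= n%:~R :> R by rewrite ler1z.
rewrite ge_min; apply/orP; right; rewrite distrC; apply: le_trans (ler_norm _); lra.
Qed.

Lemma dint_natdiv_ge (q r : nat) : (1 <= r < q)%N -> q%:R^-1 <= dint (r%:R / q%:R : R).
Proof.
move=> /andP[r1 rq]; apply: le_trans (dint_natdiv q r _); last by rewrite r1.
have q0 : 0 < q%:R :> R by rewrite ltr0n; lia.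
by rewrite le_min; apply/andP; split; rewrite -[X in X <= _]mul1r ler_pM2r ?invr_gt0// ler1n ?subn_gt0.
Qed.

Lemma inv_dint_natdiv (q r : nat) : (1 <= r < q)%N ->
  (dint (r%:R / q%:R : R))^-1 <= q%:R * (r%:R^-1 + (q - r)%:R^-1).
Proof.
move=> /[dup] rq /andP[r1 r2]; have := dint_natdiv q r rq.
have q0 : 0 < q%:R :> R by rewrite ltr0n; lia.
have r0 : 0 < r%:R :> R by rewrite ltr0n.
have s0 : 0 < (q - r)%:R :> R by rewrite ltr0n subn_gt0.
have d0 : 0 < dint (r%:R / q%:R : R) by apply: lt_le_trans (dint_natdiv_ge q r rq); rewrite invr_gt0.
rewrite ge_min mulrDr => /orP[h|h].
  apply: ler_wpDr; first by rewrite divr_ge0// ltW.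
  by rewrite -[X in _ <= X]invrK lef_pV2 ?posrE ?invr_gt0 ?divr_gt0// invf_div.
apply: ler_wpDl; first by rewrite divr_ge0// ltW.
by rewrite -[X in _ <= X]invrK lef_pV2 ?posrE ?invr_gt0 ?divr_gt0// invf_div.
Qed.

Lemma sum_rev1 (F : nat -> R) q : \sum_(1 <= r < q) F (q - r)%N = \sum_(1 <= r < q) F r.
Proof.
by rewrite big_nat_rev /=; apply: eq_big_nat => i /andP[i1 iq]; congr F; lia.
Qed.

Lemma sum_inv_dint_natdiv (q : nat) : (0 < q)%N ->
  \sum_(1 <= r < q) (dint (r%:R / q%:R : R))^-1 <= 2 * q%:R * (1 + ln q%:R).
Proof.
move=> q0; apply: le_trans (_ : \sum_(1 <= r < q) q%:R * (r%:R^-1 + (q - r)%:R^-1) <= _).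
  by apply: ler_sum_nat => r; exact: inv_dint_natdiv.
rewrite -mulr_sumr big_split/= (sum_rev1 (fun r => r%:R^-1)).
have h : \sum_(1 <= r < q) (r%:R : R)^-1 <= 1 + ln q%:R.
  by apply: le_trans (sum_inv_le q); rewrite big_nat_recr//= lerDl invr_ge0.
have q0' : 0 <= q%:R :> R by [].
nra.
Qed.

Lemma sum_inv2_dint_natdiv (q : nat) : (0 < q)%N ->
  \sum_(1 <= r < q) (dint (r%:R / q%:R : R) ^+ 2)^-1 <= 8 * q%:R ^+ 2.
Proof.
move=> q0; apply: le_trans (_ : \sum_(1 <= r < q) q%:R ^+ 2 * (2 * (r%:R ^+ 2)^-1 + 2 * ((q - r)%:R ^+ 2)^-1) <= _).
  apply: ler_sum_nat => r rq; have := inv_dint_natdiv q r rq.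
  have d0 : 0 <= (dint (r%:R / q%:R : R))^-1 by rewrite invr_ge0 dint_ge0.
  rewrite -!exprVn; move: (dint _)^-1 (r%:R^-1) ((q - r)%:R^-1) d0 => d a b d0 dab.
  apply: le_trans (_ : (q%:R * (a + b)) ^+ 2 <= _).
    by rewrite ler_sqr ?nnegrE//; exact: le_trans dab.
  rewrite exprMn; apply: ler_wpM2l; first exact: sqr_ge0.
  have := sqr_ge0 (a - b); nra.
rewrite -mulr_sumr big_split/= -!mulr_sumr (sum_rev1 (fun r => (r%:R ^+ 2)^-1)).
have h : \sum_(1 <= r < q) (r%:R ^+ 2 : R)^-1 <= 2.
  by apply: le_trans (sum_inv2_le q); rewrite big_nat_recr//= lerDl invr_ge0 sqr_ge0.
have q0' : 0 <= q%:R ^+ 2 :> R by rewrite sqr_ge0.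
nra.
Qed.

Lemma dint_intdiv_mod (p : int) (q s : nat) : (0 < q)%N ->
  dint (s%:R * (p%:~R / q%:R) : R) = dint (((s * `|(p %% q)%Z|) %% q)%N%:R / q%:R).
Proof.
move=> q0; have q0' : q%:R != 0 :> R by rewrite pnatr_eq0 -lt0n.
have P0 : (p %% q)%Z = `|(p %% q)%Z|%N :> int.
  by rewrite gez0_abs// modz_ge0//; case: q q0 {q0'}.
set P := `|(p %% q)%Z|%N in P0 *.
have -> : s%:R * (p%:~R / q%:R) = ((s * P) %% q)%N%:R / q%:R +
   ((s%:Z * (p %/ q)%Z + ((s * P) %/ q)%N%:Z))%:~R :> R.
  rewrite [in LHS](divz_eq p q) P0 !(intrD, intrM) -!pmulrn.
  have -> : (s%:R : R) * (((p %/ q)%Z%:~R * q%:R + P%:R) / q%:R) = s%:R * (p %/ q)%Z%:~R + (s * P)%N%:R / q%:R.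
    rewrite natrM; field; exact: q0'.
  rewrite [in LHS](divn_eq (s * P) q) natrD natrM; field; exact: q0'.
by rewrite dintDz.
Qed.

(** Multiplication by p permutes the nonzero residues mod q; injectivity and a count suffice. *)
Lemma sum_dint_coprime (F : R -> R) (p : int) (q : nat) : (0 < q)%N -> coprimez p q ->
  \sum_(1 <= s < q) F (dint (s%:R * (p%:~R / q%:R))) = \sum_(1 <= r < q) F (dint (r%:R / q%:R)).
Proof.
move=> q0 cpq; set P := `|(p %% q)%Z|%N.
have cP : coprime q P.
  have P0 : (p %% q)%Z = P%:Z by rewrite gez0_abs// modz_ge0//; case: q q0 {cpq P}.
  by move: cpq; rewrite /coprimez -gcdz_modl P0 coprime_sym.
have -> : \sum_(1 <= s < q) F (dint (s%:R * (p%:~R / q%:R))) =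
   \sum_(r <- [seq ((s * P) %% q)%N | s <- index_iota 1 q]) F (dint (r%:R / q%:R)).
  by rewrite big_map; apply: eq_bigr => s _; rewrite dint_intdiv_mod.
apply: perm_big.
have u : uniq [seq ((s * P) %% q)%N | s <- index_iota 1 q].
  rewrite map_inj_in_uniq ?iota_uniq// => s t; rewrite !mem_index_iota => /andP[s1 sq] /andP[t1 tq].
  wlog st : s t s1 sq t1 tq / (s <= t)%N.
    move=> H e; have [st|ts] := leqP s t; first exact: H.
    by apply/esym; apply: H => //; exact: ltnW.
  move=> /eqP; rewrite eq_sym eqn_mod_dvd ?leq_mul2r ?st ?orbT// -mulnBl Gauss_dvdl// => qd.
  have [|d0] := posnP (t - s); first by move/eqP; rewrite subn_eq0 => ts; apply/eqP; rewrite eqn_leq st.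
  by have := dvdn_leq d0 qd; lia.
apply: uniq_perm => //; first exact: iota_uniq.
have sub : {subset [seq ((s * P) %% q)%N | s <- index_iota 1 q] <= index_iota 1 q}.
  move=> r /mapP[s]; rewrite !mem_index_iota => /andP[s1 sq] ->.
  rewrite ltn_mod q0 andbT lt0n; apply/negP => /eqP /eqP; rewrite -/(dvdn q _) Gauss_dvdl// => qs.
  by have := dvdn_leq s1 qs; lia.
by have [] := uniq_min_size u sub; rewrite ?size_map.
Qed.

Lemma dint_frac_ge (p : int) (q s : nat) : (0 < q)%N -> coprimez p q -> ~~ (q %| s)%N ->
  q%:R^-1 <= dint (s%:R * (p%:~R / q%:R) : R).
Proof.
move=> q0 cpq qs; rewrite dint_intdiv_mod//; apply: dint_natdiv_ge.
set P := `|(p %% q)%Z|%N.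
have cP : coprime q P.
  have P0 : (p %% q)%Z = P%:Z by rewrite gez0_abs// modz_ge0//; case: q q0 {cpq P qs}.
  by move: cpq; rewrite /coprimez -gcdz_modl P0 coprime_sym.
by rewrite ltn_mod q0 andbT lt0n -/(dvdn q _) Gauss_dvdl.
Qed.

End Dint.

(** * Sums over multiples of alpha close to a rational *)

Section Approx.
Context {R : realType}.

Lemma sum_block_le (F W : nat -> R) (q H : nat) : (0 < q)%N ->
  (forall h, 0 <= F h) ->
  (forall i, (i <= H %/ q)%N -> \sum_(1 <= s < q) F (i * q + s)%N <= W i) ->
  \sum_(1 <= h < H.+1 | ~~ (q %| h)%N) F h <= \sum_(0 <= i < (H %/ q).+1) W i.
Proof.
move=> q0 F0 FW.
pose G h := if (q %| h)%N then 0 else F h.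
have G0 h : 0 <= G h by rewrite /G; case: ifP.
have -> : \sum_(1 <= h < H.+1 | ~~ (q %| h)%N) F h = \sum_(1 <= h < H.+1) G h.
  by rewrite big_mkcond; apply: eq_bigr => h _; rewrite /G; case: (q %| h)%N.
have Hq : (H < (H %/ q).+1 * q)%N by exact: ltn_ceil.
apply: le_trans (_ : \sum_(0 <= h < (H %/ q).+1 * q) G h <= _).
  rewrite (@big_cat_nat _ _ _ 1 0 ((H %/ q).+1 * q))//=; last by lia.
  rewrite (@big_cat_nat _ _ _ H.+1 1 ((H %/ q).+1 * q))//=.
  by apply: ler_wpDl; [|apply: ler_wpDr => //]; exact: sumr_ge0.
rewrite big_nat_mul; apply: ler_sum_nat => i /andP[_ iH].
apply: le_trans (FW i iH).
change (\sum_(i * q <= j < i.+1 * q) G j <= \sum_(1 <= s < q) F (i * q + s)%N).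
rewrite big_ltn ?ltn_pmul2r// {1}/G dvdn_mull// add0r.
rewrite -(addn1 (i * q)) addnC big_addn mulSn addnK.
rewrite le_eqVlt; apply/orP; left; apply/eqP; apply: eq_big_nat => s /andP[s1 sq].
by rewrite addnC /G dvdn_addr ?dvdn_mull// gtnNdvd.
Qed.

Lemma sum_multiples (F : nat -> R) (q H : nat) : (0 < q)%N ->
  \sum_(1 <= h < H.+1 | (q %| h)%N) F h = \sum_(1 <= j < (H %/ q).+1) F (j * q)%N.
Proof.
move=> q0; elim: H => [|H IH]; first by rewrite div0n !big_nil.
rewrite big_mkcond big_nat_recr//= -big_mkcond IH.
case: ifP => qH.
  have e2 : (H.+1 %/ q = (H %/ q).+1)%N by rewrite divnS// qH.
  have e3 : (H.+1 = (H %/ q).+1 * q)%N by rewrite -e2 divnK.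
  by rewrite e2 [RHS]big_nat_recr//= -e3.
by rewrite addr0 divnS// qH.
Qed.

Variables (alpha : R) (p : int) (q H : nat) (eps : R).
Let beta : R := `|q%:R * alpha - p%:~R|.
Hypothesis q1 : (1 < q)%N.
Hypothesis cpq : coprimez p q.
Hypothesis eps_gt0 : 0 < eps.
Hypothesis beta_gt0 : 0 < beta.
Hypothesis Hbeta : H%:R * beta <= 1 - eps.

Let q0 : (0 < q)%N. Proof. exact: ltnW. Qed.
Let qR : 0 < q%:R :> R. Proof. by rewrite ltr0n. Qed.

(** The points h alpha and hp/q differ by h beta / q <= (1 - eps) / q, which is at most (1 - eps)
    ||hp/q|| because ||hp/q|| >= 1/q when q does not divide h. *)
Lemma approx_ndvd (h : nat) : (1 <= h <= H)%N -> ~~ (q %| h)%N ->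
  eps * dint (h%:R * (p%:~R / q%:R)) <= dint (h%:R * alpha).
Proof.
move=> /andP[h1 hH] qh.
have dge := @dint_frac_ge R p q h q0 cpq qh.
have := dintD (h%:R * alpha) (h%:R * (p%:~R / q%:R) - h%:R * alpha).
rewrite addrC subrK.
have -> : `|h%:R * (p%:~R / q%:R) - h%:R * alpha| = h%:R * beta / q%:R.
  have -> : h%:R * (p%:~R / q%:R) - h%:R * alpha = - (h%:R / q%:R) * (q%:R * alpha - p%:~R).
    by field; rewrite gt_eqF.
  rewrite normrM -/beta.
  have -> : `|- (h%:R / q%:R)| = h%:R / q%:R :> R by rewrite normrN ger0_norm ?divr_ge0.
  by rewrite mulrAC.
have hb : h%:R * beta / q%:R <= (1 - eps) / q%:R.
  rewrite ler_pM2r ?invr_gt0//; apply: le_trans Hbeta.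
  by rewrite ler_pM2r// ler_nat.
have e1 : 0 <= 1 - eps by apply: le_trans Hbeta; rewrite mulr_ge0// ltW.
have : (1 - eps) / q%:R <= (1 - eps) * dint (h%:R * (p%:~R / q%:R)) by apply: ler_wpM2l.
move=> h2 h3; move: (le_trans h3 (lerD (lexx _) (le_trans hb h2))); rewrite -lerBlDr => h4.
by apply: le_trans h4; rewrite mulrBl mul1r opprB addrCA subrr addr0.
Qed.

Lemma approx_ndvd_gt0 (h : nat) : (1 <= h <= H)%N -> ~~ (q %| h)%N ->
  0 < dint (h%:R * alpha).
Proof.
move=> hH qh; apply: lt_le_trans (approx_ndvd _ hH qh).
by rewrite mulr_gt0//; apply: lt_le_trans (@dint_frac_ge R p q h q0 cpq qh); rewrite invr_gt0.
Qed.

(** From q >= 2 and j q beta < 1. It makes j beta itself the distance from j q alpha to the nearest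
    integer. *)
Lemma approx_dvd_small (j : nat) : (j * q <= H)%N -> j%:R * beta <= 2^-1.
Proof.
move=> jH; have : (j * q)%N%:R * beta <= 1 - eps.
  by apply: le_trans Hbeta; rewrite ler_pM2r// ler_nat.
rewrite natrM; have : 2 <= q%:R :> R by rewrite ler_nat.
have : 0 <= j%:R * beta by rewrite mulr_ge0// ltW.
move: eps_gt0; move: beta => b; nra.
Qed.

Lemma approx_dvd (j : nat) : (j * q <= H)%N -> dint ((j * q)%N%:R * alpha) = j%:R * beta.
Proof.
move=> jH; have jb := approx_dvd_small j jH.
have e : `|(j * q)%N%:R * alpha - (j%:Z * p)%:~R| = j%:R * beta.
  rewrite intrM natrM -mulrA -[j%:Z%:~R]/(j%:R) -mulrBr normrM ger0_norm//.
by rewrite (@dint_small R _ (j%:Z * p)) e.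
Qed.

Lemma approx_gt0 (h : nat) : (1 <= h <= H)%N -> 0 < dint (h%:R * alpha).
Proof.
move=> hH; have [/dvdnP[j e]|] := boolP (q %| h)%N; last exact: approx_ndvd_gt0.
have [h1 h2] := andP hH.
rewrite e approx_dvd -?e// mulr_gt0// ltr0n lt0n; apply/eqP => j0.
by move: h1; rewrite e j0.
Qed.

Lemma ndvd_inv_le (h : nat) : (1 <= h <= H)%N -> ~~ (q %| h)%N ->
  (dint (h%:R * alpha))^-1 <= eps^-1 * (dint (h%:R * (p%:~R / q%:R)))^-1.
Proof.
move=> hH qh; rewrite -invfM lef_pV2 ?posrE; first exact: approx_ndvd.
  exact: approx_gt0.
by rewrite mulr_gt0//; apply: lt_le_trans (@dint_frac_ge R p q h q0 cpq qh); rewrite invr_gt0.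
Qed.

Lemma dint_block (i s : nat) :
  dint ((i * q + s)%N%:R * (p%:~R / q%:R)) = dint (s%:R * (p%:~R / q%:R)) :> R.
Proof.
have -> : (i * q + s)%N%:R * (p%:~R / q%:R) = s%:R * (p%:~R / q%:R) + (i%:Z * p)%:~R :> R.
  rewrite natrD natrM intrM -[i%:Z%:~R]/(i%:R); field; by rewrite gt_eqF.
exact: dintDz.
Qed.

Lemma block_sum1 (i : nat) :
  \sum_(1 <= s < q) (dint ((i * q + s)%N%:R * (p%:~R / q%:R) : R))^-1 <= 2 * q%:R * (1 + ln q%:R).
Proof.
under eq_bigr => s _ do rewrite dint_block.
by rewrite (sum_dint_coprime (fun x => x^-1)) ?sum_inv_dint_natdiv.
Qed.

Lemma block_sum2 (i : nat) :
  \sum_(1 <= s < q) (dint ((i * q + s)%N%:R * (p%:~R / q%:R) : R) ^+ 2)^-1 <= 8 * q%:R ^+ 2.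
Proof.
under eq_bigr => s _ do rewrite dint_block.
by rewrite (sum_dint_coprime (fun x => (x ^+ 2)^-1)) ?sum_inv2_dint_natdiv.
Qed.

Lemma sum_ndvd_le (w W : nat -> R) (F : R -> R) (B : R) :
  (forall h, 0 <= w h) -> (forall i s, (1 <= s < q)%N -> w (i * q + s)%N <= W i) ->
  (forall x, 0 <= x -> 0 <= F x) ->
  (forall i, 0 <= W i) ->
  (forall i, \sum_(1 <= s < q) F (dint ((i * q + s)%N%:R * (p%:~R / q%:R))) <= B) ->
  \sum_(1 <= h < H.+1 | ~~ (q %| h)%N) w h * F (dint (h%:R * (p%:~R / q%:R)))
  <= (\sum_(0 <= i < (H %/ q).+1) W i) * B.
Proof.
move=> w0 wW F0 W0 FB; rewrite mulr_suml; apply: sum_block_le => //.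
  by move=> h; rewrite mulr_ge0// F0// dint_ge0.
move=> i _; apply: le_trans (_ : \sum_(1 <= s < q) W i * F (dint ((i * q + s)%N%:R * (p%:~R / q%:R))) <= _).
  by apply: ler_sum_nat => s sq; apply: ler_wpM2r; [exact/F0/dint_ge0|exact: wW].
by rewrite -mulr_sumr; apply: ler_wpM2l.
Qed.

Lemma sum_split_dvd (F : nat -> R) :
  \sum_(1 <= h < H.+1) F h = \sum_(1 <= h < H.+1 | ~~ (q %| h)%N) F h +
     \sum_(1 <= j < (H %/ q).+1) F (j * q)%N.
Proof. by rewrite (bigID (fun h => (q %| h)%N))/= addrC sum_multiples. Qed.

Let Hq : (H %/ q)%N%:R <= H%:R / q%:R :> R.
Proof. by rewrite ler_pdivlMr// -natrM ler_nat leq_trunc_div. Qed.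

Lemma sum_ndvd_cond_le (F G : nat -> R) :
  (forall h, (1 <= h <= H)%N -> ~~ (q %| h)%N -> F h <= G h) ->
  \sum_(1 <= h < H.+1 | ~~ (q %| h)%N) F h <= \sum_(1 <= h < H.+1 | ~~ (q %| h)%N) G h.
Proof.
move=> FG; rewrite big_nat_cond [X in _ <= X]big_nat_cond.
by apply: ler_sum => h /andP[hH qh]; exact: FG.
Qed.

Lemma sum_inv_dint_le :
  \sum_(1 <= h < H.+1) (dint (h%:R * alpha))^-1 <=
  eps^-1 * (H%:R / q%:R + 1) * (2 * q%:R * (1 + ln q%:R)) + beta^-1 * (1 + ln (H %/ q)%N%:R).
Proof.
have lq : 0 <= 1 + ln q%:R :> R by rewrite addr_ge0// ln_ge0// ler1n.
rewrite sum_split_dvd; apply: lerD.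
  apply: le_trans (sum_ndvd_cond_le _ (fun h => eps^-1 * (dint (h%:R * (p%:~R / q%:R)))^-1) ndvd_inv_le) _.
  apply: le_trans (sum_ndvd_le (fun _ => eps^-1) (fun _ => eps^-1) (fun x => x^-1) _ _ _ _ _ block_sum1) _.
  - by move=> _; rewrite invr_ge0 ltW.
  - by [].
  - by move=> x; rewrite invr_ge0.
  - by move=> _; rewrite invr_ge0 ltW.
  rewrite sumr_const_nat subn0 -[_ *+ _]mulr_natr; apply: ler_wpM2r; first by rewrite !mulr_ge0.
  rewrite -natr1; apply: ler_wpM2l; first by rewrite invr_ge0 ltW.
  by rewrite lerD2r.
apply: le_trans (_ : beta^-1 * \sum_(1 <= j < (H %/ q).+1) j%:R^-1 <= _); last first.
  by apply: ler_wpM2l; [rewrite invr_ge0 ltW|exact: sum_inv_le].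
rewrite mulr_sumr; apply: ler_sum_nat => j /andP[j1 jH].
by rewrite approx_dvd ?invfM 1?mulrC//; rewrite -leq_divRL.
Qed.

Lemma sum_inv2_dint_le :
  \sum_(1 <= h < H.+1) (dint (h%:R * alpha) ^+ 2)^-1 <=
  eps^-1 ^+ 2 * (H%:R / q%:R + 1) * (8 * q%:R ^+ 2) + 2 * beta^-1 ^+ 2.
Proof.
rewrite sum_split_dvd; apply: lerD.
  apply: le_trans (sum_ndvd_cond_le _ (fun h => eps^-1 ^+ 2 * (dint (h%:R * (p%:~R / q%:R)) ^+ 2)^-1) _) _.
    move=> h hH qh; rewrite -!exprVn -exprMn ler_sqr ?nnegrE ?ndvd_inv_le// ?invr_ge0 ?dint_ge0//.
    by rewrite mulr_ge0// invr_ge0 ?dint_ge0// ltW.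
  apply: le_trans (sum_ndvd_le (fun _ => eps^-1 ^+ 2) (fun _ => eps^-1 ^+ 2) (fun x => (x ^+ 2)^-1) _ _ _ _ _ block_sum2) _.
  - by move=> _; rewrite sqr_ge0.
  - by [].
  - by move=> x _; rewrite invr_ge0 sqr_ge0.
  - by move=> _; rewrite sqr_ge0.
  rewrite sumr_const_nat subn0 -[_ *+ _]mulr_natr; apply: ler_wpM2r; first by rewrite mulr_ge0// sqr_ge0.
  rewrite -natr1; apply: ler_wpM2l; first by rewrite sqr_ge0.
  by rewrite lerD2r.
apply: le_trans (_ : beta^-1 ^+ 2 * \sum_(1 <= j < (H %/ q).+1) (j%:R ^+ 2)^-1 <= _); last first.
  by rewrite mulrC; apply: ler_wpM2r; [rewrite sqr_ge0|exact: sum_inv2_le].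
rewrite mulr_sumr; apply: ler_sum_nat => j /andP[j1 jH].
rewrite approx_dvd; last by rewrite -leq_divRL.
by rewrite exprMn invfM mulrC exprVn.
Qed.

(** The cut 2h > q bounds the weight 1/h by 2/q in the block of h < q, so every block costs its
    weight times q log q and the weights add up to a single logarithm of H/q. The smaller h are
    treated in mean square. *)
Lemma sum_inv_high_le :
  \sum_(1 <= h < H.+1 | ~~ (q %| h)%N) (if (q < 2 * h)%N then (h%:R * dint (h%:R * alpha))^-1 else 0)
  <= eps^-1 * (2 * (1 + ln q%:R) * (3 + ln (H %/ q)%N%:R)).
Proof.
have lq : 0 <= 1 + ln q%:R :> R by rewrite addr_ge0// ln_ge0// ler1n.
pose w h : R := if (q < 2 * h)%N then h%:R^-1 else 0.
pose W i : R := if i == 0%N then 2 / q%:R else (i%:R * q%:R)^-1.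
apply: le_trans (sum_ndvd_cond_le _ (fun h => eps^-1 * (w h * (dint (h%:R * (p%:~R / q%:R)))^-1)) _) _.
  move=> h hH qh; rewrite /w; case: ifP => _; last by rewrite mul0r mulr0.
  by rewrite mulrCA invfM; apply: ler_wpM2l; [rewrite invr_ge0|exact: ndvd_inv_le].
rewrite -mulr_sumr; apply: ler_wpM2l; first by rewrite invr_ge0 ltW.
apply: le_trans (sum_ndvd_le w W (fun x => x^-1) _ _ _ _ _ block_sum1) _.
- by move=> h; rewrite /w; case: ifP => _ //; rewrite invr_ge0.
- move=> i s /andP[s1 sq]; rewrite /w /W; case: eqVneq => [->|i0].
    rewrite mul0n add0n; case: ifP => [qs|_]; last by rewrite divr_ge0.
    rewrite -[2 / _]invrK invf_div lef_pV2 ?posrE ?divr_gt0// ?ltr0n//.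
    by rewrite ler_pdivrMr// -natrM ler_nat mulnC ltnW.
  have iq : (i * q + s)%N%:R^-1 <= (i%:R * q%:R)^-1 :> R.
    rewrite lef_pV2 ?posrE ?mulr_gt0// ?ltr0n ?lt0n// -?natrM ?ler_nat ?leq_addr//.
    by rewrite addn_eq0 negb_and -!lt0n s1 orbT.
  by case: ifP => _ //; rewrite invr_ge0 mulr_ge0.
- by move=> x; rewrite invr_ge0.
- by move=> i; rewrite /W; case: ifP => _; rewrite ?invr_ge0 ?divr_ge0 ?mulr_ge0.
have -> : \sum_(0 <= i < (H %/ q).+1) W i = q%:R^-1 * (2 + \sum_(1 <= i < (H %/ q).+1) i%:R^-1).
  rewrite big_ltn// {1}/W eqxx mulrDr (mulrC _ 2) mulr_sumr; congr (_ + _).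
  by apply: eq_big_nat => i /andP[i1 _]; case: i i1 => // i _; rewrite /W /= invfM mulrC.
have -> : q%:R^-1 * (2 + \sum_(1 <= i < (H %/ q).+1) i%:R^-1) * (2 * q%:R * (1 + ln q%:R))
   = 2 * (1 + ln q%:R) * (2 + \sum_(1 <= i < (H %/ q).+1) i%:R^-1) :> R.
  by field; rewrite gt_eqF.
apply: ler_wpM2l; first by rewrite mulr_ge0.
have := sum_inv_le (H %/ q) (R := R); lra.
Qed.

(** The block h < q is kept as it is, since its size depends on p/q; block i >= 1 contributes at
    most 8 / i^2. *)
Lemma sum_inv2_ndvd_le :
  \sum_(1 <= h < H.+1 | ~~ (q %| h)%N) ((h%:R * dint (h%:R * alpha)) ^+ 2)^-1
  <= eps^-1 ^+ 2 *
     (\sum_(1 <= h < q) ((h%:R * dint (h%:R * (p%:~R / q%:R))) ^+ 2)^-1 + 16).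
Proof.
apply: le_trans (sum_ndvd_cond_le _ (fun h => eps^-1 ^+ 2 *
    ((h%:R ^+ 2)^-1 * (dint (h%:R * (p%:~R / q%:R)) ^+ 2)^-1)) _) _.
  move=> h hH qh; rewrite mulrCA exprMn invfM; apply: ler_wpM2l; first by rewrite invr_ge0 sqr_ge0.
  rewrite -!exprVn -exprMn ler_sqr ?nnegrE ?ndvd_inv_le// ?invr_ge0 ?dint_ge0//.
  by rewrite mulr_ge0// invr_ge0 ?dint_ge0// ltW.
rewrite -mulr_sumr; apply: ler_wpM2l; first by rewrite sqr_ge0.
pose V := \sum_(1 <= h < q) ((h%:R * dint (h%:R * (p%:~R / q%:R))) ^+ 2 : R)^-1.
pose W i : R := if i == 0%N then V else 8 * (i%:R ^+ 2)^-1.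
apply: le_trans (sum_block_le _ W q H q0 _ _) _.
- by move=> h; rewrite mulr_ge0// invr_ge0 sqr_ge0.
- move=> i _; rewrite /W; case: eqVneq => [->|i0].
    rewrite /V le_eqVlt; apply/orP; left; apply/eqP; apply: eq_bigr => s _.
    by rewrite mul0n add0n -!exprVn -exprMn invfM.
  apply: le_trans (_ : \sum_(1 <= s < q) (i%:R * q%:R) ^- 2 * (dint ((i * q + s)%N%:R * (p%:~R / q%:R)) ^+ 2)^-1 <= _).
    apply: ler_sum_nat => s /andP[s1 sq]; apply: ler_wpM2r; first by rewrite invr_ge0 sqr_ge0.
    rewrite -!exprVn ler_sqr ?nnegrE ?invr_ge0 ?mulr_ge0//.
    rewrite lef_pV2 ?posrE ?mulr_gt0// ?ltr0n ?lt0n// -?natrM ?ler_nat ?leq_addr//.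
    by rewrite addn_eq0 negb_and -!lt0n s1 orbT.
  rewrite -mulr_sumr; apply: le_trans (ler_wpM2l _ (block_sum2 i)) _.
    by rewrite invr_ge0 sqr_ge0.
  rewrite le_eqVlt; apply/orP; left; apply/eqP.
  have e (a b : R) : a != 0 -> b != 0 -> ((a * b) ^+ 2)^-1 * (8 * b ^+ 2) = 8 * (a ^+ 2)^-1.
    by move=> a0 b0; field; rewrite ?a0 ?b0.
  by apply: e; [rewrite pnatr_eq0|rewrite gt_eqF].
rewrite big_ltn// {1}/W eqxx lerD2l.
apply: le_trans (_ : 8 * \sum_(1 <= i < (H %/ q).+1) (i%:R ^+ 2)^-1 <= _).
  rewrite mulr_sumr; apply: ler_sum_nat => i /andP[i1 _]; by case: i i1.
have := sum_inv2_le (H %/ q) (R := R); lra.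
Qed.

End Approx.

(** * Deterministic bounds for log P_N *)

(** The Dirichlet kernel 1 + 2 sum_{r <= N} cos(2 pi r x) where sin(pi x) is nonzero; it is even and
    1-periodic in x. *)
Definition dratio {R : realType} (N : nat) (x : R) : R :=
  sin ((2 * N%:R + 1) * (pi * x)) / sin (pi * x).

Section Dratio.
Context {R : realType}.
Implicit Types x : R.

Lemma dratioN N x : dratio N (- x) = dratio N x.
Proof. by rewrite /dratio !mulrN !sinN invrN mulrNN. Qed.

Lemma dratio_abs N x : dratio N `|x| = dratio N x.
Proof. by have [_|_] := ger0P x; rewrite ?dratioN. Qed.

Lemma sin_odd_Dpi N x : sin (x + (2 * N%:R + 1) * pi) = - sin x.
Proof.
elim: N => [|N IH]; first by rewrite mulr0 add0r mul1r sinDpi.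
have -> : x + (2 * N.+1%:R + 1) * pi = x + (2 * N%:R + 1) * pi + pi + pi.
  by rewrite -(natr1 N); ring.
by rewrite !sinDpi IH opprK.
Qed.

Lemma dratioD1 N x : dratio N (x + 1) = dratio N x.
Proof.
rewrite /dratio mulrDr mulr1 sinDpi mulrDr sin_odd_Dpi invrN mulrNN.
by [].
Qed.

Lemma dratioDz N x (n : int) : dratio N (x + n%:~R) = dratio N x.
Proof.
have nat_case (y : R) (m : nat) : dratio N (y + m%:R) = dratio N y.
  by elim: m => [|m IH]; rewrite ?addr0// -natr1 addrA dratioD1.
case: n => n; first exact: nat_case.
by rewrite NegzE -(nat_case _ n.+1) mulrNz subrK.
Qed.

Lemma dratio_approx N (alpha : R) (j m : nat) (n : int) :
  dratio N ((j * m)%N%:R * alpha) = dratio N (j%:R * `|m%:R * alpha - n%:~R|).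
Proof.
rewrite -[in RHS](ger0_norm (ler0n R j)) -normrM dratio_abs mulrBr.
rewrite -(dratioDz N (_ - _) (j%:Z * n)) intrM subrK natrM mulrA.
by [].
Qed.

Lemma dratio_le N x : 0 < dint x -> `|dratio N x| <= 2 / dint x.
Proof.
move=> d0; rewrite /dratio normrM -[X in _ <= X]mul1r normfV; apply: ler_pM => //.
  exact: sin_max.
exact: inv_sin_le_dint.
Qed.

(** The two conditions on H beta say H ~ 1/beta. The error in [ln_sudler_expansion], extended from N
    to H, is then logarithmic by [sum_inv_dint_le]: the h not divisible by q give (H + q) log q,
    those divisible by q give (1/beta) log H, and the whole is divided by H + 1. The harmonic sum is
    absorbed as well. *)
Lemma sudler_dratio_expansion (alpha : R) (p : int) (q H : nat) (eps : R) (N : nat) :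
  let beta : R := `|q%:R * alpha - p%:~R| in
  (1 < q)%N -> coprimez p q -> 0 < eps -> eps <= 2^-1 -> 0 < beta ->
  H%:R * beta <= 1 - eps -> 1 - eps <= H.+1%:R * beta -> (q <= 2 * H)%N -> (N <= H)%N ->
  `|ln (sudler N alpha) + \sum_(1 <= h < H.+1) dratio N (h%:R * alpha) / (2 * h%:R)|
   <= 30 * eps^-1 * (1 + ln H%:R).
Proof.
move=> beta q1 cpq e0 e1 b0 Hb Hb1 qH NH.
have ag := approx_gt0 alpha p q H eps q1 cpq e0 b0 Hb.
have H0 : (0 < H)%N by lia.
have lH : 0 <= ln H%:R :> R by rewrite ln_ge0// ler1n.
have lq : ln q%:R <= 1 + ln H%:R :> R.
  apply: le_trans (_ : ln (2 * H%:R) <= _).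
    by rewrite ler_ln ?posrE ?mulr_gt0// ?ltr0n//; [rewrite -natrM ler_nat|lia].
  rewrite lnM ?posrE ?ltr0n// lerD2r; have := @le_ln1Dx R 1; rewrite (_ : 1 + 1 = 2) ?ltrN10; last by ring.
  by apply; lra.
have s0 h : (1 <= h <= H)%N -> sin (pi * (h%:R * alpha)) != 0.
  by move=> hH; apply: sin_neq0_dint; exact: ag.
have s0N r : (1 <= r <= N)%N -> sin (pi * (r%:R * alpha)) != 0.
  by move=> /andP[r1 rN]; apply: s0; rewrite r1 (leq_trans rN).
have := @ln_sudler_expansion R alpha N H s0N s0.
have -> : \sum_(1 <= h < H.+1) sin ((2 * N%:R + 1) * (pi * (h%:R * alpha))) /
     (2 * h%:R * sin (pi * (h%:R * alpha))) = \sum_(1 <= h < H.+1) dratio N (h%:R * alpha) / (2 * h%:R).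
  apply: eq_bigr => h _; rewrite /dratio -[RHS]mulrA -invfM; congr (_ / _).
  by rewrite mulrC.
set A := \sum_(1 <= h < H.+1) _ / _; set B := \sum_(1 <= h < H.+1) _^-1.
set C := _^-1 * _ => h.
have B0 : 0 <= B by apply: sumr_ge0 => i _; rewrite invr_ge0 mulr_ge0.
have B1 : B <= 2^-1 * (1 + ln H%:R).
  apply: le_trans (_ : 2^-1 * \sum_(1 <= h < H.+1) h%:R^-1 <= _); last first.
    by apply: ler_wpM2l; [rewrite invr_ge0|exact: sum_inv_le].
  by rewrite mulr_sumr /B; apply: ler_sum => i _; rewrite invfM.
have C1 : C <= (2 / H.+1%:R) * (eps^-1 * (H%:R / q%:R + 1) * (2 * q%:R * (1 + ln q%:R)) +
    beta^-1 * (1 + ln (H %/ q)%N%:R)).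
  rewrite /C -mulrA mulrCA; apply: ler_wpM2l; first by rewrite invr_ge0.
  apply: le_trans (_ : 2 * \sum_(1 <= h < H.+1) (dint (h%:R * alpha))^-1 <= _).
    apply: le_trans (_ : \sum_(1 <= r < H.+1) `|sin (pi * (r%:R * alpha))|^-1 <= _).
      rewrite (@big_cat_nat _ _ _ N.+1 1 H.+1)//= lerDl.
      by apply: sumr_ge0 => i _; rewrite invr_ge0.
    rewrite mulr_sumr; apply: ler_sum_nat => r rH.
    by apply: inv_sin_le_dint; exact: ag.
  apply: ler_wpM2l => //.
  exact: sum_inv_dint_le.
have H1 : 0 < H.+1%:R :> R by [].
have HR : 0 < H%:R :> R by rewrite ltr0n.
have qR : 0 < q%:R :> R by rewrite ltr0n ltnW.
have qH' : q%:R <= 2 * H%:R :> R by rewrite -natrM ler_nat.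
have C2 : C <= 2 * (6 * eps^-1 * (2 + ln H%:R) + 2 * (1 + ln H%:R)).
  apply: le_trans C1 _.
  rewrite -mulrA ler_pM2l// mulrDr; apply: lerD.
    have -> : H.+1%:R^-1 * (eps^-1 * (H%:R / q%:R + 1) * (2 * q%:R * (1 + ln q%:R))) =
       2 * eps^-1 * ((H%:R + q%:R) / H.+1%:R) * (1 + ln q%:R).
      by field; rewrite ?gt_eqF.
    have h3 : (H%:R + q%:R) / H.+1%:R <= 3 :> R.
      by rewrite ler_pdivrMr// -(natr1 H); lra.
    have h30 : 0 <= (H%:R + q%:R) / H.+1%:R :> R by rewrite divr_ge0// addr_ge0// ltW.
    have : 0 <= eps^-1 by rewrite invr_ge0 ltW.
    have lq0 : 0 <= ln q%:R :> R by rewrite ln_ge0// ler1n ltnW.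
    move: (eps^-1) (_ / H.+1%:R) (ln q%:R) (ln H%:R) lq lH lq0 h3 h30 => e x lq' lH' *.
    have -> : 2 * e * x * (1 + lq') = e * (2 * (x * (1 + lq'))) by ring.
    have -> : 6 * e * (2 + lH') = e * (6 * (2 + lH')) by ring.
    apply: ler_wpM2l => //; nra.
  rewrite mulrA; apply: ler_pM.
  - by rewrite mulr_ge0// invr_ge0// ltW.
  - apply: addr_ge0 => //; case: (H %/ q)%N => [|k]; first by rewrite ln0.
    by rewrite ln_ge0// ler1n.
  - rewrite -invfM -[2]invrK lef_pV2 ?posrE ?mulr_gt0//.
    by apply: le_trans Hb1; lra.
  rewrite lerD2l; case E : (H %/ q)%N => [|k]; first by rewrite ln0.
  by rewrite ler_ln ?posrE ?ltr0n// -E ler_nat leq_div.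
have e2 : 2 <= eps^-1 by rewrite -[2]invrK lef_pV2 ?posrE.
have -> : ln (sudler N alpha) + A = (ln (sudler N alpha) + (A - B)) + B by ring.
apply: le_trans (ler_normD _ _) _; rewrite (ger0_norm B0).
apply: le_trans (lerD (le_trans h C2) B1) _.
move: (eps^-1) (ln H%:R) e2 lH => e l e2 l0; nra.
Qed.

Lemma abel_sin_ge0 (a : nat -> R) (J : nat) (phi : R) : 0 <= phi <= pi ->
  (forall n, (1 <= n < J)%N -> a n.+1 <= a n) -> (forall n, (1 <= n <= J)%N -> 0 <= a n) ->
  0 <= \sum_(1 <= j < J.+1) a j * (sin (j%:R * phi) / j%:R).
Proof. by move=> h am a0; apply: abel_ge0 => // n _; exact: fejer_jackson. Qed.

Lemma abel_sin_ge (a : nat -> R) (J : nat) (phi : R) : (2 <= J)%N -> 0 <= phi <= pi ->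
  (forall n, (1 <= n < J)%N -> a n.+1 <= a n) -> (forall n, (1 <= n <= J)%N -> 0 <= a n) ->
  (a 1%N - a 2) * sin phi <= \sum_(1 <= j < J.+1) a j * (sin (j%:R * phi) / j%:R).
Proof.
move=> J2 h am a0; apply: le_trans (abel_ge _ _ _ _ J2 _ am a0).
  by rewrite mul1r divr1.
by move=> n _; exact: fejer_jackson.
Qed.

Lemma sin_pi_mono (x y : R) : 0 <= x -> x <= y -> y <= 2^-1 -> sin (pi * x) <= sin (pi * y).
Proof.
move=> x0 xy y1; have p0 := pi_gt0 R.
have h (z : R) : 0 <= z -> z <= 2^-1 -> pi * z \in `[(- (pi / 2)), pi / 2].
  by move=> z0 z1; rewrite in_itv/=; apply/andP; split; nra.
have [->//|ne] := eqVneq x y.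
by apply: ltW; rewrite ltr_sin ?h ?ltr_pM2l// ?lt_neqAle ?ne//; lra.
Qed.

Lemma inv_sin_antitone (beta : R) (n m : nat) : 0 < beta -> (1 <= n)%N -> (n <= m)%N ->
  m%:R * beta <= 2^-1 -> (sin (pi * (m%:R * beta)))^-1 <= (sin (pi * (n%:R * beta)))^-1.
Proof.
move=> b0 n1 nm mb.
have nb : 0 < n%:R * beta by rewrite mulr_gt0// ltr0n.
have nmb : n%:R * beta <= m%:R * beta by rewrite ler_pM2r// ler_nat.
have s1 : 0 < sin (pi * (n%:R * beta)).
  by apply: lt_le_trans (sin_ge_half _ _); [rewrite divr_gt0|rewrite ltW//= (le_trans nmb)].
have s2 := sin_pi_mono _ _ (ltW nb) nmb mb.
by rewrite lef_pV2 ?posrE ?(lt_le_trans s1).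
Qed.


(** The multiples of m form a sine series with coefficients 1/sin(pi j b), the shape required by
    Abel summation. A restriction [P] on the indices becomes a coefficient 0. *)
Lemma dratio_dvd_sum N (alpha : R) (m H : nat) (n : int) (P : pred nat) :
  (0 < m)%N ->
  \sum_(1 <= h < H.+1 | (m %| h)%N && P h) dratio N (h%:R * alpha) / (2 * h%:R) =
  (2 * m%:R)^-1 * \sum_(1 <= j < (H %/ m).+1)
     (if P (j * m)%N then (sin (pi * (j%:R * `|m%:R * alpha - n%:~R|)))^-1 else 0) *
      (sin (j%:R * ((2 * N%:R + 1) * (pi * `|m%:R * alpha - n%:~R|))) / j%:R).
Proof.
move=> m0; rewrite big_mkcondr sum_multiples// mulr_sumr; apply: eq_bigr => j _.
case: ifP => _; last by rewrite mul0r mulr0.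
rewrite (dratio_approx _ _ _ _ n) /dratio natrM; set b := `|_|.
have -> : (2 * N%:R + 1) * (pi * (j%:R * b)) = j%:R * ((2 * N%:R + 1) * (pi * b)) by ring.
move: (sin _) (sin _) => A B; rewrite !invfM; ring.
Qed.

Lemma dratio_square_le (alpha : R) (h : nat) : (0 < h)%N -> 0 < dint (h%:R * alpha) ->
  (2 * h%:R * sin (pi * (h%:R * alpha))) ^- 2 <= ((h%:R * dint (h%:R * alpha)) ^+ 2)^-1.
Proof.
move=> h0 d0; have h0' : 0 < h%:R :> R by rewrite ltr0n.
have := dint_le_sin (h%:R * alpha); have s0 := sin_neq0_dint _ d0.
move: (sin _) s0 (dint _) d0 => s s0 d d0 sd.
have hs : 2 * h%:R * s != 0 by rewrite mulf_neq0// mulf_neq0// gt_eqF.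
rewrite -!exprVn -[X in X <= _]real_normK ?num_real// ler_sqr ?nnegrE; [|exact: normr_ge0|by rewrite invr_ge0 mulr_ge0// (ltW d0)].
rewrite normfV lef_pV2 ?posrE ?mulr_gt0 ?normr_gt0//.
have -> : `|2 * h%:R * s| = h%:R * (2 * `|s|).
  by rewrite normrM ger0_norm ?mulr_ge0//; ring.
by rewrite ler_pM2l//; lra.
Qed.

End Dratio.

(** * Lower and upper bounds for log P_N at a fixed alpha *)

Section Deterministic.
Context {R : realType}.

Lemma sin_2pi_nat (j : nat) (y : R) : sin (j%:R * (2 * pi) - y) = - sin y.
Proof.
rewrite addrC -sinN -(periodicn (@sinD2pi R) j (- y)); congr sin; congr (_ + _).
by rewrite -[RHS]mulr_natl -[pi *+ 2]mulr_natl.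
Qed.

Lemma dint_ge_min (x : R) : 0 <= x -> x <= 1 -> Num.min x (1 - x) <= dint x.
Proof.
move=> x0 x1; have [n ->] := dint_ex x.
have [n0|n1] := leP n 0.
  rewrite ge_min; apply/orP; left.
  have n0' : n%:~R <= 0 :> R by rewrite lerz0.
  apply: le_trans (ler_norm _); lra.
have n1' : 1 <= n%:~R :> R by rewrite ler1z.
rewrite ge_min; apply/orP; right; rewrite distrC; apply: le_trans (ler_norm _); lra.
Qed.

(** The gap [a 1 - a 2] of [abel_ge] for the coefficients 1/sin(pi j beta). With y = pi beta it is
    (2 cos y - 1) / (2 cos y sin y), where cos y >= 3/4 and sin y <= 4 beta. *)
Lemma main_term_gap (beta : R) : 0 < beta -> beta <= 16^-1 ->
  (16 * beta)^-1 <= (sin (pi * (1%:R * beta)))^-1 - (sin (pi * (2%:R * beta)))^-1.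
Proof.
move=> b0 b1; rewrite mul1r; set y := pi * beta.
have pi4 : pi <= 4 :> R by have := pihalf_lt2 R; lra.
have pi0 := pi_gt0 R; have pi2 := pi_ge2 R.
have y0 : 0 < y by rewrite mulr_gt0.
have y1 : y <= 4 * beta by rewrite /y ler_wpM2r// ltW.
have sy : 0 < sin y by apply: sin_gt0_pi; rewrite y0 /y; nra.
have sy1 : sin y <= y by apply: sin_le; exact: ltW.
have -> : pi * (2%:R * beta) = y *+ 2 by rewrite -mulr_natl /y; ring.
rewrite sin_mulr2n.
have cy : 3 / 4 <= cos y.
  have -> : y = 2 * (y / 2) by field.
  rewrite cos_double.
  have : 0 <= sin (y / 2) by apply: sin_ge0_pi; lra.
  have : sin (y / 2) <= y / 2 by apply: sin_le; lra.
  move: (sin (y / 2)) => s s1 s0; nra.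
have cy1 := cos_le1 y.
move: (cos y) (sin y) cy cy1 sy sy1 => c s c0 c1 s0 s1.
have -> : s^-1 - (c * s *+ 2)^-1 = (2 * c - 1) / (2 * c) / s.
  rewrite -mulr_natl; field; rewrite ?gt_eqF//; lra.
apply: le_trans (_ : 4^-1 / s <= _).
  rewrite -invfM lef_pV2 ?posrE ?mulr_gt0//; lra.
rewrite ler_pM2r ?invr_gt0// ler_pdivlMr; lra.
Qed.

(** The main term is (2q)^-1 times the sine series over multiples of q. In the second half of the
    period, at distance eps from its ends, the series is at most -eps / (16 beta), whence eps / (32
    q beta). The condition 8q <= H provides at least two multiples of q and beta <= 1/16. *)
Lemma sudler_lower (alpha : R) (p : int) (q H : nat) (eps Vb : R) :
  let beta : R := `|q%:R * alpha - p%:~R| in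
  (1 < q)%N -> coprimez p q -> 0 < eps -> eps <= 2^-1 -> 0 < beta ->
  H%:R * beta <= 1 - eps -> 1 - eps <= H.+1%:R * beta -> (8 * q <= H)%N ->
  \sum_(1 <= h < q) ((h%:R * dint (h%:R * (p%:~R / q%:R))) ^+ 2)^-1 <= Vb ->
  exists X : nat -> R,
    \sum_(0 <= N < H) X N ^+ 2 <= 200 * eps^-1 ^+ 4 * (Vb + 16) * H%:R /\
    forall N, (N <= H)%N -> 2^-1 + eps <= (N%:R + 2^-1) * beta ->
      (N%:R + 2^-1) * beta <= 1 - eps ->
      eps / (32 * q%:R * beta) - `|X N| - 30 * eps^-1 * (1 + ln H%:R) <= ln (sudler N alpha).
Proof.
move=> beta q1 cpq e0 e1 b0 Hb Hb1 qH VV.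
have ag := approx_gt0 alpha p q H eps q1 cpq e0 b0 Hb.
have q0 : (0 < q)%N by exact: ltnW.
have H16 : (16 <= H)%N by apply: leq_trans qH; rewrite (leq_mul2l 8 2).
have H0 : (0 < H)%N by apply: leq_trans H16.
have HR : 0 < H%:R :> R by rewrite ltr0n.
have qR : 0 < q%:R :> R by rewrite ltr0n.
have b16 : beta <= 16^-1.
  have : 16 <= H%:R :> R by rewrite ler_nat.
  move=> h; rewrite -[16^-1]mul1r ler_pdivlMr// mulrC.
  apply: le_trans (_ : H%:R * beta <= _); first by rewrite ler_pM2r.
  lra.
have eV : 2 <= eps^-1 by rewrite -[2]invrK lef_pV2 ?posrE.
pose c h : R := if (q %| h)%N then 0 else (2 * h%:R * sin (pi * (h%:R * alpha)))^-1.
exists (fun N => \sum_(1 <= h < H.+1) c h * sin ((2 * N%:R + 1) * (pi * (h%:R * alpha)))); split.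
  apply: le_trans (mean_square_sin R alpha c H H H0 _) _.
    by move=> d dH; apply: sin_neq0_dint; exact: ag.
  have V0 : 0 <= Vb.
    by apply: le_trans VV; apply: sumr_ge0 => i _; rewrite invr_ge0 sqr_ge0.
  have c2 : \sum_(1 <= h < H.+1) c h ^+ 2 <= eps^-1 ^+ 2 * (Vb + 16).
    apply: le_trans (_ : \sum_(1 <= h < H.+1 | ~~ (q %| h)%N) ((h%:R * dint (h%:R * alpha)) ^+ 2)^-1 <= _).
      rewrite [X in _ <= X]big_mkcond; apply: ler_sum_nat => h /andP[h1 hH].
      rewrite /c; case: (q %| h)%N; first by rewrite expr0n.
      by rewrite exprVn; apply: dratio_square_le => //; apply: ag; rewrite h1.
    apply: le_trans (sum_inv2_ndvd_le alpha p q H eps q1 cpq e0 b0 Hb) _.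
    by apply: ler_wpM2l; [rewrite sqr_ge0|rewrite lerD2r].
  (* With 1/beta <= 4H the right side is at most 4 (16 eps^-2 + 32) H^2, and 4 <= eps^-2 gives 96.
     The factor 2H + (2/H) 96 eps^-2 H^2 of the mean square is then below 200 eps^-2 H. *)
  have s2 : \sum_(1 <= d < H.+1) (sin (pi * (d%:R * alpha)) ^+ 2)^-1 <= 96 * eps^-1 ^+ 2 * H%:R ^+ 2.
    apply: le_trans (_ : 4 * \sum_(1 <= d < H.+1) (dint (d%:R * alpha) ^+ 2)^-1 <= _).
      rewrite mulr_sumr; apply: ler_sum_nat => d dH; have d0 := ag d dH.
      have := inv_sin_le_dint _ d0 => h.
      apply: le_trans (_ : (2 / dint (d%:R * alpha)) ^+ 2 <= _).
        rewrite -exprVn -[X in X <= _]real_normK ?num_real// normfV ler_sqr ?nnegrE ?invr_ge0//.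
        by rewrite divr_ge0// (ltW d0).
      by rewrite exprMn exprVn (_ : 2 ^+ 2 = 4) ?lexx// expr2; ring.
    apply: le_trans (ler_wpM2l _ (sum_inv2_dint_le alpha p q H eps q1 cpq e0 b0 Hb)) _ => //.
    have bH : beta^-1 <= 4 * H%:R.
      rewrite -[beta^-1]mul1r ler_pdivrMr//.
      have : H.+1%:R <= 2 * H%:R :> R by rewrite -natrM ler_nat mul2n -addnn -addn1 leq_add2l.
      move=> h2; have h3 : H.+1%:R * beta <= 2 * H%:R * beta by rewrite ler_pM2r.
      lra.
    have -> : eps^-1 ^+ 2 * (H%:R / q%:R + 1) * (8 * q%:R ^+ 2) =
      eps^-1 ^+ 2 * (8 * ((H%:R + q%:R) * q%:R)) by field; rewrite ?gt_eqF.
    have qH' : q%:R <= H%:R :> R by rewrite ler_nat (leq_trans _ qH)// leq_pmull.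
    have hq : (H%:R + q%:R) * q%:R <= 2 * H%:R ^+ 2 :> R.
      rewrite expr2 mulrA; apply: ler_pM => //; lra.
    have bi0 : 0 <= beta^-1 by rewrite invr_ge0 ltW.
    have hb : beta^-1 ^+ 2 <= 16 * H%:R ^+ 2.
      have -> : 16 * H%:R ^+ 2 = (4 * H%:R) ^+ 2 :> R by ring.
      by rewrite ler_sqr ?nnegrE// mulr_ge0.
    have ee : 4 <= eps^-1 ^+ 2 by nra.
    move: (H%:R ^+ 2) (beta^-1 ^+ 2) (eps^-1 ^+ 2) (_ * q%:R) (sqr_ge0 (H%:R : R)) hq hb ee => A B E D A0 hq' hb' ee'.
    nra.
  set C := \sum_(1 <= h < H.+1) c h ^+ 2 in c2 *.
  set S := \sum_(1 <= d < H.+1) _ in s2 *.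
  have C0 : 0 <= C by apply: sumr_ge0 => i _; rewrite sqr_ge0.
  have S0 : 0 <= S by apply: sumr_ge0 => i _; rewrite invr_ge0 sqr_ge0.
  apply: le_trans (_ : (eps^-1 ^+ 2 * (Vb + 16)) * (200 * eps^-1 ^+ 2 * H%:R) <= _); last first.
    rewrite le_eqVlt; apply/orP; left; apply/eqP; ring.
  apply: ler_pM => //.
    by rewrite addr_ge0// mulr_ge0// divr_ge0.
  have : 2 / H%:R * S <= 192 * eps^-1 ^+ 2 * H%:R.
    apply: le_trans (ler_wpM2l _ s2) _; first by rewrite divr_ge0.
    rewrite le_eqVlt; apply/orP; left; apply/eqP; field; rewrite ?gt_eqF//.
  have ee : 4 <= eps^-1 ^+ 2 by nra.
  have : 4 * H%:R <= eps^-1 ^+ 2 * H%:R by rewrite ler_pM2r.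
  lra.
move=> N NH N1 N2.
have qH2 : (q <= 2 * H)%N.
  by apply: leq_trans (leq_pmull _ _) => //; apply: leq_trans qH; rewrite leq_pmull.
have := sudler_dratio_expansion alpha p q H eps N q1 cpq e0 e1 b0 Hb Hb1 qH2 NH.
set Err := 30 * _ * _; set X := \sum_(1 <= h < H.+1) c h * _.
rewrite (bigID (fun h => (q %| h)%N && true))/=.
under eq_bigl => h do rewrite -/(predT h).
rewrite (dratio_dvd_sum N alpha q H p predT q0) -/beta.
have -> : \sum_(1 <= i < H.+1 | ~~ ((q %| i)%N && true)) dratio N (i%:R * alpha) / (2 * i%:R) = X.
  rewrite big_mkcond; apply: eq_bigr => h _; rewrite andbT /c.
  case: (q %| h)%N; rewrite /= ?mul0r// /dratio.
  by rewrite [RHS]mulrC -[LHS]mulrA -invfM; congr (_ / _); rewrite mulrC.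
set phi := (2 * N%:R + 1) * (pi * beta).
set M := \sum_(1 <= j < _) _.
(* Reflection about 2 pi changes the sign of every sine and brings the phase from the second half of
   the period into [0, pi]. *)
pose phi' := 2 * pi - phi.
have ex : phi' = pi * (2 - 2 * ((N%:R + 2^-1) * beta)) by rewrite /phi' /phi; field.
set x := 2 - 2 * _ in ex.
have x1 : 2 * eps <= x by rewrite /x; lra.
have x2 : x <= 1 - 2 * eps by rewrite /x; lra.
have pi0 := pi_gt0 R.
have ph0 : 0 <= phi' <= pi by rewrite ex; apply/andP; split; nra.
have sphi : eps <= sin phi'.
  have s0 : 0 <= sin phi' by exact: sin_ge0_pi.
  have := dint_le_sin x; rewrite -ex (ger0_norm s0).
  have : 2 * eps <= dint x.
    apply: le_trans (dint_ge_min x _ _); [|lra|lra].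
    by rewrite le_min x1; lra.
  lra.
have M1 : M <= - ((16 * beta)^-1 * eps).
  have -> : M = - \sum_(1 <= j < (H %/ q).+1) (sin (pi * (j%:R * beta)))^-1 * (sin (j%:R * phi') / j%:R).
    rewrite -sumrN; apply: eq_bigr => j _ /=.
    have -> : j%:R * phi = j%:R * (2 * pi) - j%:R * phi' by rewrite /phi'; ring.
    by rewrite sin_2pi_nat mulNr mulrN.
  rewrite lerN2.
  have jb j : (j <= H %/ q)%N -> j%:R * beta <= 2^-1.
    move=> jH; apply: (approx_dvd_small alpha p q H eps q1 e0 b0 Hb); by rewrite -leq_divRL.
  have J2 : (2 <= H %/ q)%N by rewrite leq_divRL// (leq_trans _ qH)// leq_mul2r orbT.
  apply: le_trans (abel_sin_ge (fun j => (sin (pi * (j%:R * beta)))^-1) (H %/ q) phi' J2 ph0 _ _).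
  - apply: ler_pM => //; first by rewrite invr_ge0 mulr_ge0// ltW.
      exact: ltW.
    exact: main_term_gap.
  - move=> n /andP[n1 nJ]; apply: inv_sin_antitone => //; exact: jb.
  - move=> n /andP[n1 nJ]; rewrite invr_ge0; apply: le_trans (sin_ge_half _ _).
      by rewrite divr_ge0// mulr_ge0// ltW.
    by rewrite jb// andbT mulr_ge0// ltW.
have M2 : (2 * q%:R)^-1 * M <= - (eps / (32 * q%:R * beta)).
  apply: le_trans (ler_wpM2l _ M1) _; first by rewrite invr_ge0 mulr_ge0// ltW.
  rewrite le_eqVlt; apply/orP; left; apply/eqP; field; rewrite ?gt_eqF//.
rewrite ler_norml => /andP[h1 _].
have := ler_norm X; move: M2 h1; move: (_ * M) (eps / _) => A B; lra.
Qed.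


Lemma sudler_upper (alpha : R) (p n1 : int) (q m H L : nat) (tau Zb : R) :
  let beta : R := `|q%:R * alpha - p%:~R| in
  let beta1 : R := `|m%:R * alpha - n1%:~R| in
  let main h := (m %| h)%N && ((h %/ m)%N%:R * beta1 <= 2^-1) in
  (1 < q)%N -> coprimez p q -> 0 < beta ->
  H%:R * beta <= 2^-1 -> 2^-1 <= H.+1%:R * beta -> (q <= 2 * H)%N ->
  (0 < m)%N -> 0 < beta1 -> 0 <= tau ->
  (m = q /\ n1 = p) \/ (q%:R * beta)^-1 <= tau ->
  \sum_(1 <= h < (q %/ 2).+1 | ~~ main h) ((h%:R * dint (h%:R * alpha)) ^+ 2)^-1 <= Zb ->
  (0 < L)%N -> (q <= 2 * L)%N ->
  exists X : nat -> R,
    \sum_(0 <= N < L) X N ^+ 2 <= 1026 * L%:R * Zb /\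
    forall N, (N <= H)%N ->
      (exists k : nat, k%:R <= (N%:R + 2^-1) * beta1 <= k%:R + 2^-1) ->
      ln (sudler N alpha) <= `|X N| + 60 * (1 + ln H%:R)
         + 4 * (1 + ln q%:R) * (3 + ln (H %/ q)%N%:R) + 2 * tau.
Proof.
move=> beta beta1 main q1 cpq b0 Hb Hb1 qH m0 b1 t0 qm ZZ L0 qL.
have e0 : 0 < 2^-1 :> R by rewrite invr_gt0.
have e1 : 2^-1 <= 2^-1 :> R by [].
have h1 : 1 - 2^-1 = 2^-1 :> R by field.
have Hb' : H%:R * beta <= 1 - 2^-1 by rewrite h1.
have Hb1' : 1 - 2^-1 <= H.+1%:R * beta by rewrite h1.
have ag := approx_gt0 alpha p q H 2^-1 q1 cpq e0 b0 Hb'.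
have q0 : (0 < q)%N by exact: ltnW.
have qR : 0 < q%:R :> R by rewrite ltr0n.
have LR : 0 < L%:R :> R by rewrite ltr0n.
have q2H : (q %/ 2 <= H)%N by rewrite -[X in (_ <= X)%N](mulKn H (_ : 0 < 2)%N)// leq_div2r.
have q2q : (q %/ 2 < q)%N by rewrite ltn_Pdiv.
have agq d : (1 <= d <= q %/ 2)%N -> (1 <= d <= H)%N.
  by move=> /andP[-> dq] /=; apply: leq_trans q2H.
have ndv d : (1 <= d <= q %/ 2)%N -> ~~ (q %| d)%N.
  by move=> /andP[d1 dq]; rewrite gtnNdvd// (leq_ltn_trans dq).
pose c h : R := if main h then 0 else (2 * h%:R * sin (pi * (h%:R * alpha)))^-1.
exists (fun N => \sum_(1 <= h < (q %/ 2).+1) c h * sin ((2 * N%:R + 1) * (pi * (h%:R * alpha)))); split.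
  apply: le_trans (mean_square_sin R alpha c (q %/ 2) L L0 _) _.
    by move=> d dH; apply: sin_neq0_dint; apply: ag; exact: agq.
  have c2 : \sum_(1 <= h < (q %/ 2).+1) c h ^+ 2 <= Zb.
    apply: le_trans ZZ; rewrite [X in _ <= X]big_mkcond; apply: ler_sum_nat => h hH.
    rewrite /c; case: (main h); first by rewrite expr0n.
    by rewrite exprVn; apply: dratio_square_le; [case/andP: hH|apply: ag; exact: agq].
  have s2 : \sum_(1 <= d < (q %/ 2).+1) (sin (pi * (d%:R * alpha)) ^+ 2)^-1 <= 128 * q%:R ^+ 2.
    apply: le_trans (_ : \sum_(1 <= d < (q %/ 2).+1) 16 * (dint (d%:R * (p%:~R / q%:R)) ^+ 2)^-1 <= _).
      apply: ler_sum_nat => d dH; have d0 := ag d (agq d dH).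
      have := inv_sin_le_dint _ d0 => h.
      have := ndvd_inv_le alpha p q H 2^-1 q1 cpq e0 b0 Hb' d (agq d dH) (ndv d dH).
      rewrite invrK => h'.
      apply: le_trans (_ : (4 * (dint (d%:R * (p%:~R / q%:R)))^-1) ^+ 2 <= _).
        rewrite -exprVn -[X in X <= _]real_normK ?num_real// normfV ler_sqr ?nnegrE ?invr_ge0//; last first.
          by rewrite mulr_ge0// invr_ge0 dint_ge0.
        apply: le_trans h _; move: h'; lra.
      rewrite exprMn exprVn (_ : 4 ^+ 2 = 16 :> R) ?lexx// expr2; ring.
    rewrite -mulr_sumr.
    have : \sum_(1 <= d < (q %/ 2).+1) (dint (d%:R * (p%:~R / q%:R)) ^+ 2)^-1 <= 8 * q%:R ^+ 2 :> R.
      apply: le_trans (_ : \sum_(1 <= d < q) (dint (d%:R * (p%:~R / q%:R)) ^+ 2)^-1 <= _).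
        rewrite [X in _ <= X](@big_cat_nat _ _ _ (q %/ 2).+1 1 q)//= lerDl.
        by apply: sumr_ge0 => i _; rewrite invr_ge0 sqr_ge0.
      rewrite (sum_dint_coprime (fun x => (x ^+ 2)^-1)) //.
      exact: sum_inv2_dint_natdiv.
    move: (\sum_(_ <= _ < _) _) (q%:R ^+ 2) => A B h; lra.
  set C := \sum_(1 <= h < _) c h ^+ 2 in c2 *.
  set S := \sum_(1 <= d < _) _ in s2 *.
  have C0 : 0 <= C by apply: sumr_ge0 => i _; rewrite sqr_ge0.
  have S0 : 0 <= S by apply: sumr_ge0 => i _; rewrite invr_ge0 sqr_ge0.
  rewrite [X in _ <= X]mulrC; apply: ler_pM => //.
    by rewrite addr_ge0// mulr_ge0// divr_ge0.
  have qL' : q%:R <= 2 * L%:R :> R by rewrite -natrM ler_nat.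
  (* From q <= 2L. The mean square factor is then 2L + (2/L) 512 L^2 = 1026 L. *)
  have s3 : S <= 512 * L%:R ^+ 2.
    apply: le_trans s2 _.
    have : q%:R ^+ 2 <= (2 * L%:R) ^+ 2 :> R by rewrite ler_sqr ?nnegrE// ?mulr_ge0.
    rewrite exprMn (_ : 2 ^+ 2 = 4 :> R); last by rewrite expr2; ring.
    move: (q%:R ^+ 2) (L%:R ^+ 2) => A B h; lra.
  have : 2 / L%:R * S <= 1024 * L%:R.
    apply: le_trans (ler_wpM2l _ s3) _; first by rewrite divr_ge0.
    rewrite le_eqVlt; apply/orP; left; apply/eqP; field; rewrite ?gt_eqF//.
  lra.
move=> N NH [k /andP[k1 k2]].
have := sudler_dratio_expansion alpha p q H 2^-1 N q1 cpq e0 e1 b0 Hb' Hb1' qH NH.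
rewrite invrK; set Err := 30 * _ * _; set X := \sum_(1 <= h < _) c h * _.
pose T h := dratio N (h%:R * alpha) / (2 * h%:R).
have Tle h : (1 <= h <= H)%N -> `|T h| <= (h%:R * dint (h%:R * alpha))^-1.
  move=> hH; have h0 : 0 < h%:R :> R by rewrite ltr0n; case/andP: hH.
  have n2 : `|2 * h%:R| = 2 * h%:R :> R by rewrite ger0_norm ?mulr_ge0.
  rewrite /T normrM normfV n2; have h2 := dratio_le N _ (ag h hH).
  rewrite ler_pdivrMr ?mulr_gt0//; apply: le_trans h2 _.
  rewrite le_eqVlt; apply/orP; left; apply/eqP.
  have -> : (h%:R * dint (h%:R * alpha))^-1 * (2 * h%:R) = 2 / dint (h%:R * alpha) * (h%:R^-1 * h%:R).
    by rewrite invfM; ring.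
  by rewrite mulVf ?gt_eqF// mulr1.
have inv0 h : 0 <= (h%:R * dint (h%:R * alpha))^-1 :> R by rewrite invr_ge0 mulr_ge0// dint_ge0.
rewrite (bigID main)/=.
have main0 : 0 <= \sum_(1 <= h < H.+1 | main h) T h.
  rewrite /T /main (dratio_dvd_sum N alpha m H n1 (fun h => (h %/ m)%N%:R * beta1 <= 2^-1) m0).
  apply: mulr_ge0; first by rewrite invr_ge0 mulr_ge0.
  (* Setting the coefficients to 0 once j beta1 > 1/2 keeps them nonnegative and nonincreasing, as
     sin(pi t) increases up to t = 1/2. The phase is reduced by k whole periods to lie in
     [0, pi]. *)
  pose a j : R := if j%:R * beta1 <= 2^-1 then (sin (pi * (j%:R * beta1)))^-1 else 0.
  pose phi : R := pi * (2 * ((N%:R + 2^-1) * beta1 - k%:R)).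
  have -> : \sum_(1 <= j < (H %/ m).+1) (if (j * m %/ m)%N%:R * beta1 <= 2^-1 then
        (sin (pi * (j%:R * beta1)))^-1 else 0) * (sin (j%:R * ((2 * N%:R + 1) * (pi * beta1))) / j%:R)
     = \sum_(1 <= j < (H %/ m).+1) a j * (sin (j%:R * phi) / j%:R).
    apply: eq_bigr => j _; rewrite mulnK// /a; congr (_ * (_ / _)).
    have -> : j%:R * ((2 * N%:R + 1) * (pi * beta1)) = (j * k)%N%:R * (2 * pi) - (- (j%:R * phi)).
      by rewrite natrM /phi; field.
    by rewrite sin_2pi_nat sinN opprK.
  apply: abel_sin_ge0.
  - have pi0 := pi_gt0 R; rewrite /phi; apply/andP; split.
      apply: mulr_ge0; first exact: ltW.
      by apply: mulr_ge0 => //; rewrite subr_ge0.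
    rewrite -[X in _ <= X]mulr1 ler_pM2l//; lra.
  - move=> j /andP[j1 jH]; rewrite /a.
    have jj : j%:R * beta1 <= j.+1%:R * beta1 by rewrite ler_pM2r// ler_nat.
    case: ifP => h2.
      by rewrite (le_trans jj h2); exact: inv_sin_antitone.
    case: ifP => // h3; rewrite invr_ge0; apply: le_trans (sin_ge_half _ _).
      by rewrite divr_ge0// mulr_ge0// ltW.
    by rewrite h3 andbT mulr_ge0// ltW.
  - move=> j /andP[j1 jH]; rewrite /a; case: ifP => // h3; rewrite invr_ge0.
    apply: le_trans (sin_ge_half _ _).
      by rewrite divr_ge0// mulr_ge0// ltW.
    by rewrite h3 andbT mulr_ge0// ltW.
rewrite [X in _ + (_ + X)](bigID (fun h => (q < 2 * h)%N))/=.
have -> : \sum_(1 <= h < H.+1 | ~~ main h && ~~ (q < 2 * h)%N) T h = X.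
  rewrite (@big_cat_nat _ _ _ (q %/ 2).+1 1 H.+1)//=.
  rewrite [X in _ + X]big_nat_cond [X in _ + X]big_pred0; last first.
    move=> h; apply/negbTE; rewrite !negb_and !negbK; case: (ltnP (q %/ 2) h) => //= hq.
    rewrite orbA orbC; apply/orP; left.
    by rewrite mulnC -ltn_divLR.
  rewrite addr0 /X big_mkcond; apply: eq_big_nat => h /andP[h1' h2].
  have -> : (q < 2 * h)%N = false.
    by apply/negbTE; rewrite -leqNgt mulnC -leq_divRL.
  rewrite andbT /c /T /dratio; case: (main h) => /=; first by rewrite mul0r.
  by rewrite [RHS]mulrC -[LHS]mulrA -invfM; congr (_ / _); rewrite mulrC.
set M := \sum_(_ <= _ < _ | main _) T _ in main0 *.
set U := \sum_(_ <= _ < _ | _) T _.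
have hU : `|U| <= 4 * (1 + ln q%:R) * (3 + ln (H %/ q)%N%:R) + 2 * tau.
  apply: le_trans (ler_norm_sum _ _ _) _.
  pose G h : R := (h%:R * dint (h%:R * alpha))^-1.
  apply: le_trans (_ : \sum_(1 <= h < H.+1 | ~~ main h && (q < 2 * h)%N) G h <= _).
    rewrite big_nat_cond [X in _ <= X]big_nat_cond.
    by apply: ler_sum => h /andP[hH _]; exact: Tle.
  rewrite (bigID (fun h => (q %| h)%N))/= addrC; apply: lerD.
    have := sum_inv_high_le alpha p q H 2^-1 q1 cpq e0 b0 Hb'; rewrite invrK.
    have -> : 2 * (2 * (1 + ln q%:R) * (3 + ln (H %/ q)%N%:R)) = 4 * (1 + ln q%:R) * (3 + ln (H %/ q)%N%:R) :> R by ring.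
    apply: le_trans.
    rewrite big_mkcond [X in _ <= X]big_mkcond; apply: ler_sum => h _.
    case: (q %| h)%N; rewrite /= ?andbF// andbT.
    case: (q < 2 * h)%N; rewrite ?andbT ?andbF//.
    by case: (main h) => //=; exact: inv0.
  case: qm => [[mq np]|qt].
    (* If (m, n1) = (q, p), each multiple j q <= H has j beta <= 1/2 and is a main index, so no term
       is left. *)
    rewrite big_nat_cond big_pred0 ?mulr_ge0// => h; apply/negbTE.
    apply/negP => /andP[/andP[_ hH] /andP[/andP[nm _] /dvdnP[j e]]].
    move: nm; rewrite /main mq e dvdn_mull//= mulnK//.
    have -> : beta1 = beta by rewrite /beta1 mq np.
    rewrite (approx_dvd_small alpha p q H 2^-1 q1 e0 b0 Hb')//.
    by rewrite -e.
  apply: le_trans (_ : \sum_(1 <= h < H.+1 | (q %| h)%N) G h <= _).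
    rewrite big_mkcond [X in _ <= X]big_mkcond; apply: ler_sum => h _.
    case: (q %| h)%N; rewrite ?andbF// andbT; case: ifP => // _; exact: inv0.
  rewrite sum_multiples//.
  apply: le_trans (_ : (q%:R * beta)^-1 * \sum_(1 <= j < (H %/ q).+1) (j%:R ^+ 2)^-1 <= _).
    rewrite mulr_sumr; apply: ler_sum_nat => j /andP[j1 jH].
    rewrite /G (approx_dvd alpha p q H 2^-1 q1 e0 b0 Hb'); last by rewrite -leq_divRL.
    rewrite -invfM le_eqVlt; apply/orP; left; apply/eqP; congr (_^-1).
    by rewrite natrM -/beta; ring.
  rewrite mulrC; apply: ler_pM => //.
  - by apply: sumr_ge0 => j _; rewrite invr_ge0 sqr_ge0.
  - by rewrite invr_ge0 mulr_ge0// ltW.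
  - exact: sum_inv2_le.
rewrite ler_norml => /andP[_ h2].
move: hU; rewrite ler_norml => /andP[hU _].
have := ler_norm (- X); rewrite normrN => hX.
have eErr : Err = 60 * (1 + ln H%:R) by rewrite /Err; ring.
move: h2 hU; rewrite eErr; move: (60 * _) (4 * _ * _) (2 * tau) => A B D h2 hU.
lra.
Qed.

End Deterministic.

(** * Metric lemmas *)

Section Metric.
Context {R : realType}.
Local Notation mu := (@lebesgue_measure R).
Local Open Scope classical_set_scope.

Lemma mem_bigsetU (I : eqType) (s : seq I) (A : I -> set R) (x : R) :
  (\big[setU/set0]_(i <- s) A i) x <-> exists2 i, i \in s & A i x.
Proof.
elim: s => [|i s IH]; first by rewrite big_nil; split => // -[].
rewrite big_cons; split => [[Ax|/IH[j js Ax]]|[j]].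
- by exists i => //; rewrite mem_head.
- by exists j => //; rewrite in_cons js orbT.
- by rewrite in_cons => /predU1P[->|js] Ax; [left|right; apply/IH; exists j].
Qed.

Lemma measure_bigsetU_le (I : eqType) (s : seq I) (A : I -> set R) (m : I -> R) :
  (forall i, i \in s -> measurable (A i)) ->
  (forall i, i \in s -> (mu (A i) <= (m i)%:E)%E) ->
  measurable (\big[setU/set0]_(i <- s) A i) /\
  (mu (\big[setU/set0]_(i <- s) A i) <= (\sum_(i <- s) m i)%:E)%E.
Proof.
elim: s => [|i s IH] mA Am; first by rewrite !big_nil measure0.
have mA' j : j \in s -> measurable (A j) by move=> js; apply: mA; rewrite in_cons js orbT.
have Am' j : j \in s -> (mu (A j) <= (m j)%:E)%E by move=> js; apply: Am; rewrite in_cons js orbT.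
have [mU Um] := IH mA' Am'.
rewrite !big_cons; have mi := mA i (mem_head _ _); split; first exact: measurableU.
rewrite EFinD.
apply: (@le_trans _ _ (mu (A i) + mu (\big[setU/set0]_(i <- s) A i))%E); first exact: measureU2.
by apply: leeD => //; apply: Am; rewrite mem_head.
Qed.

Lemma measure_le_bound (A U : set R) (m : \bar R) : measurable A -> measurable U ->
  A `<=` U -> (mu U <= m)%E -> (mu A <= m)%E.
Proof. by move=> mA mU AU; apply: le_trans; apply: le_measure => //; rewrite inE. Qed.

Lemma measure_itvcc (a b : R) : a <= b -> mu `[a, b] = (b - a)%:E.
Proof.
move=> ab; rewrite lebesgue_measure_itv/= lte_fin; case: ltP => // ba.
by rewrite (_ : b = a) ?subrr//; apply/eqP; rewrite eq_le ab ba.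
Qed.

(** The set ||h x|| <= t in [a, b] lies in at most h (b - a) + 2 intervals of length 2t/h centred at
    the points n/h. A measurable superset is all that the later estimates ask for. *)
Lemma dint_cover (h : nat) (a b t : R) : (0 < h)%N -> a <= b -> 0 <= t ->
  exists U : set R, [/\ measurable U,
    (mu U <= (2 * t * ((b - a) + 2 / h%:R))%:E)%E &
    forall x, a <= x <= b -> dint (h%:R * x) <= t -> U x].
Proof.
move=> h0 ab t0; have hR : 0 < h%:R :> R by rewrite ltr0n.
have [th|th] := leP t 2^-1; last first.
  exists `[a, b]; split => //.
  rewrite measure_itvcc// lee_fin.
  have : 0 <= 2 / h%:R :> R by rewrite divr_ge0.
  move: (2 / _) => c c0; nra.
pose n0 := Num.ceil (h%:R * a - 2^-1).
pose K := Num.trunc (h%:R * (b - a) + 1).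
have hba : 0 <= h%:R * (b - a) + 1 by rewrite addr_ge0// mulr_ge0// subr_ge0.
pose A (i : nat) : set R := `[((n0%:~R + i%:R) - t) / h%:R, ((n0%:~R + i%:R) + t) / h%:R].
have Ale i : mu (A i) = (2 * t / h%:R)%:E.
  rewrite measure_itvcc; last by rewrite ler_pM2r ?invr_gt0//; lra.
  congr (_%:E); rewrite -mulrBl; congr (_ / _); ring.
have mA i : measurable (A i) by exact: measurable_itv.
have Am i : (mu (A i) <= (2 * t / h%:R)%:E)%E by rewrite Ale.
have [mU Um] := @measure_bigsetU_le _ (iota 0 K.+1) A (fun _ => 2 * t / h%:R)
   (fun i _ => mA i) (fun i _ => Am i).
exists (\big[setU/set0]_(i <- iota 0 K.+1) A i); split => //.
  apply: le_trans Um _.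
  rewrite lee_fin big_const_seq count_predT size_iota iter_addr_0 -[X in X <= _]mulr_natl.
  have -> : 2 * t * (b - a + 2 / h%:R) = (h%:R * (b - a) + 2) * (2 * t / h%:R).
    by field; rewrite gt_eqF.
  apply: ler_wpM2r; first by rewrite divr_ge0// mulr_ge0.
  have := truncn_le (h%:R * (b - a) + 1); rewrite hba -/K -natr1; lra.
move=> x /andP[ax xb] dx; apply/mem_bigsetU.
have [n e] := dint_ex (h%:R * x); rewrite e in dx.
have n1 : `|h%:R * x - n%:~R| <= 2^-1 by exact: le_trans th.
move: n1; rewrite ler_norml => /andP[n1 n2].
have ax' : h%:R * a <= h%:R * x by rewrite ler_pM2l.
have xb' : h%:R * x <= h%:R * b by rewrite ler_pM2l.
have n0n : n0 <= n by rewrite /n0 ceil_le_int; lra.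
have c1 := ceil_ge (h%:R * a - 2^-1); rewrite -/n0 in c1.
have ei : `|n - n0|%N%:Z = n - n0 by rewrite gez0_abs// subr_ge0.
have eR : `|n - n0|%N%:R = n%:~R - n0%:~R :> R.
  by rewrite -intrB -ei -pmulrn.
exists `|n - n0|%N.
  rewrite mem_iota /= add0n ltnS truncn_ge_nat// eR; lra.
move: dx; rewrite ler_norml => /andP[d1 d2].
rewrite /A /= in_itv/= eR ler_pdivrMr// ler_pdivlMr//; apply/andP; split; lra.
Qed.

Lemma markov_indic (I : eqType) (s : seq I) (A : I -> set R) (w m : I -> R) (t : R) :
  0 < t -> (forall i, i \in s -> measurable (A i)) -> (forall i, i \in s -> 0 <= w i) ->
  (forall i, i \in s -> (mu (A i) <= (m i)%:E)%E) ->
  let S : set R := [set x | t <= \sum_(i <- s) w i * \1_(A i) x] in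
  measurable S /\ (mu S <= ((\sum_(i <- s) w i * m i) / t)%:E)%E.
Proof.
move=> t0 mA w0 Am.
have mf (s' : seq I) : {subset s' <= s} ->
    measurable_fun setT (fun x => \sum_(i <- s') w i * \1_(A i) x).
  elim: s' => [|i s' IH] ss.
    by under eq_fun do rewrite big_nil; exact: measurable_cst.
  under eq_fun do rewrite big_cons.
  apply: measurable_funD; last by apply: IH => j js; apply: ss; rewrite in_cons js orbT.
  apply: measurable_funM; first exact: measurable_cst.
  by apply: measurable_indic; apply: mA; apply: ss; rewrite mem_head.
set S : set R := [set x | _].
have mS : measurable S.
  have := mf s (fun _ h => h) measurableT `[t, +oo[ (measurable_itv _).
  rewrite setTI; congr (measurable _); apply/seteqP; split => x /=; rewrite in_itv/= andbT//.
split => //.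
have fE : (fun x => (\sum_(i <- s) w i * \1_(A i) x)%:E) =
    (fun x => (\sum_(i <- s) ((w i)%:E * (\1_(A i) x)%:E))%E).
  by apply/funext => x; rewrite -sumEFin; apply: eq_bigr => i _; rewrite EFinM.
have h1 : (t%:E * mu S <= \int[mu]_x (\sum_(i <- s) w i * \1_(A i) x)%:E)%E.
  have -> : (t%:E * mu S = \int[mu]_x (t%:E * (\1_S x)%:E))%E.
    rewrite ge0_integralZl_EFin//; last 2 first.
      by apply/measurable_EFinP; exact: measurable_indic.
      exact: ltW.
    by rewrite integral_indic// setIT.
  apply: ge0_le_integral => //.
  - move=> x _; rewrite -EFinM lee_fin mulr_ge0// ltW//.
  - by apply/measurable_EFinP; apply: measurable_funM; [exact: measurable_cst|exact: measurable_indic].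
  - by apply/measurable_EFinP; exact: mf.
  - move=> x _; rewrite -EFinM lee_fin indicE; have [xS|xS] := boolP (x \in S).
      by rewrite mulr1; move: xS; rewrite inE.
    by rewrite mulr0 big_seq; apply: sumr_ge0 => i si; rewrite mulr_ge0// w0.
have h2 : (\int[mu]_x (\sum_(i <- s) w i * \1_(A i) x)%:E <= (\sum_(i <- s) w i * m i)%:E)%E.
  suff H (s' : seq I) : {subset s' <= s} ->
    (\int[mu]_x (\sum_(i <- s') w i * \1_(A i) x)%:E <= (\sum_(i <- s') w i * m i)%:E)%E by exact: H.
  elim: s' => [|i s' IH] ss.
    by rewrite big_nil; under eq_integral do rewrite big_nil; rewrite integral0.
  rewrite big_cons; under eq_integral do rewrite big_cons EFinD.
  have is' : i \in s by apply: ss; rewrite mem_head.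
  have ss' : {subset s' <= s} by move=> j js; apply: ss; rewrite in_cons js orbT.
  rewrite ge0_integralD//.
  - rewrite EFinD; apply: leeD; last exact: IH.
    under eq_integral do rewrite EFinM.
    rewrite ge0_integralZl_EFin//.
    + have -> : (\int[mu]_x (\1_(A i) x)%:E = mu (A i))%E by rewrite integral_indic ?setIT//; exact: mA.
      rewrite [X in (_ <= X)%E]EFinM; apply: lee_wpmul2l; [by rewrite lee_fin w0|exact: Am].
    + by apply/measurable_EFinP/measurable_indic; exact: mA.
    + exact: w0.
  - by move=> x _; rewrite lee_fin mulr_ge0// w0.
  - apply/measurable_EFinP/measurable_funM; [exact: measurable_cst|by apply: measurable_indic; exact: mA].
  - by move=> x _; rewrite lee_fin big_seq; apply: sumr_ge0 => j js; rewrite mulr_ge0// w0// ss'.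
  - by apply/measurable_EFinP; exact: mf.
have := le_trans h1 h2.
by rewrite muleC -lee_pdivlMr.
Qed.

End Metric.

(** * Spacing of reduced fractions and criteria for null sets *)

Section Rationals.
Context {R : realType}.
Local Notation mu := (@lebesgue_measure R).
Local Open Scope classical_set_scope.

Definition dn (x : rat) : nat := `|denq x|%N.

Lemma dn_gt0 x : (0 < dn x)%N.
Proof. by rewrite /dn absz_gt0 denq_neq0. Qed.

Lemma dnE x : (dn x)%:R = (denq x)%:~R :> R.
Proof. by rewrite /dn natr_absz gtr0_norm// denq_gt0. Qed.

Lemma ratrE (x : rat) : ratr x = (numq x)%:~R / (dn x)%:R :> R.
Proof. by rewrite dnE. Qed.

Lemma coprime_numq_dn x : coprimez (numq x) (dn x).
Proof. by rewrite coprimezE; exact: coprime_num_den. Qed.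

Lemma rat_separation (x y : rat) : x != y ->
  1 <= `|ratr x - ratr y : R| * (dn x)%:R * (dn y)%:R.
Proof.
move=> xy.
have dx : (dn x)%:R != 0 :> R by rewrite pnatr_eq0 -lt0n dn_gt0.
have dy : (dn y)%:R != 0 :> R by rewrite pnatr_eq0 -lt0n dn_gt0.
have e : (ratr x - ratr y : R) * (dn x)%:R * (dn y)%:R =
   (numq x * denq y - numq y * denq x)%:~R.
  rewrite !ratrE intrB !intrM -!dnE; field; by rewrite ?dx ?dy.
have -> : `|ratr x - ratr y : R| * (dn x)%:R * (dn y)%:R =
   `|(numq x * denq y - numq y * denq x)%:~R|.
  by rewrite -e !normrM !normr_nat.
rewrite -intr_norm ler1z -gtz0_ge1 normr_gt0 subr_eq0.
apply: contra xy => /eqP h.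
rewrite -(divq_num_den x) -(divq_num_den y) eqr_div ?intr_eq0 ?denq_neq0//.
by rewrite -!intrM h.
Qed.

(** Distinct fractions with denominators below D are more than 1/D^2 apart, so x -> trunc((x - a)
    D^2) is injective. *)
Lemma rat_count (s : seq rat) (a b : R) (D : nat) : uniq s -> a <= b -> (0 < D)%N ->
  (forall x, x \in s -> (dn x < D)%N /\ a <= ratr x <= b) ->
  (size s)%:R <= (b - a) * D%:R ^+ 2 + 1.
Proof.
move=> us ab D0 sP.
have D0R : 0 < D%:R :> R by rewrite ltr0n.
pose f (x : rat) := Num.trunc ((ratr x - a) * D%:R ^+ 2 : R).
have ba : 0 <= (b - a) * D%:R ^+ 2 by rewrite mulr_ge0 ?sqr_ge0// subr_ge0.
have fpos x : x \in s -> 0 <= (ratr x - a) * D%:R ^+ 2.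
  by move=> /sP[_ /andP[h _]]; rewrite mulr_ge0 ?sqr_ge0// subr_ge0.
have finj : {in s &, injective f}.
  move=> x y xs ys e; apply/eqP; apply: contraT => xy.
  have := rat_separation x y xy.
  have := truncn_itv (fpos x xs); have := truncn_itv (fpos y ys).
  rewrite -/(f x) -/(f y) e -natr1.
  have [dx _] := sP x xs; have [dy _] := sP y ys.
  move=> /andP[y1 y2] /andP[x1 x2] h.
  have h2 : `|ratr x - ratr y : R| * D%:R ^+ 2 < 1.
    rewrite -[D%:R ^+ 2]ger0_norm ?sqr_ge0// -normrM ltr_norml mulrBl.
    move: x1 x2 y1 y2; rewrite !mulrBl; lra.
  have : `|ratr x - ratr y : R| * (dn x)%:R * (dn y)%:R <= `|ratr x - ratr y : R| * D%:R ^+ 2.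
    rewrite -mulrA; apply: ler_wpM2l => //; rewrite expr2.
    by apply: ler_pM => //; rewrite ler_nat ltnW.
  lra.
have : (size s <= (Num.trunc ((b - a) * D%:R ^+ 2)).+1)%N.
  rewrite -(size_map f) -(size_iota 0 (Num.trunc ((b - a) * D%:R ^+ 2)).+1).
  apply: uniq_leq_size; first by rewrite map_inj_in_uniq.
  move=> _ /mapP[x xs ->]; rewrite mem_iota /= add0n ltnS; apply: le_truncn.
  by have [_ /andP[_ h]] := sP x xs; rewrite ler_wpM2r ?sqr_ge0// lerD2r.
rewrite -(ler_nat R) -natr1 => h; apply: le_trans h _; rewrite lerD2r.
by rewrite truncn_le.
Qed.

Lemma rats_between (a b : R) (D : nat) : exists s : seq rat, uniq s /\
  forall x, x \in s = (dn x < D)%N && (a <= ratr x <= b).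
Proof.
pose n := (Num.trunc (`|a| + `|b|)).+1.
have n1 : `|a| + `|b| < n%:R by exact: truncnS_gt.
pose L := [seq (i%:Z - (n * D)%N%:Z)%:~R / (q%:R : rat) | i <- iota 0 (2 * (n * D)).+1, q <- iota 1 D].
exists [seq x <- undup L | (dn x < D)%N && (a <= ratr x <= b)]; split.
  by rewrite filter_uniq// undup_uniq.
move=> x; rewrite mem_filter mem_undup; apply: andb_idr => /andP[xD /andP[ax xb]].
have num : (`|numq x|%N <= n * D)%N.
  rewrite -(ler_nat R) natr_absz intr_norm.
  have -> : (numq x)%:~R = ratr x * (dn x)%:R :> R.
    by rewrite ratrE divfK// pnatr_eq0 -lt0n dn_gt0.
  rewrite normrM normr_nat natrM; apply: ler_pM => //; last by rewrite ler_nat ltnW.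
  rewrite ler_norml; have := ler_norm b; have := ler_norm (- a); rewrite normrN.
  have := normr_ge0 a; have := normr_ge0 b; lra.
have ei : (absz (numq x + (n * D)%N%:Z))%:Z = numq x + (n * D)%N%:Z.
  rewrite gez0_abs//; move: num; set m := (n * D)%N => num; lia.
apply/allpairsP; exists (absz (numq x + (n * D)%N%:Z), dn x); split; rewrite /fst /snd.
- rewrite mem_iota add0n ltnS -lez_nat ei.
  move: num; set m := (n * D)%N => num; lia.
- by rewrite mem_iota dn_gt0 add1n ltnS ltnW.
- rewrite ei addrK -[LHS](divq_num_den x); congr (_ / _).
  by rewrite /dn natr_absz gtr0_norm// denq_gt0.
Qed.

(** Quasi-independence of neighbourhoods of fractions. Only the y within 2 rho of x matter, at most
    4 rho Dl^2 + 1 of them. If there is one at all, separation gives 1 <= 2 rho Dk Dl, and the last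
    hypothesis converts this into 1 <= 4 rho Dl^2, which absorbs the +1. *)
Lemma pair_measure (x : rat) (s : seq rat) (Dk Dl : nat) (rho sig : R) :
  uniq s -> (dn x < Dk)%N -> (forall y, y \in s -> (dn y < Dl)%N /\ y != x) ->
  0 < sig -> sig <= rho ->
  (1 <= 2 * rho * Dk%:R * Dl%:R -> 1 <= 4 * rho * Dl%:R ^+ 2) ->
  (mu (`[(ratr x - rho)%R, (ratr x + rho)%R] `&`
     \big[setU/set0]_(y <- s) `[(ratr y - sig)%R, (ratr y + sig)%R])
   <= (16 * rho * Dl%:R ^+ 2 * sig)%:E)%E.
Proof.
move=> us xD sP s0 sr cond.
have r0 : 0 < rho by exact: lt_le_trans sr.
pose A (y : rat) : set R := `[(ratr y - sig)%R, (ratr y + sig)%R].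
have mA y : measurable (A y) by exact: measurable_itv.
have Am y : (mu (A y) <= (2 * sig)%:E)%E.
  rewrite measure_itvcc; last by lra.
  by rewrite lee_fin; lra.
pose s' := [seq y <- s | `|ratr x - ratr y : R| <= 2 * rho].
have us' : uniq s' by rewrite filter_uniq.
have [mU Um] := @measure_bigsetU_le R _ s' A (fun _ => 2 * sig)
   (fun i _ => mA i) (fun i _ => Am i).
apply: (@le_trans _ _ (mu (\big[setU/set0]_(y <- s') A y))).
  apply: le_measure; rewrite ?inE.
  - by apply: measurableI; [exact: measurable_itv|apply: bigsetU_measurable => y _; exact: mA].
  - exact: mU.
  - move=> z [/= xz /mem_bigsetU[y ys yz]]; apply/mem_bigsetU; exists y => //.
    rewrite mem_filter ys andbT; move: xz yz; rewrite /A /= !in_itv/= => /andP[h1 h2] /andP[h3 h4].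
    rewrite ler_norml; apply/andP; split; lra.
apply: le_trans Um _; rewrite lee_fin big_const_seq count_predT iter_addr_0 -[X in X <= _]mulr_natl.
have D0 : 0 <= 16 * rho * Dl%:R ^+ 2 * sig.
  by rewrite !mulr_ge0 ?sqr_ge0// ltW.
case E : s' => [|y0 s'']; first by rewrite mul0r.
rewrite -E.
have y0s : y0 \in s' by rewrite E mem_head.
have [yD yx] : (dn y0 < Dl)%N /\ y0 != x by apply: sP; move: y0s; rewrite mem_filter => /andP[].
have h1 : 1 <= 4 * rho * Dl%:R ^+ 2.
  apply: cond.
  have := rat_separation x y0; rewrite eq_sym yx => /(_ erefl) h; apply: le_trans h _.
  move: y0s; rewrite mem_filter => /andP[h _].
  apply: ler_pM => //; last by rewrite ler_nat ltnW.
  by apply: ler_pM => //; rewrite ler_nat ltnW.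
have := @rat_count s' (ratr x - 2 * rho) (ratr x + 2 * rho) Dl us'.
have -> : ratr x + 2 * rho - (ratr x - 2 * rho) = 4 * rho by ring.
have ab : ratr x - 2 * rho <= ratr x + 2 * rho by lra.
have Dl0 : (0 < Dl)%N by apply: leq_ltn_trans yD.
move=> /(_ ab Dl0) h; have {}h : (size s')%:R <= 4 * rho * Dl%:R ^+ 2 + 1.
  apply: h => y; rewrite mem_filter => /andP[yx' ys]; have [-> _] := sP y ys; split => //.
  by move: yx'; rewrite ler_norml => /andP[h2 h3]; apply/andP; split; lra.
apply: (@le_trans _ _ ((8 * rho * Dl%:R ^+ 2) * (2 * sig))).
  apply: ler_wpM2r; first by rewrite mulr_ge0// ltW.
  lra.
rewrite le_eqVlt; apply/orP; left; apply/eqP; ring.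
Qed.

(** Almost every point of A is a density point, where the proportion of A in small intervals tends
    to 1 > c. *)
Lemma null_of_density (A : set R) (c : R) : measurable A -> c < 1 ->
  (forall a b : R, a < b -> (mu (A `&` `]a, b[) <= (c * (b - a))%:E)%E) -> mu A = 0%E.
Proof.
move=> mA c1 Ac.
have [N [mN N0 AN]] := lebesgue_density mA.
apply/eqP; rewrite eq_le measure_ge0 andbT -N0; apply: le_measure; rewrite ?inE//.
move=> x Ax; apply: AN => /= h.
have : (1%:E <= c%:E :> \bar R)%E.
  have -> : 1%:E = (\1_A x)%:E :> \bar R by rewrite indicE mem_set.
  apply: (cvge_to_le h); near=> r.
  have r0 : 0 < r by near: r; exact: nbhs_right_gt.
  rewrite (lebesgue_measure_ball _ (ltW r0)) inver mulrn_eq0/= gt_eqF//.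
  rewrite lee_pdivrMr ?mulrn_wgt0// ball_itv.
  apply: le_trans (Ac (x - r) (x + r) _) _; first lra.
  by rewrite -EFinM lee_fin mulr2n le_eqVlt; apply/orP; left; apply/eqP; ring.
by rewrite lee_fin leNgt c1.
Unshelve. all: by end_near. Qed.

Lemma borel_cantelli (F : nat -> set R) (u : nat -> R) :
  (forall n, measurable (F n)) -> (forall n, 0 <= u n) ->
  (forall n, (mu (F n) <= (u n)%:E)%E) ->
  (exists C, forall n, \sum_(0 <= i < n) u i <= C) ->
  {ae mu, forall x, exists n0, forall n, (n0 <= n)%N -> ~ F n x}.
Proof.
move=> mF u0 Fu [C uC].
exists (lim_sup_set F); split.
- by apply: bigcapT_measurable => k; apply: bigcup_measurable => j _; exact: mF.
- apply: lim_sup_set_cvg0 => //.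
  apply: (@le_lt_trans _ _ C%:E); last by rewrite ltry.
  apply: lime_le; first by apply: is_cvg_nneseries.
  apply: nearW => n; apply: (@le_trans _ _ (\sum_(0 <= i < n) (u i)%:E)%E).
    by apply: lee_sum => i _; exact: Fu.
  by rewrite sumEFin lee_fin.
- move=> x /= h n _; apply: contrapT => h2; apply: h; exists n => k nk Fk.
  by apply: h2; exists k.
Qed.

End Rationals.

(** * Covers of exceptional sets and Dirichlet approximation *)

Section Covers.
Context {R : realType}.
Local Notation mu := (@lebesgue_measure R).
Local Open Scope classical_set_scope.

Lemma dyadic_bracket (v : R) (I : nat) : 1 <= v -> v < 2 ^+ I ->
  exists2 i, (i < I)%N & 2 ^+ i <= v < 2 ^+ i.+1.
Proof.
elim: I => [|I IH] v1 vI; first by move: vI; rewrite expr0; lra.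
have [vI'|vI'] := ltP v (2 ^+ I).
  by have [i iI h] := IH v1 vI'; exists i => //; rewrite ltnS ltnW.
by exists I => //; rewrite vI' vI.
Qed.

Lemma exists_exp2_gt (v : R) : exists I : nat, v < 2 ^+ I.
Proof.
exists (Num.trunc v).+1; apply: lt_le_trans (truncnS_gt v) _.
by rewrite -natrX ler_nat ltnW// ltn_expl.
Qed.

Lemma sum_half_le (I : nat) : \sum_(i <- iota 0 I) (2 ^+ i : R)^-1 <= 2.
Proof.
suff -> : \sum_(i <- iota 0 I) (2 ^+ i : R)^-1 = 2 - 2 * (2 ^+ I)^-1.
  by rewrite gerBl mulr_ge0// invr_ge0 exprn_ge0.
elim: I => [|I IH]; first by rewrite big_nil expr0 invr1 mulr1 subrr.
rewrite -addn1 iotaD big_cat /= big_seq1 IH add0n addn1 exprS.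
have : 2 ^+ I != 0 :> R by rewrite expf_neq0.
by move: (2 ^+ I) => c c0; field; rewrite ?c0.
Qed.

(* Dyadic layers of the values of (h ||h x||)^-1 and Markov's inequality. *)
Lemma truncated_cover (H : nat) (a b tau t : R) : a <= b -> 0 < tau -> 0 < t ->
  exists U : set R, [/\ measurable U,
   (mu U <= (8 * tau / t * \sum_(1 <= h < H.+1) (((b - a) + 2 / h%:R) / h%:R))%:E)%E &
   forall x, a <= x <= b ->
    t <= \sum_(1 <= h < H.+1)
      (if (h%:R * dint (h%:R * x))^-1 <= tau then ((h%:R * dint (h%:R * x)) ^+ 2)^-1 else 0) ->
    U x].
Proof.
move=> ab tau0 t0.
have [I HI] := exists_exp2_gt (H%:R * tau).
have /choice [A AP] : forall p : nat * nat, exists U : set R, (0 < p.1)%N -> [/\ measurable U,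
    (mu U <= (2 * (2 ^+ p.2.+1 / (p.1%:R * tau)) * ((b - a) + 2 / p.1%:R))%:E)%E &
    forall x, a <= x <= b -> dint (p.1%:R * x) <= 2 ^+ p.2.+1 / (p.1%:R * tau) -> U x].
  move=> [[|h] i]; first by exists set0.
  have c0 : 0 <= 2 ^+ i.+1 / (h.+1%:R * tau).
    by rewrite divr_ge0// ?exprn_ge0// mulr_ge0// ltW.
  have [U UP] := @dint_cover R h.+1 a b _ isT ab c0.
  by exists U.
pose s := [seq (h, i) | h <- index_iota 1 H.+1, i <- iota 0 I].
(* On the layer 2^i <= h ||h x|| tau < 2^(i+1) the term is at most tau^2 / 4^i, and the layer is
   contained in ||h x|| <= 2^(i+1) / (h tau). Weight times measure decays like 2^-i, hence one
   factor tau in total. *)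
pose w (p : nat * nat) : R := tau ^+ 2 / 4 ^+ p.2.
pose m (p : nat * nat) : R := 2 * (2 ^+ p.2.+1 / (p.1%:R * tau)) * ((b - a) + 2 / p.1%:R).
have sP p : p \in s -> (0 < p.1)%N.
  by move=> /allpairsP[[h i] /= [hs _ ->]] /=; move: hs; rewrite mem_index_iota => /andP[].
have w0 p : 0 <= w p by rewrite /w divr_ge0 ?sqr_ge0// exprn_ge0.
have [mU Um] := @markov_indic R _ s A w m t t0
  (fun p ps => let: And3 h _ _ := AP p (sP p ps) in h) (fun p _ => w0 p)
  (fun p ps => let: And3 _ h _ := AP p (sP p ps) in h).
eexists; split; first exact: mU.
  apply: le_trans Um _; rewrite lee_fin [X in _ <= X]mulrAC.
  rewrite ler_pM2r ?invr_gt0// /s big_allpairs_dep /= mulr_sumr big_seq [X in _ <= X]big_seq.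
  apply: ler_sum => h; rewrite mem_index_iota => /andP[h0 _].
  have hR : 0 < h%:R :> R by rewrite ltr0n.
  have -> : \sum_(i <- iota 0 I) w (h, i) * m (h, i) =
     (4 * tau * ((b - a + 2 / h%:R) / h%:R)) * \sum_(i <- iota 0 I) (2 ^+ i)^-1.
    rewrite mulr_sumr; apply: eq_bigr => i _; rewrite /w /m /= (exprS _ i).
    have -> : 4 ^+ i = 2 ^+ i * 2 ^+ i :> R by rewrite -exprMn; congr (_ ^+ _); ring.
    have : 2 ^+ i != 0 :> R by rewrite expf_neq0.
    move: (2 ^+ i) => c c0; field; rewrite ?c0 ?gt_eqF//.
  have K0 : 0 <= 4 * tau * ((b - a + 2 / h%:R) / h%:R).
    apply: mulr_ge0; first by rewrite mulr_ge0// (ltW tau0).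
    by apply: divr_ge0 => //; apply: addr_ge0; [rewrite subr_ge0|rewrite divr_ge0].
  have := sum_half_le I; move: (\sum_(_ <- _) _) K0 => S K0 S2.
  move: (_ / h%:R) K0 => K K0; nra.
move=> x xab tx; apply: le_trans tx _.
rewrite /s big_allpairs_dep /= big_seq [X in _ <= X]big_seq.
apply: ler_sum => h; rewrite mem_index_iota => /andP[h0 hH].
have hR : 0 < h%:R :> R by rewrite ltr0n.
have nn i : 0 <= w (h, i) * \1_(A (h, i)) x by rewrite mulr_ge0.
case: ifP => htau; last by apply: sumr_ge0 => i _; exact: nn.
(* When ||h x|| = 0 the convention 1/0 = 0 makes the term vanish. *)
have [d0|d0] := eqVneq (dint (h%:R * x)) 0.
  by rewrite d0 mulr0 expr0n invr0; apply: sumr_ge0 => i _; exact: nn.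
have dgt : 0 < dint (h%:R * x) by rewrite lt_neqAle eq_sym d0 dint_ge0.
set d := dint (h%:R * x) in htau d0 dgt *.
pose v := h%:R * d * tau.
have hd : 0 < h%:R * d by rewrite mulr_gt0.
have v1 : 1 <= v.
  by move: htau; rewrite -[X in X <= _]mul1r ler_pdivrMr// mulrC.
have vI : v < 2 ^+ I.
  apply: le_lt_trans HI; rewrite ler_pM2r//.
  apply: (@le_trans _ _ (h%:R * 1)); last by rewrite mulr1 ler_nat -ltnS.
  rewrite ler_pM2l//; apply: le_trans (dint_le_half _) _; lra.
have [i iI /andP[i1 i2]] := dyadic_bracket _ _ v1 vI.
rewrite (big_rem i) ?mem_iota//=; apply: ler_wpDr; first by apply: sumr_ge0 => k _; exact: nn.
have [_ _ /(_ x xab) hA] := AP (h, i) h0.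
have -> : \1_(A (h, i)) x = 1 :> R.
  rewrite indicE mem_set//; apply: hA => /=.
  rewrite ler_pdivlMr ?mulr_gt0//; apply: ltW; apply: le_lt_trans i2.
  by rewrite /v mulrCA mulrA.
rewrite mulr1 /w /= ler_pdivlMr ?exprn_gt0//.
have -> : tau ^+ 2 = ((h%:R * d) ^+ 2)^-1 * v ^+ 2.
  by rewrite /v [(_ * tau) ^+ 2]exprMn mulrA mulVf ?mul1r// expf_neq0// gt_eqF.
apply: ler_wpM2l; first by rewrite invr_ge0 sqr_ge0.
have -> : 4 ^+ i = (2 ^+ i) ^+ 2 :> R by rewrite -exprM mulnC exprM; congr (_ ^+ _); rewrite expr2; ring.
by rewrite ler_sqr ?nnegrE ?exprn_ge0// (le_trans _ v1).
Qed.

(** Pigeonhole among the fractional parts of 0, alpha, ..., Q alpha. The fraction n/q found is then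
    reduced: its denominator divides q, so the bound stated with it is weaker than 1/(qQ). *)
Lemma dirichlet_approximation (alpha : R) (Q : nat) : (0 < Q)%N ->
  exists x : rat, (dn x <= Q)%N /\ `|alpha - ratr x| <= ((dn x)%:R * Q%:R)^-1.
Proof.
move=> Q0; have QR : 0 < Q%:R :> R by rewrite ltr0n.
pose fr (j : nat) : R := j%:R * alpha - (Num.floor (j%:R * alpha))%:~R.
have fr0 j : 0 <= fr j by rewrite subr_ge0 floor_le.
have fr1 j : fr j < 1 by rewrite ltrBlDl -[1]/(1%:~R) -intrD floorD1_gt.
pose f j := Num.trunc (Q%:R * fr j).
have : ~~ uniq (map f (iota 0 Q.+1)).
  apply/negP => u.
  have := @uniq_leq_size _ (map f (iota 0 Q.+1)) (iota 0 Q) u.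
  suff sub : {subset map f (iota 0 Q.+1) <= iota 0 Q}.
    by move=> /(_ sub); rewrite size_map !size_iota ltnn.
  move=> _ /mapP[j _ ->]; rewrite mem_iota add0n truncn_lt_nat ?mulr_ge0//.
  by rewrite leq0n /= -[X in _ < X]mulr1 ltr_pM2l.
move=> /(uniqPn 0%N)[i [j [ij]]]; rewrite size_map size_iota => jQ.
rewrite !(nth_map 0%N) ?size_iota ?(ltn_trans ij)// !nth_iota ?(ltn_trans ij)// !add0n => fij.
pose q := (j - i)%N; pose n := Num.floor (j%:R * alpha) - Num.floor (i%:R * alpha).
have q0 : (0 < q)%N by rewrite subn_gt0.
have qQ : (q <= Q)%N by apply: leq_trans (leq_subr _ _) _; rewrite -ltnS.
have qR : 0 < q%:R :> R by rewrite ltr0n.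
have h1 : `|q%:R * alpha - n%:~R| <= Q%:R^-1.
  have -> : q%:R * alpha - n%:~R = fr j - fr i.
    by rewrite /q /n /fr natrB ?(ltnW ij)// intrB; ring.
  rewrite -[Q%:R^-1]mul1r ler_pdivlMr// -[X in _ * X]ger0_norm// -normrM mulrBl.
  have := truncn_itv (mulr_ge0 (ltW QR) (fr0 i)); have := truncn_itv (mulr_ge0 (ltW QR) (fr0 j)).
  rewrite -/(f i) -/(f j) fij -natr1 => /andP[a1 a2] /andP[a3 a4].
  rewrite ler_norml; apply/andP; split; lra.
pose x : rat := n%:~R / q%:R.
have ex : ratr x = n%:~R / q%:R :> R by rewrite /x fmorph_div /= ratr_int ratr_nat.
have dq : (dn x %| q)%N.
  have e : numq x * q%:Z = n * denq x.
    apply: (@intr_inj rat); rewrite !intrM.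
    have dx : (denq x)%:~R != 0 :> rat by rewrite intr_eq0 denq_neq0.
    have qx : (q%:Z)%:~R != 0 :> rat by rewrite intr_eq0 -lt0n.
    have : (numq x)%:~R / (denq x)%:~R = n%:~R / (q%:Z)%:~R :> rat by rewrite divq_num_den.
    by move=> /eqP; rewrite eqr_div// => /eqP.
  have /(congr1 absz) := e; rewrite !abszM /= => e'.
  have : (dn x %| `|numq x| * q)%N by rewrite e' dvdn_mull.
  by rewrite Gauss_dvdr// coprime_sym coprime_num_den.
exists x; have dle := dvdn_leq q0 dq; split; first exact: leq_trans qQ.
have d0 : 0 < (dn x)%:R :> R by rewrite ltr0n dn_gt0.
apply: (@le_trans _ _ ((q%:R * Q%:R)^-1)); last first.
  by rewrite lef_pV2 ?posrE ?mulr_gt0// ler_pM2r// ler_nat.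
have -> : alpha - ratr x = (q%:R * alpha - n%:~R) / q%:R by rewrite ex; field; rewrite gt_eqF.
by rewrite normrM normfV (gtr0_norm qR) invfM mulrC ler_pM2l ?invr_gt0.
Qed.

Lemma dint_cover_family (s : seq nat) (a b : R) (t : nat -> R) : a <= b ->
  (forall h, h \in s -> (0 < h)%N) -> (forall h, 0 <= t h) ->
  exists U : set R, [/\ measurable U,
    (mu U <= (\sum_(h <- s) 2 * t h * ((b - a) + 2 / h%:R))%:E)%E &
    forall x, a <= x <= b -> (exists2 h, h \in s & dint (h%:R * x) <= t h) -> U x].
Proof.
move=> ab s0 t0.
have /choice [A AP] : forall h : nat, exists U : set R, (0 < h)%N -> [/\ measurable U,
    (mu U <= (2 * t h * ((b - a) + 2 / h%:R))%:E)%E &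
    forall x, a <= x <= b -> dint (h%:R * x) <= t h -> U x].
  move=> [|h]; first by exists set0.
  by have [U UP] := @dint_cover R h.+1 a b _ isT ab (t0 h.+1); exists U.
have [mU Um] := @measure_bigsetU_le R _ s A (fun h => 2 * t h * ((b - a) + 2 / h%:R))
  (fun h hs => let: And3 h _ _ := AP h (s0 h hs) in h)
  (fun h hs => let: And3 _ h _ := AP h (s0 h hs) in h).
eexists; split; [exact: mU|exact: Um|].
move=> x xab [h hs xt]; apply/mem_bigsetU; exists h => //.
by have [_ _] := AP h (s0 h hs); exact.
Qed.

End Covers.

(** * Approximation by fractions with small V *)

Section GoodFractions.
Context {R : realType}.
Local Notation mu := (@lebesgue_measure R).
Local Open Scope classical_set_scope.

Definition Vsum (x : rat) : R :=
  \sum_(1 <= h < dn x) ((h%:R * dint (h%:R * ((numq x)%:~R / (dn x)%:R))) ^+ 2)^-1.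

Lemma dint_ratr_ge (x : rat) (h : nat) : (1 <= h < dn x)%N ->
  (dn x)%:R^-1 <= dint (h%:R * ratr x : R).
Proof.
move=> /andP[h1 hx]; rewrite ratrE; apply: dint_frac_ge; [exact: dn_gt0|exact: coprime_numq_dn|].
by rewrite gtnNdvd.
Qed.

(* For h < dn x the points h * ratr x and h * alpha differ by at most ||h * ratr x||. *)
Lemma Vsum_le (x : rat) (alpha : R) (Q : nat) : (dn x <= Q)%N ->
  `|alpha - ratr x| <= ((dn x)%:R * Q%:R)^-1 ->
  (forall h, (1 <= h <= Q)%N -> 0 < dint (h%:R * alpha)) ->
  Vsum x <= 4 * \sum_(1 <= h < Q.+1) ((h%:R * dint (h%:R * alpha)) ^+ 2)^-1.
Proof.
move=> xQ ax a0.
have d0 : 0 < (dn x)%:R :> R by rewrite ltr0n dn_gt0.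
have Q0 : 0 < Q%:R :> R by rewrite ltr0n (leq_trans _ xQ)// dn_gt0.
apply: (@le_trans _ _ (4 * \sum_(1 <= h < dn x) ((h%:R * dint (h%:R * alpha)) ^+ 2)^-1)); last first.
  rewrite ler_pM2l// [X in _ <= X](@big_cat_nat _ _ _ (dn x) 1 Q.+1)//= ?dn_gt0//; last exact: leqW.
  by rewrite lerDl; apply: sumr_ge0 => h _; rewrite invr_ge0 sqr_ge0.
rewrite mulr_sumr /Vsum -ratrE; apply: ler_sum_nat => h /andP[h1 hx].
have hQ : (1 <= h <= Q)%N by rewrite h1 (leq_trans (ltnW hx)).
have h0 : 0 < h%:R :> R by rewrite ltr0n.
have dx : (dn x)%:R^-1 <= dint (h%:R * ratr x : R) by apply: dint_ratr_ge; rewrite h1.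
have da := a0 h hQ.
have dle : dint (h%:R * alpha) <= 2 * dint (h%:R * ratr x).
  have := dintD (h%:R * ratr x) (h%:R * (alpha - ratr x)).
  rewrite -mulrDr [ratr x + _]addrC subrK normrM normr_nat.
  have : h%:R * `|alpha - ratr x| <= (dn x)%:R^-1.
    apply: (@le_trans _ _ ((dn x)%:R * ((dn x)%:R * Q%:R)^-1)).
      by apply: ler_pM => //; rewrite ler_nat ltnW.
    rewrite invfM mulrA divff ?gt_eqF// mul1r lef_pV2 ?posrE// ler_nat//.
  lra.
have d1 : 0 < dint (h%:R * ratr x : R) by apply: lt_le_trans dx; rewrite invr_gt0.
rewrite (_ : 4 = (2^-1 ^+ 2)^-1 :> R); last by field.
rewrite -invfM -exprMn lef_pV2 ?posrE ?exprn_gt0 ?mulr_gt0 ?invr_gt0//.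
rewrite ler_sqr ?nnegrE ?mulr_ge0 ?invr_ge0 ?dint_ge0// mulrCA ler_pM2l//; lra.
Qed.

Lemma ln2_le1 : ln 2 <= 1 :> R.
Proof. by have := @le_ln1Dx R 1; rewrite (_ : 1 + 1 = 2 :> R); [apply; lra|ring]. Qed.

Lemma sum_inv_pow64 (k m : nat) : (m <= 64 ^ k)%N -> \sum_(1 <= h < m.+1) (h%:R : R)^-1 <= 1 + 6 * k%:R.
Proof.
move=> mk; apply: le_trans (sum_inv_le m) _; rewrite lerD2l.
have [->|m0] := posnP m; first by rewrite ln0// mulr_ge0.
apply: (@le_trans _ _ (ln (64 ^+ k))).
  by rewrite ler_ln ?posrE ?ltr0n ?exprn_gt0// -natrX ler_nat.
rewrite lnXn// -[X in X <= _]mulr_natr; apply: ler_wpM2r => //.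
rewrite (_ : 64 = 2 ^+ 6 :> R); last by rewrite -natrX.
rewrite lnXn// -[X in X <= _]mulr_natl; have := ln2_le1; lra.
Qed.

Lemma sum_cover_le (L : R) (k m : nat) : 0 <= L -> (1 <= k)%N -> (m <= 64 ^ k.+1)%N ->
  \sum_(1 <= h < m.+1) ((L + 2 / h%:R) / h%:R) <= 13 * k%:R * L + 4.
Proof.
move=> L0 k1 mk.
have -> : \sum_(1 <= h < m.+1) ((L + 2 / h%:R) / h%:R) =
   L * \sum_(1 <= h < m.+1) h%:R^-1 + 2 * \sum_(1 <= h < m.+1) (h%:R ^+ 2)^-1.
  by rewrite !mulr_sumr -big_split/=; apply: eq_bigr => h _; rewrite mulrDl -mulrA expr2 invfM.
have h1 := sum_inv_pow64 _ _ mk; have h2 := @sum_inv2_le R m.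
have k1' : 1 <= k%:R :> R by rewrite ler1n.
move: h1 h2; rewrite -natr1; move: (\sum_(_ <= _ < _) _) (\sum_(_ <= _ < _) _) => A B h1 h2.
nra.
Qed.

(** Dirichlet's theorem at height Q attaches to alpha a reduced fraction. It is good, with alpha in
    its window of radius 1/(PQ), unless its denominator is below P = 64^k, or some h ||h alpha|| <=
    1/tau, or the truncated sum is large; each of these has measure about (b - a)/16. Windows of
    good fractions thus cover half of the interval, which forces their number. The ratio 64 gives Q
    >= 32P and so the 1/16 of the first set. The room 64^(-2k) before b is meant for the one-sided
    intervals of [approx_set]. *)
Lemma good_count : exists2 A0 : R, 0 < A0 & forall a b : R, a < b -> exists k0 : nat, forall k, (k0 <= k)%N ->
  exists s : seq rat, [/\ uniq s,
    forall x, x \in s -> [/\ (64 ^ k <= dn x < 64 ^ k.+1)%N, a <= ratr x,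
       ratr x + (64 ^+ (2 * k))^-1 <= b & Vsum x <= A0 * k%:R ^+ 2] &
    (b - a) * 64 ^+ (2 * k) <= (size s)%:R].
Proof.
have [A eA] : exists A : R, A = 832 ^+ 2 by exists (832 ^+ 2).
have A0 : 0 < A by rewrite eA; apply: exprn_gt0; lra.
exists (4 * A); first by apply: mulr_gt0 A0; lra.
move=> a b ab.
pose L := b - a; have L0 : 0 < L by rewrite subr_gt0.
exists (Num.trunc (64 / L)).+1 => k kk.
have k64 : 64 / L <= k%:R.
  by apply: le_trans (ltW (truncnS_gt (64 / L))) _; rewrite ler_nat.
have k1 : (1 <= k)%N by apply: leq_trans kk.
have kR : 0 < k%:R :> R by rewrite ltr0n.
have k1R : 1 <= k%:R :> R by rewrite ler1n.
have kL : k%:R^-1 <= L / 64.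
  by rewrite -[L / 64]invrK invf_div lef_pV2 ?posrE ?divr_gt0.
pose P := (64 ^ k)%N; pose Q := (64 ^ k.+1).-1.
have P0 : (0 < P)%N by rewrite expn_gt0.
have PR : 0 < P%:R :> R by rewrite ltr0n.
have eQ : Q.+1 = (64 * P)%N by rewrite /Q prednK ?expn_gt0// expnS.
have Q64 : (Q < 64 ^ k.+1)%N by rewrite /Q prednK// expn_gt0.
have PQ : (32 * P <= Q)%N by rewrite -ltnS eQ ltn_pmul2r.
have Q0 : (0 < Q)%N by apply: leq_trans PQ; rewrite muln_gt0.
have QR : 0 < Q%:R :> R by rewrite ltr0n.
have PQR : 32 * P%:R <= Q%:R :> R by rewrite -natrM ler_nat.
have kP : k%:R <= P%:R :> R.
  by rewrite ler_nat ltnW// ltn_expl.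
have kP2 : k%:R ^+ 2 <= P%:R :> R.
  rewrite -natrX ler_nat; apply: ltnW.
  have -> : P = ((8 ^ k) ^ 2)%N by rewrite /P -expnM mulnC expnM.
  by rewrite ltn_sqr ltn_expl.
have ePP : 64 ^+ (2 * k) = P%:R * P%:R :> R by rewrite mul2n -addnn exprD -natrX.
(* 416 = 16 * 26 and A = 832^2 make the leading parts of the measures of [U2] and [U3] equal to
   L/16. *)
pose tau : R := 416 * k%:R; have tau0 : 0 < tau by apply: mulr_gt0 kR; lra.
pose t : R := A * k%:R ^+ 2; have t0 : 0 < t by rewrite mulr_gt0 ?exprn_gt0.
have iotaP h : h \in index_iota 1 P -> (0 < h)%N by rewrite mem_index_iota => /andP[].
have iotaQ h : h \in index_iota 1 Q.+1 -> (0 < h)%N by rewrite mem_index_iota => /andP[].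
have Qi0 : 0 <= Q%:R^-1 :> R by rewrite invr_ge0 ltW.
have [U1 [mU1 U1m U1P]] := @dint_cover_family R (index_iota 1 P) a b (fun _ => Q%:R^-1) (ltW ab) iotaP (fun _ => Qi0).
have ti0 h : 0 <= (h%:R * tau)^-1 :> R by rewrite invr_ge0 mulr_ge0// ltW.
have [U2 [mU2 U2m U2P]] := @dint_cover_family R (index_iota 1 Q.+1) a b (fun h => (h%:R * tau)^-1) (ltW ab) iotaQ ti0.
have [U3 [mU3 U3m U3P]] := @truncated_cover R Q a b tau t (ltW ab) tau0 t0.
have S1 := sum_cover_le L k Q (ltW L0) k1 (ltnW Q64).
have c1 : \sum_(h <- index_iota 1 P) 2 * Q%:R^-1 * (b - a + 2 / h%:R) <= L / 16 + 2 / k%:R.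
  rewrite -mulr_sumr big_split/= sumr_const_nat -mulr_sumr -/L.
  have h1 : \sum_(1 <= h < P) (h%:R : R)^-1 <= 1 + 6 * k%:R.
    apply: le_trans (_ : \sum_(1 <= h < P.+1) (h%:R : R)^-1 <= _).
      by rewrite [X in _ <= X]big_nat_recr//= lerDl invr_ge0.
    exact: sum_inv_pow64.
  have h2 : L *+ (P - 1) <= L * P%:R.
    by rewrite -[X in X <= _]mulr_natr; apply: ler_wpM2l; [exact: ltW|rewrite ler_nat leq_subr].
  apply: (@le_trans _ _ (2 * (32 * P%:R)^-1 * (L * P%:R + 14 * k%:R))).
    apply: ler_pM.
    - by rewrite mulr_ge0.
    - apply: addr_ge0; first by rewrite mulrn_wge0// ltW.
      by rewrite mulr_ge0// sumr_ge0// => i _; rewrite invr_ge0.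
    - by rewrite ler_pM2l// lef_pV2 ?posrE// mulr_gt0.
    - by apply: lerD => //; move: h1; lra.
  have -> : 2 * (32 * P%:R)^-1 * (L * P%:R + 14 * k%:R) = L / 16 + (14 / 16) * (k%:R / P%:R).
    by field; rewrite gt_eqF.
  rewrite lerD2l; have h3 : k%:R / P%:R <= k%:R^-1 :> R.
    by rewrite ler_pdivrMr// mulrC ler_pdivlMr// -expr2.
  have : 0 <= k%:R^-1 :> R by rewrite invr_ge0 ltW.
  move: h3; move: (k%:R / P%:R) (k%:R^-1) => x y; lra.
have c2 : \sum_(h <- index_iota 1 Q.+1) 2 * (h%:R * tau)^-1 * (b - a + 2 / h%:R) <= L / 16 + k%:R^-1.
  have -> : \sum_(h <- index_iota 1 Q.+1) 2 * (h%:R * tau)^-1 * (b - a + 2 / h%:R) =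
    (2 / tau) * \sum_(1 <= h < Q.+1) ((L + 2 / h%:R) / h%:R).
    rewrite mulr_sumr; apply: eq_bigr => h _; rewrite invfM -/L; ring.
  apply: le_trans (ler_wpM2l _ S1) _; first by rewrite divr_ge0// ltW.
  have -> : 2 / tau * (13 * k%:R * L + 4) = L / 16 + (8 / 416) * k%:R^-1.
    by rewrite /tau; field; rewrite gt_eqF.
  have : 0 <= k%:R^-1 :> R by rewrite invr_ge0 ltW.
  lra.
have c3 : 8 * tau / t * \sum_(1 <= h < Q.+1) ((b - a + 2 / h%:R) / h%:R) <= L / 16 + k%:R^-1.
  apply: le_trans (ler_wpM2l _ S1) _; first by apply: divr_ge0 (ltW t0); apply: mulr_ge0 (ltW tau0); lra.
  have -> : 8 * tau / t * (13 * k%:R * L + 4) = L / 16 + (1 / 52) * k%:R^-1.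
    by rewrite /tau /t eA; field; rewrite gt_eqF.
  have : 0 <= k%:R^-1 :> R by rewrite invr_ge0 ltW.
  lra.
have [s0 [us0 s0P]] := @rats_between R a b (64 ^ k.+1).
pose s := [seq x <- s0 | [&& (64 ^ k <= dn x)%N, ratr x + (64 ^+ (2 * k))^-1 <= b &
   Vsum x <= 4 * A * k%:R ^+ 2]].
have us : uniq s by rewrite filter_uniq.
pose r : R := (P%:R * Q%:R)^-1.
have r0 : 0 < r by rewrite invr_gt0 mulr_gt0.
pose W (x : rat) : set R := `[(ratr x - r)%R, (ratr x + r)%R].
have mW x : measurable (W x) by exact: measurable_itv.
have Wm x : (mu (W x) <= (2 * r)%:E)%E.
  rewrite measure_itvcc; last by clear -r0; lra.
  by rewrite lee_fin; clear; lra.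
have [mUW UWm] := @measure_bigsetU_le R _ s W (fun _ => 2 * r) (fun x _ => mW x) (fun x _ => Wm x).
set UW := \big[setU/set0]_(i <- s) W i in mUW UWm.
have rL : r <= L / 64.
  apply: le_trans kL; rewrite lef_pV2 ?posrE ?mulr_gt0//; apply: le_trans kP _.
  by rewrite -[X in X <= _]mulr1 ler_pM2l// ler1n.
have PPL : (64 ^+ (2 * k))^-1 <= L / 64.
  apply: le_trans kL; rewrite ePP lef_pV2 ?posrE ?mulr_gt0//; apply: le_trans kP _.
  by rewrite -[X in X <= _]mulr1 ler_pM2l// ler1n.
have cover : `[(a + L / 8)%R, (b - L / 8)%R] `<=` U1 `|` U2 `|` U3 `|` UW.
  move=> al /=; rewrite in_itv/= => /andP[al1 al2].
  have alab : a <= al <= b.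
    by clear -al1 al2 L0; apply/andP; split; lra.
  have [|nU1] := pselect (U1 al); first by left; left; left.
  have [|nU2] := pselect (U2 al); first by left; left; right.
  have [|nU3] := pselect (U3 al); first by left; right.
  right; apply/mem_bigsetU.
  have [x [xQ xal]] := @dirichlet_approximation R al Q Q0.
  have xR : 0 < (dn x)%:R :> R by rewrite ltr0n dn_gt0.
  have Px : (P <= dn x)%N.
    rewrite leqNgt; apply/negP => xP; apply: nU1; apply: U1P => //.
    exists (dn x); first by rewrite mem_index_iota dn_gt0.
    apply: le_trans (dint_le _ (numq x)) _.
    have -> : (dn x)%:R * al - (numq x)%:~R = (dn x)%:R * (al - ratr x).
      by rewrite mulrBr ratrE mulrCA divff ?mulr1// gt_eqF.
    rewrite normrM normr_nat; apply: le_trans (ler_wpM2l (ltW xR) xal) _.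
    by rewrite invfM mulrA divff ?gt_eqF// mul1r.
  have dQ h : (1 <= h <= Q)%N -> (h%:R * tau)^-1 < dint (h%:R * al).
    move=> /andP[h1 hQ]; rewrite ltNge; apply/negP => hd; apply: nU2; apply: U2P => //.
    by exists h => //; rewrite mem_index_iota h1 ltnS.
  have dQ0 h : (1 <= h <= Q)%N -> 0 < dint (h%:R * al).
    by move=> /dQ; apply: le_lt_trans.
  have alr : `|al - ratr x| <= r.
    apply: le_trans xal _; rewrite lef_pV2 ?posrE ?mulr_gt0// ler_pM2r// ler_nat//.
  have Z : \sum_(1 <= h < Q.+1) ((h%:R * dint (h%:R * al)) ^+ 2)^-1 <= t.
    rewrite leNgt; apply/negP => tZ; apply: nU3; apply: U3P => //; apply: le_trans (ltW tZ) _.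
    apply: ler_sum_nat => h hQ; case: ifP => // /negP[].
    have h0 : 0 < h%:R :> R by rewrite ltr0n; case/andP: hQ.
    have := dQ h hQ; have := dQ0 h hQ; move: (dint _) => d d0 hd.
    apply: le_trans (_ : ((h%:R * tau)^-1)^-1 / h%:R <= _); last first.
      by rewrite invrK mulrAC divff ?mul1r// gt_eqF.
    rewrite invfM mulrC; apply: ler_wpM2r; first by rewrite invr_ge0 ltW.
    by rewrite lef_pV2 ?posrE// ?(ltW hd)// invr_gt0; apply: mulr_gt0.
  have VV := Vsum_le x al Q xQ xal dQ0.
  move: (alr); rewrite ler_norml => /andP[al3 al4].
  exists x; last first.
    by rewrite /W /= in_itv/=; clear -al3 al4; apply/andP; split; lra.
  have x1 : Vsum x <= 4 * A * k%:R ^+ 2 by apply: le_trans VV _; rewrite -mulrA ler_pM2l.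
  have x2 : a <= ratr x by clear -al1 al4 rL L0; lra.
  have x3 : ratr x <= b by clear -al2 al3 rL L0; lra.
  have x4 : ratr x + (64 ^+ (2 * k))^-1 <= b by clear -al2 al3 rL PPL L0; lra.
  rewrite mem_filter s0P x1 x2 x3 x4 (leq_ltn_trans xQ Q64) !andbT; exact: Px.
exists s; split => //.
  move=> x; rewrite mem_filter s0P => /andP[/and3P[h1 h2 h3] /andP[h4 /andP[h5 h6]]].
  by split => //; rewrite h1.
have m1 : (mu (`[(a + L / 8)%R, (b - L / 8)%R] : set R) <=
   (L / 16 + 2 / k%:R)%:E + (L / 16 + k%:R^-1)%:E + (L / 16 + k%:R^-1)%:E + (2 * r * (size s)%:R)%:E)%E.
  apply: le_trans (le_measure mu _ _ cover) _; rewrite ?inE//.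
    by apply: measurableU => //; apply: measurableU => //; apply: measurableU.
  apply: (@le_trans _ _ (mu (U1 `|` U2 `|` U3) + mu UW)%E).
    by apply: measureU2 => //; apply: measurableU => //; apply: measurableU.
  apply: leeD.
    apply: (@le_trans _ _ (mu (U1 `|` U2) + mu U3)%E).
      by apply: measureU2 => //; apply: measurableU.
    apply: leeD; last by apply: le_trans U3m _; rewrite lee_fin.
    apply: (@le_trans _ _ (mu U1 + mu U2)%E); first exact: measureU2.
    by apply: leeD; [apply: le_trans U1m _|apply: le_trans U2m _]; rewrite lee_fin.
  apply: le_trans UWm _.
  by rewrite lee_fin big_const_seq count_predT iter_addr_0 -[X in X <= _]mulr_natr.
move: m1; rewrite measure_itvcc; last by rewrite /L; clear -ab; lra.
rewrite -!EFinD lee_fin => m1.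
have r1 : 2 * r <= (16 * (P%:R * P%:R))^-1.
  rewrite /r -[2]invrK -invfM lef_pV2 ?posrE ?mulr_gt0//.
  have : P%:R * (32 * P%:R) <= P%:R * Q%:R :> R by rewrite ler_pM2l.
  clear; lra.
rewrite ePP -/L.
have PP0 : 0 < P%:R * P%:R :> R by rewrite mulr_gt0.
have : L / 2 <= 2 * r * (size s)%:R.
  by move: m1 kL; move: (2 * r * _) (k%:R^-1) => x y; rewrite /L; clear; lra.
have : 2 * r * (size s)%:R <= (16 * (P%:R * P%:R))^-1 * (size s)%:R by apply: ler_wpM2r.
move=> h1 h2; have := le_trans h2 h1.
rewrite [X in _ <= X]mulrC ler_pdivlMr; last by apply: mulr_gt0 PP0; clear; lra.
have : 0 < L * (P%:R * P%:R) by rewrite mulr_gt0.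
move: (P%:R * P%:R) ((size s)%:R) => x y; clear; lra.
Qed.

End GoodFractions.

(** * Infinitely many good approximations for almost every alpha *)

Section LimsupApproximation.
Context {R : realType}.
Local Notation mu := (@lebesgue_measure R).
Local Open Scope classical_set_scope.

(** Sets are added one at a time: the new one meets the union of the others in measure at most C u_i
    S, S being the sum of their weights. *)
Lemma bonferroni (I : eqType) (s : seq I) (E : I -> set R) (u : I -> R) (e0 C : R) :
  uniq s -> 0 <= C -> (forall i, i \in s -> 0 <= u i) ->
  (forall i, i \in s -> measurable (E i)) ->
  (forall i, i \in s -> ((e0 * u i)%:E <= mu (E i))%E) ->
  (forall i j, i \in s -> j \in s -> i != j -> (mu (E i `&` E j) <= (C * (u i * u j))%:E)%E) ->
  ((e0 * (\sum_(i <- s) u i) - C * (\sum_(i <- s) u i) ^+ 2)%:E <=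
     mu (\big[setU/set0]_(i <- s) E i))%E.
Proof.
elim: s => [|i s IH] /= us C0 u0 mE Eu Ep.
  by rewrite !big_nil expr0n /= !mulr0 subrr measure0.
case/andP: us => si us.
have ss j : j \in s -> j \in i :: s by move=> js; rewrite in_cons js orbT.
have {}IH := IH us C0 (fun j js => u0 j (ss j js)) (fun j js => mE j (ss j js))
  (fun j js => Eu j (ss j js)) (fun j k js ks => Ep j k (ss j js) (ss k ks)).
have ii := mem_head i s.
rewrite !big_cons; set U := \big[setU/set0]_(j <- s) E j in IH *.
set S := \sum_(j <- s) u j in IH *.
have S0 : 0 <= S by rewrite /S big_seq; apply: sumr_ge0 => j js; apply: u0; exact: ss.
have [mU _] : measurable U /\ True.
  by split => //; rewrite /U big_seq; apply: bigsetU_measurable => j js; apply: mE; exact: ss.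
have mi := mE i ii; have ui := u0 i ii.
have EU : (mu (E i `&` U) <= (C * (u i * S))%:E)%E.
  have mEE j : j \in s -> measurable (E i `&` E j).
    by move=> js; apply: measurableI => //; apply: mE; exact: ss.
  have EE j : j \in s -> (mu (E i `&` E j) <= (C * (u i * u j))%:E)%E.
    by move=> js; apply: Ep => //; [exact: ss|apply: contraNneq si => ->].
  have [mU' Um'] := @measure_bigsetU_le R _ s (fun j => E i `&` E j) _ mEE EE.
  have mA : measurable (E i `&` U) by exact: measurableI.
  apply: (measure_le_bound _ _ _ mA mU').
    by move=> x [Ex /mem_bigsetU[j js Ej]]; apply/mem_bigsetU; exists j.
  by apply: le_trans Um' _; rewrite lee_fin -!mulr_sumr.
have -> : E i `|` U = U `|` (E i `\` U).
  by rewrite setDE setUIr setUv setIT setUC.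
rewrite measureU//; last 2 first.
  exact: measurableD.
  by rewrite setDE setICA setICr setI0.
have D : ((e0 * u i - C * (u i * S))%:E <= mu (E i `\` U))%E.
  rewrite EFinB leeBlDl//.
  apply: le_trans (Eu i ii) _; rewrite (measureDI mu mi mU) addeC.
  by apply: leeD.
apply: le_trans (leeD IH D); rewrite -EFinD lee_fin.
have : 0 <= C * (u i * S) by rewrite !mulr_ge0.
have : 0 <= C * u i ^+ 2 by rewrite mulr_ge0 ?sqr_ge0.
nra.
Qed.

Lemma partial_sum_in (u : nat -> R) (P : pred nat) (k : nat) (d : R) :
  (forall i, P i -> 0 <= u i <= d) -> 0 < d ->
  (forall B, exists n, B <= \sum_(0 <= i < n | P i) u i) ->
  exists n, d <= \sum_(k <= i < n | P i) u i <= 2 * d.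
Proof.
move=> ud d0 div.
have ex : exists n, d <= \sum_(k <= i < n | P i) u i.
  have [n nB] := div (d + \sum_(0 <= i < k | P i) u i).
  exists n; have [kn|nk] := leqP k n.
    by move: nB; rewrite (@big_cat_nat _ _ _ k 0 n)//=; lra.
  have : \sum_(0 <= i < n | P i) u i <= \sum_(0 <= i < k | P i) u i.
    rewrite [X in _ <= X](@big_cat_nat _ _ _ n 0 k)//=; last exact: ltnW.
    by rewrite lerDl; apply: sumr_ge0 => i /ud /andP[].
  lra.
have /ex_minnP [n nd nmin] := ex.
exists n; rewrite nd /=.
have [kn|nk] := ltnP k n; last by move: nd; rewrite big_geq//; lra.
case: n nd nmin kn => // n nd nmin; rewrite ltnS => kn.
have lt : \sum_(k <= i < n | P i) u i < d.
  by rewrite ltNge; apply/negP => /nmin; rewrite ltnn.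
rewrite big_mkcond/= big_nat_recr//= -big_mkcond/=.
by case: ifP => [/ud /andP[_]|_]; lra.
Qed.

(** Only points to the right of x at distance between rho/2 and rho, rho = 1/(64^(2k) T k). The
    inner gap bounds beta from below and hence log H from above. *)
Definition approx_set (A0 : R) (T : nat -> R) (k : nat) (x : rat) : set R :=
  if (64 ^ k <= dn x < 64 ^ k.+1)%N && (Vsum x <= A0 * k%:R ^+ 2) then
    `[(ratr x + (64 ^+ (2 * k) * T k)^-1 / 2)%R, (ratr x + (64 ^+ (2 * k) * T k)^-1)%R]
  else set0.

Lemma measurable_approx_set A0 T k x : measurable (approx_set A0 T k x).
Proof. by rewrite /approx_set; case: ifP. Qed.

(** In any ]a, b[ take a finite run of large scales whose sum of 1/T lies in [d, 2d], d = 1/(8K). By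
    [bonferroni] the union has measure at least (b - a)/(32K). The complement of [G m], the union
    over all scales from m on, thus fills at most a fixed proportion below 1 of every interval and
    is null. *)
Lemma approx_infinitely_often : exists2 A0 : R, 0 < A0 & forall (T : nat -> R) (S : pred nat),
  (forall k, S k -> 2 ^+ 32 <= T k) ->
  (forall k l, S k -> S l -> (k <= l)%N -> T k <= T l) ->
  (forall B, exists n, B <= \sum_(0 <= k < n | S k) (T k)^-1) ->
  {ae mu, forall alpha : R, forall m, exists2 k, (m <= k)%N && S k &
     exists x, approx_set A0 T k x alpha}.
Proof.
have [A0 A00 GC] := @good_count R; exists A0 => // T S T0 Tmono div.
(* K (b - a) is the quasi-independence constant: there are at most 2 * 64^2 (b - a) 64^(2k)
   fractions at scale k, and each meets scale l in measure at most 16 * 64^2 rho_k 64^(2l) rho_l.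
   Since 2^32 = 8K, each 1/T is at most d = 1/(8K). *)
have [K eK] : exists K : R, K = 32 * 64 ^+ 4 by eexists.
have eT0 : 2 ^+ 32 = 8 * K by rewrite eK; ring.
have K1 : 2048 <= K.
  have : 1 <= 64 ^+ 3 :> R by apply: exprn_ege1; lra.
  by rewrite eK (exprS _ 3); move: (64 ^+ 3) => y; lra.
have {}T0 k : S k -> 8 * K <= T k by rewrite -eT0; exact: T0.
have Tpos k : S k -> 0 < T k by move=> /T0; lra.
pose G m : set R := \bigcup_k (if (m <= k)%N && S k then \bigcup_x approx_set A0 T k x else set0).
have mG m : measurable (G m).
  apply: bigcupT_measurable => k; case: ifP => // _.
  by apply: bigcupT_measurable_rat => x; exact: measurable_approx_set.
suff G0 m : mu (~` G m) = 0%E.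
  apply: ae_foralln => m; exists (~` G m); split; [exact: (measurableC (mG m))|exact: G0|].
  move=> al /= nal Gal; apply: nal; case: Gal => k _; case: ifP => // mk [x _ xal].
  by exists k => //; exists x.
apply: (@null_of_density R _ (1 - (32 * K)^-1)).
- exact: (measurableC (mG m)).
- by rewrite ltrBlDr ltrDl invr_gt0; lra.
move=> a b ab; have [k0 k0P] := GC a b ab.
have [L eL] : exists L : R, L = b - a by eexists.
have L0 : 0 < L by rewrite eL subr_gt0.
have /choice [sk skP] : forall k, exists s : seq rat, (k0 <= k)%N -> [/\ uniq s,
    forall x, x \in s -> [/\ (64 ^ k <= dn x < 64 ^ k.+1)%N, a <= ratr x,
       ratr x + (64 ^+ (2 * k))^-1 <= b & Vsum x <= A0 * k%:R ^+ 2] &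
    (b - a) * 64 ^+ (2 * k) <= (size s)%:R].
  move=> k; have [kk|kk] := leqP k0 k; last by exists [::].
  by have [s sP] := k0P k kk; exists s.
pose k2 := maxn m (maxn k0 (Num.trunc L^-1).+1).
have k2P k : (k2 <= k)%N -> [/\ (m <= k)%N, (k0 <= k)%N & L^-1 <= k%:R].
  rewrite /k2 !geq_max => /and3P[h1 h2 h3]; split => //.
  by apply: le_trans (ltW (truncnS_gt L^-1)) _; rewrite ler_nat.
pose rho k : R := (64 ^+ (2 * k) * T k)^-1.
have p64 (j : nat) : 0 < 64 ^+ j :> R by apply: exprn_gt0; lra.
have rho0 k : S k -> 0 < rho k by move=> Sk; rewrite invr_gt0 mulr_gt0// Tpos.
have apx k x : (k2 <= k)%N -> x \in sk k -> approx_set A0 T k x =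
    `[(ratr x + rho k / 2)%R, (ratr x + rho k)%R].
  move=> /k2P[_ kk _] xs; have [_ /(_ x xs)[h1 _ _ h2] _] := skP k kk.
  by rewrite /approx_set h1 h2.
pose E k : set R := \big[setU/set0]_(x <- sk k) approx_set A0 T k x.
have mE k : measurable (E k).
  by apply: bigsetU_measurable => x _; exact: measurable_approx_set.
have EG k : (k2 <= k)%N -> S k -> E k `<=` G m.
  move=> /k2P[mk _ _] Sk al /mem_bigsetU[x xs xal]; exists k => //; rewrite mk Sk.
  by exists x.
have rho_le k : S k -> rho k <= (64 ^+ (2 * k))^-1 / 4096.
  move=> Sk; rewrite /rho invfM ler_pM2l ?invr_gt0//.
  rewrite lef_pV2 ?posrE; [have := T0 k Sk; clear -K1; lra|exact: Tpos|clear; lra].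
have EJ k : (k2 <= k)%N -> S k -> E k `<=` `]a, b[.
  move=> kk Sk al /mem_bigsetU[x xs]; rewrite apx//= !in_itv/= => /andP[h1 h2].
  have [_ kk0 _] := k2P k kk; have [_ /(_ x xs)[_ h3 h4 _] _] := skP k kk0.
  have h5 := rho0 k Sk; have h6 := rho_le k Sk.
  have h7 : 0 < (64 ^+ (2 * k))^-1 :> R by rewrite invr_gt0.
  move: h4 h6 h7; move: ((64 ^+ (2 * k))^-1) => y h4 h6 h7.
  by apply/andP; clear -h1 h2 h3 h4 h5 h6 h7; split; lra.
have low k : (k2 <= k)%N -> S k -> ((L / 2 * (T k)^-1)%:E <= mu (E k))%E.
  move=> kk Sk; have [_ kk0 _] := k2P k kk; have [us sP sz] := skP k kk0.
  have r0 := rho0 k Sk; have rl := rho_le k Sk.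
  have B1 x : x \in sk k -> 0 <= rho k / 2 by move=> _; rewrite divr_ge0// ltW.
  have B2 x : x \in sk k -> measurable (approx_set A0 T k x).
    by move=> _; exact: measurable_approx_set.
  have B3 x : x \in sk k -> ((1 * (rho k / 2))%:E <= mu (approx_set A0 T k x))%E.
    move=> xs; rewrite apx// measure_itvcc; last by clear -r0; lra.
    by rewrite lee_fin; clear -r0; lra.
  (* Disjointness within one scale: a common point gives |x - y| <= rho/2, less than the separation
     64^(-2k-2), because rho <= 64^(-2k)/4096. *)
  have B4 x y : x \in sk k -> y \in sk k -> x != y ->
      (mu (approx_set A0 T k x `&` approx_set A0 T k y) <= (0 * ((rho k / 2) * (rho k / 2)))%:E)%E.
    move=> xs ys xy; rewrite mul0r.
    suff -> : approx_set A0 T k x `&` approx_set A0 T k y = set0 by rewrite measure0.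
    rewrite !apx//; apply/seteqP; split => // al []/=; rewrite !in_itv/= => /andP[h1 h2] /andP[h3 h4].
    have [/andP[_ dx] _ _ _] := sP x xs; have [/andP[_ dy] _ _ _] := sP y ys.
    have := @rat_separation R x y xy.
    have : `|ratr x - ratr y : R| <= rho k / 2.
      by rewrite ler_norml; clear -h1 h2 h3 h4; apply/andP; split; lra.
    move: (`|ratr x - ratr y : R|) => w hw.
    have dx' : (dn x)%:R <= 64 ^+ k.+1 :> R by rewrite -natrX ler_nat ltnW.
    have dy' : (dn y)%:R <= 64 ^+ k.+1 :> R by rewrite -natrX ler_nat ltnW.
    apply/negP; rewrite -ltNge -mulrA.
    have dd : (dn x)%:R * (dn y)%:R <= 4096 * 64 ^+ (2 * k) :> R.
      apply: (@le_trans _ _ (64 ^+ k.+1 * 64 ^+ k.+1)); first by apply: ler_pM.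
      by rewrite mul2n -addnn exprD !exprS; move: (64 ^+ k) => z; clear; lra.
    apply: (@le_lt_trans _ _ (rho k / 2 * (4096 * 64 ^+ (2 * k)))).
      apply: (@le_trans _ _ (rho k / 2 * ((dn x)%:R * (dn y)%:R))).
        by apply: ler_wpM2r.
      by apply: ler_wpM2l => //; rewrite divr_ge0// ltW.
    have : (64 ^+ (2 * k))^-1 * 64 ^+ (2 * k) = 1 :> R by rewrite mulVf// gt_eqF.
    move: rl (p64 (2 * k)%N); move: (64 ^+ (2 * k)) => z; move: (z^-1) => zi rl z0 e1.
    have := ler_wpM2r (ltW z0) rl; clear -e1; nra.
  have := @bonferroni _ (sk k) (approx_set A0 T k) (fun=> rho k / 2) 1 0 us (lexx 0) B1 B2 B3 B4.
  apply: le_trans; rewrite lee_fin mul0r subr0 mul1r big_const_seq count_predT iter_addr_0.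
  rewrite -[X in _ <= X]mulr_natr; rewrite -eL in sz.
  apply: (@le_trans _ _ (rho k / 2 * (L * 64 ^+ (2 * k)))); last first.
    by apply: ler_wpM2l sz; rewrite divr_ge0// ltW.
  rewrite /rho invfM le_eqVlt; apply/orP; left; apply/eqP.
  by field; rewrite !gt_eqF//= Tpos.
have size_le k : (k2 <= k)%N -> (size (sk k))%:R <= 2 * 64 ^+ 2 * L * 64 ^+ (2 * k).
  move=> kk; have [_ kk0 kL] := k2P k kk; have [us sP sz] := skP k kk0.
  have D0 : (0 < 64 ^ k.+1)%N by rewrite expn_gt0.
  have := @rat_count R (sk k) a b (64 ^ k.+1) us (ltW ab) D0.
  move=> /(_ _) h; apply: le_trans (h _) _.
    move=> x xs; have [/andP[_ h1] h2 h3 _] := sP x xs; split => //.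
    rewrite h2 /=; apply: le_trans h3; rewrite lerDl invr_ge0 ltW//.
  rewrite -eL natrX -exprM mulnC mulnS exprD.
  have h1 : 1 <= L * 64 ^+ (2 * k).
    apply: (@le_trans _ _ (L * k%:R)).
      by rewrite -ler_pdivrMl// mulr1.
    rewrite ler_pM2l// -natrX ler_nat; apply: leq_trans (ltnW (ltn_expl k (_ : 1 < 64)%N)) _ => //.
    by rewrite leq_exp2l// leq_pmull.
  have h2 : 1 <= 64 ^+ 2 :> R by apply: exprn_ege1; rewrite ler1n.
  move: h1 h2; move: (64 ^+ (2 * k)) (64 ^+ 2) => z w; clear -L0; nra.
have C0 : 0 <= K * L by rewrite mulr_ge0 ?ltW//; clear -K1; lra.
have pairlt k l : (k2 <= k)%N -> (k < l)%N -> S k -> S l ->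
    (mu (E k `&` E l) <= (K * L * ((T k)^-1 * (T l)^-1))%:E)%E.
  move=> kk kl Sk Sl; have ll : (k2 <= l)%N by apply: leq_trans (ltnW kl).
  have [_ kk0 _] := k2P k kk; have [us sP sz] := skP k kk0.
  have [_ ll0 _] := k2P l ll; have [us' sP' sz'] := skP l ll0.
  have rl0 := rho0 l Sl; have rk0 := rho0 k Sk.
  have rkl : rho l <= rho k.
    rewrite lef_pV2 ?posrE ?mulr_gt0 ?Tpos//; apply: ler_pM.
    - exact: ltW.
    - by rewrite ltW// Tpos.
    - by rewrite ler_eXn2l ?leq_mul2l 1?ltnW// ltr1n.
    - by apply: Tmono => //; exact: ltnW.
  pose W x (r : R) : set R := `[(ratr x - r)%R, (ratr x + r)%R].
  pose UW : set R := \big[setU/set0]_(y <- sk l) W y (rho l).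
  have mUW : measurable UW by apply: bigsetU_measurable => x _; exact: measurable_itv.
  have D1 : (64 ^ k.+1)%:R <= (64 ^ l.+1)%:R :> R by rewrite ler_nat leq_exp2l// ltnS ltnW.
  have D0 : 0 < (64 ^ k.+1)%:R :> R by rewrite ltr0n expn_gt0.
  have PW x : x \in sk k -> (mu (W x (rho k) `&` UW) <= (16 * rho k * (64 ^ l.+1)%:R ^+ 2 * rho l)%:E)%E.
    move=> xs; have [/andP[_ dx] _ _ _] := sP x xs.
    apply: (pair_measure _ _ _ _ _ _ us' dx _ rl0 rkl).
      move=> y ys; have [/andP[dy0 dy] _ _ _] := sP' y ys; split => //.
      apply/eqP => yx; move: dy0; rewrite yx leqNgt (leq_trans dx)// leq_exp2l//.
    move: D0 D1; move: ((64 ^ k.+1)%:R) ((64 ^ l.+1)%:R) => d d' D0 D1; clear -D0 D1 rk0.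
    have : 0 <= rho k * d' * (d' - d) by rewrite !mulr_ge0//; lra.
    by have : 0 <= rho k * d' ^+ 2 by [rewrite mulr_ge0 ?sqr_ge0// ltW]; nra.
  have [mV Vm] := @measure_bigsetU_le R _ (sk k) (fun x => W x (rho k) `&` UW)
     (fun=> 16 * rho k * (64 ^ l.+1)%:R ^+ 2 * rho l) (fun x _ => measurableI _ _ (measurable_itv _) mUW) PW.
  apply: (measure_le_bound _ _ _ (measurableI _ _ (mE k) (mE l)) mV).
    move=> al [/mem_bigsetU[x xs xal] /mem_bigsetU[y ys yal]].
    apply/mem_bigsetU; exists x => //; split.
      move: xal; rewrite apx// /W/= !in_itv/= => /andP[h1 h2].
      by clear -h1 h2 rk0; apply/andP; split; lra.
    apply/mem_bigsetU; exists y => //.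
    move: yal; rewrite apx// /W/= !in_itv/= => /andP[h1 h2].
    by clear -h1 h2 rl0; apply/andP; split; lra.
  apply: le_trans Vm _; rewrite lee_fin big_const_seq count_predT iter_addr_0.
  rewrite -[X in X <= _]mulr_natr.
  apply: le_trans (ler_wpM2l _ (size_le k kk)) _.
    by apply: mulr_ge0 (ltW rl0); apply: mulr_ge0 (sqr_ge0 _); apply: mulr_ge0 (ltW rk0); clear; lra.
  have -> : (64 ^ l.+1)%:R ^+ 2 = 64 ^+ 2 * 64 ^+ (2 * l) :> R.
    by rewrite natrX [64 ^+ l.+1]exprS exprMn -exprM [(l * 2)%N]mulnC.
  rewrite /rho eK.
  have nk : T k != 0 by rewrite gt_eqF// Tpos.
  have nl : T l != 0 by rewrite gt_eqF// Tpos.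
  have := gt_eqF (p64 (2 * k)%N); have := gt_eqF (p64 (2 * l)%N).
  move: (64 ^+ (2 * k)) (64 ^+ (2 * l)) => z w w0 z0.
  rewrite le_eqVlt; apply/orP; left; apply/eqP.
  by field; rewrite nk nl w0 z0.
have uP k : S k -> 0 <= (T k)^-1 <= (8 * K)^-1.
  move=> Sk; rewrite invr_ge0 ltW ?Tpos//= lef_pV2 ?posrE; [exact: T0|exact: Tpos|clear -K1; lra].
have d0 : 0 < (8 * K)^-1 by rewrite invr_gt0; clear -K1; lra.
have [n nP] := @partial_sum_in (fun k => (T k)^-1) S k2 (8 * K)^-1 uP d0 div.
pose s := [seq k <- index_iota k2 n | S k].
have sP k : k \in s -> (k2 <= k)%N /\ S k.
  by rewrite mem_filter mem_index_iota => /andP[-> /andP[-> _]].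
pose U : set R := \big[setU/set0]_(k <- s) E k.
have mU : measurable U by apply: bigsetU_measurable => x _; exact: mE.
have UG : U `<=` G m `&` `]a, b[.
  move=> al /mem_bigsetU[k /sP[kk Sk] kal]; split; [exact: EG kal|exact: EJ kal].
have Um : ((L / (32 * K))%:E <= mu U)%E.
  have B0 : uniq s by rewrite filter_uniq// iota_uniq.
  have B1 k : k \in s -> 0 <= (T k)^-1 by move=> /sP[_ /uP /andP[]].
  have B2 k : k \in s -> ((L / 2 * (T k)^-1)%:E <= mu (E k))%E by move=> /sP[kk Sk]; exact: low.
  have B3 k l : k \in s -> l \in s -> k != l ->
      (mu (E k `&` E l) <= (K * L * ((T k)^-1 * (T l)^-1))%:E)%E.
    move=> /sP[kk Sk] /sP[ll Sl]; rewrite neq_ltn => /orP[kl|lk]; first exact: pairlt.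
    by rewrite setIC [(T k)^-1 * _]mulrC; exact: pairlt.
  have := @bonferroni _ s E (fun k => (T k)^-1) (L / 2) (K * L) B0 C0 B1 (fun k _ => mE k) B2 B3.
  apply: le_trans; rewrite lee_fin big_filter.
  move: nP; move: (\sum_(k2 <= i < n | S i) (T i)^-1) => z /andP[z1 z2].
  have Kp : 0 < K by clear -K1; lra.
  have e1 : K * (8 * K)^-1 = 8^-1 by field; rewrite gt_eqF.
  have -> : L / (32 * K) = L * (4^-1 * (8 * K)^-1) by field; rewrite gt_eqF.
  have -> : L / 2 * z - K * L * z ^+ 2 = L * (2^-1 * z - K * z * z) by ring.
  rewrite ler_pM2l//.
  move: z1 z2 e1 d0; move: ((8 * K)^-1) => d z1 z2 e1 d0.
  have h1 : K * z <= 4^-1.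
    have := ler_wpM2l (ltW Kp) z2; rewrite mulrCA e1; clear; lra.
  have z0 : 0 <= z by clear -z1 d0; lra.
  have := ler_wpM2r z0 h1; clear -z1; lra.
have -> : ~` G m `&` `]a, b[ = `]a, b[ `\` G m by rewrite setDE setIC.
have mab : measurable (`]a, b[ : set R) by exact: measurable_itv.
have h1 : (mu (`]a, b[ `\` G m) + mu (`]a, b[ `&` G m) = L%:E)%E.
  have <- : mu (`]a, b[ : set R) = L%:E by rewrite lebesgue_measure_itv/= lte_fin ab -EFinB eL.
  by apply/esym; exact: (measureDI mu mab (mG m)).
have h2 : ((L / (32 * K))%:E <= mu (`]a, b[ `&` G m))%E.
  apply: le_trans Um _; have mI := measurableI _ _ mab (mG m).
  by apply: le_measure; rewrite ?inE// setIC.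
have h3 : (mu (`]a, b[ `\` G m) + (L / (32 * K))%:E <= L%:E)%E by rewrite -h1; apply: leeD.
rewrite -eL mulrBl mul1r EFinB leeBrDr//.
by rewrite [_^-1 * _]mulrC.
Qed.

End LimsupApproximation.

(** * Density at least 1/2 *)

Section Series.
Context {R : realType}.

Lemma nneseries_unbounded (u : nat -> R) : (forall k, (1 <= k)%N -> 0 <= u k) ->
  (\sum_(1 <= k <oo) (u k)%:E = +oo)%E ->
  forall B, exists n, B <= \sum_(1 <= k < n) u k.
Proof.
move=> u0 uoo B; apply: contrapT => nB.
have le n : \sum_(1 <= k < n) u k <= B.
  by rewrite leNgt; apply/negP => h; apply: nB; exists n; exact: ltW.
have : (\sum_(1 <= k <oo) (u k)%:E <= B%:E)%E.
  apply: lime_le; first by apply: is_cvg_nneseries => k k1 _; rewrite lee_fin u0.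
  by apply: nearW => n; rewrite sumEFin lee_fin.
by rewrite uoo leye_eq.
Qed.

Lemma bounded_sum_tail (w : nat -> R) (B d : R) : (forall k, 0 <= w k) -> 0 < d ->
  (forall n, \sum_(1 <= k < n) w k <= B) ->
  exists2 m, (1 <= m)%N & forall n, \sum_(m <= k < n) w k < d.
Proof.
move=> w0 d0 wB; apply: contrapT => h.
have step m : (1 <= m)%N -> exists n, d <= \sum_(m <= k < n) w k.
  move=> m1; apply: contrapT => h'; apply: h; exists m => // n.
  by rewrite ltNge; apply/negP => h2; apply: h'; exists n.
have big j : exists2 n, (1 <= n)%N & j%:R * d <= \sum_(1 <= k < n) w k.
  elim: j => [|j [n n1 nj]]; first by exists 1%N => //; rewrite mul0r big_geq.
  have [n' n'd] := step n n1.
  have nn' : (n <= n')%N.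
    by rewrite leqNgt; apply/negP => nn'; move: n'd; rewrite big_geq ?leNgt ?d0// ltnW.
  exists n'; first exact: leq_trans nn'.
  by rewrite (@big_cat_nat _ _ _ n)//= -natr1; lra.
have [n _ nj] := big (Num.trunc (B / d)).+1.
have := le_trans nj (wB n); rewrite -ler_pdivlMr// leNgt truncnS_gt//.
Qed.

(** By monotonicity a block of L consecutive terms starting at k = L n is at most L / f(L n); the
    terms with k < L are bounded by those at 1. *)
Lemma sum_dilate_unbounded (f : R -> R) (L : nat) : (0 < L)%N ->
  (forall x, 0 < x -> 0 < f x) -> (forall x y, 0 < x -> x <= y -> f x <= f y) ->
  (forall B, exists n, B <= \sum_(1 <= k < n) (f k%:R)^-1) ->
  forall B, exists n, B <= \sum_(1 <= k < n) (f (L%:R * k%:R))^-1.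
Proof.
move=> L0 f0 fm fB B.
have LR : 0 < L%:R :> R by rewrite ltr0n.
have f1 k : (0 < k)%N -> 0 <= (f k%:R)^-1.
  by move=> k0; rewrite invr_ge0 ltW// f0// ltr0n.
have blk n : \sum_(1 <= k < L * n.+1) (f k%:R)^-1 <=
    L%:R * (f 1)^-1 + L%:R * \sum_(1 <= k < n.+1) (f (L%:R * k%:R))^-1.
  elim: n => [|n IH].
    rewrite muln1 [X in _ <= _ + _ * X]big_geq// mulr0 addr0.
    apply: (@le_trans _ _ (\sum_(1 <= k < L) (f 1)^-1)).
      apply: ler_sum_nat => k /andP[k1 _].
      by rewrite lef_pV2 ?posrE ?f0 ?ltr0n// fm// ler1n.
    rewrite sumr_const_nat -[X in X <= _]mulr_natl; apply: ler_wpM2r.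
      by rewrite (f1 1%N).
    by rewrite ler_nat leq_subr.
  have Ln : (1 <= L * n.+1)%N by rewrite muln_gt0 L0.
  rewrite (@big_cat_nat _ _ _ (L * n.+1))//=; last by rewrite leq_mul2l leqnSn orbT.
  rewrite [X in _ <= _ + _ * X]big_nat_recr//= mulrDr addrA.
  apply: lerD => //.
  apply: (@le_trans _ _ (\sum_(L * n.+1 <= k < L * n.+2) (f (L%:R * n.+1%:R))^-1)).
    apply: ler_sum_nat => k /andP[k1 _].
    have k0 : (0 < k)%N by apply: leq_trans k1.
    rewrite lef_pV2 ?posrE ?f0 ?ltr0n ?mulr_gt0 ?ltr0n// fm ?mulr_gt0 ?ltr0n//.
    by rewrite -natrM ler_nat.
  by rewrite sumr_const_nat -mulnBr subSn// subnn muln1 -[X in X <= _]mulr_natl.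
have [n nB] := fB (L%:R * (f 1)^-1 + L%:R * B).
exists n.+1; rewrite -(ler_pM2l LR) -(lerD2l (L%:R * (f 1)^-1)).
apply: le_trans (blk n); apply: le_trans nB _.
have nL : (n <= L * n.+1)%N by apply: leq_trans (leqnSn n) _; rewrite leq_pmull.
have [->|n0] := posnP n; first by rewrite big_geq// big_nat_cond sumr_ge0// => k /andP[/andP[k1 _] _]; exact: f1.
rewrite [X in _ <= X](@big_cat_nat _ _ _ n)//= lerDl big_nat_cond sumr_ge0// => k /andP[/andP[k1 _] _].
by apply: f1; apply: leq_trans k1.
Qed.

(* Condensation: if the sum of min(1/k, t k) converges then its tails are small,
   which forces t k <= 2/k and hence t k <= 2 min(1/k, t k) for large k. *)
Lemma sum_min_unbounded (t : nat -> R) : (forall k, 0 <= t k) ->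
  (forall k l, (1 <= k)%N -> (k <= l)%N -> t l <= t k) ->
  (forall B, exists n, B <= \sum_(1 <= k < n) t k) ->
  forall B, exists n, B <= \sum_(1 <= k < n) Num.min k%:R^-1 (t k).
Proof.
move=> t0 tm tB B; apply: contrapT => nB.
pose w k := Num.min k%:R^-1 (t k).
have w0 k : 0 <= w k by rewrite le_min t0 invr_ge0 ler0n.
have wB n : \sum_(1 <= k < n) w k <= B.
  by rewrite leNgt; apply/negP => h; apply: nB; exists n; exact: ltW.
have wm k l : (1 <= k)%N -> (k <= l)%N -> w l <= w k.
  move=> k1 kl; rewrite /w le_min !ge_min tm ?orbT// andbT.
  by rewrite lef_pV2 ?posrE ?ltr0n ?(leq_trans k1)// ler_nat kl.
have h0 : 0 < 2^-1 :> R by rewrite invr_gt0.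
have [m m1 mP] := bounded_sum_tail w B 2^-1 w0 h0 wB.
have tw k : (m.*2 <= k)%N -> t k <= 2 * w k.
  move=> mk.
  pose j := k./2.
  have jm : (m <= j)%N by rewrite /j -(doubleK m) half_leq.
  have j1 : (1 <= j)%N by apply: leq_trans jm.
  have kj : (j.*2 <= k)%N by rewrite /j -{2}(odd_double_half k) leq_addl.
  have jk : (k <= j.*2.+1)%N by rewrite /j -{1}(odd_double_half k) -add1n leq_add2r leq_b1.
  have h1 : j%:R * w j.*2 < 2^-1.
    apply: le_lt_trans (mP j.*2.+1); apply: (@le_trans _ _ (\sum_(j.+1 <= i < j.*2.+1) w i)).
      apply: (@le_trans _ _ (\sum_(j.+1 <= i < j.*2.+1) w j.*2)).
        by rewrite sumr_const_nat subSS -addnn addnK -[X in _ <= X]mulr_natl.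
      apply: ler_sum_nat => i /andP[i1 i2]; apply: wm; first exact: leq_trans i1.
      by rewrite -ltnS.
    rewrite [X in _ <= X](@big_cat_nat _ _ _ j.+1)//=; last 2 first.
      by rewrite ltnW.
      by rewrite ltnS -addnn leq_addl.
    by rewrite lerDr sumr_ge0.
  have j0 : 0 < j%:R :> R by rewrite ltr0n.
  have h2 : w j.*2 = t j.*2.
    rewrite /w /Num.min; case: ifP => // h; move: h1; rewrite /w /Num.min h.
    rewrite -muln2 natrM invfM mulrA divff ?gt_eqF// mul1r ltxx//.
  have h3 : t k <= j.*2%:R^-1.
    apply: le_trans (tm _ _ _ kj) _; first by rewrite double_gt0.
    by rewrite -h2 ge_min lexx.
  rewrite /w /Num.min; case: ifP => _; last by have := t0 k; lra.
  apply: le_trans h3 _; rewrite -[X in _ <= X]invrK invfM invrK.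
  have k0 : (0 < k)%N by apply: leq_trans kj; rewrite double_gt0.
  rewrite lef_pV2 ?posrE ?mulr_gt0 ?invr_gt0 ?ltr0n ?double_gt0//.
  rewrite ler_pdivrMl// -natrM ler_nat; lia.
have [n nP] := tB (\sum_(1 <= k < m.*2) t k + 2 * B + 1).
have m2 : (1 <= m.*2)%N by rewrite double_gt0.
have [mn|nm] := leqP m.*2 n; last first.
  have : \sum_(1 <= k < n) t k <= \sum_(1 <= k < m.*2) t k.
    have [->|n0] := posnP n; first by rewrite big_geq// sumr_ge0.
    by rewrite [X in _ <= X](@big_cat_nat _ _ _ n)//= 1?ltnW// lerDl sumr_ge0.
  have : 0 <= B by apply: le_trans (wB 0%N); rewrite big_geq.
  by move: nP; lra.
move: nP; rewrite [X in _ <= X](@big_cat_nat _ _ _ m.*2 1 n)//=.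
have h1 : \sum_(m.*2 <= k < n) t k <= 2 * \sum_(m.*2 <= k < n) w k.
  by rewrite mulr_sumr; apply: ler_sum_nat => k /andP[mk _]; exact: tw.
have h2 : \sum_(m.*2 <= k < n) w k <= B.
  apply: le_trans (wB n); rewrite [X in _ <= X](@big_cat_nat _ _ _ m.*2)//=.
  by rewrite lerDr sumr_ge0.
by lra.
Qed.

(** The indices left out contribute at most the sum of 1/k^2, hence at most 2. *)
Lemma sum_sparse_unbounded (w : nat -> R) (P : pred nat) : (forall k, 0 <= w k) ->
  (forall k, (1 <= k)%N -> ~~ P k -> w k <= (k%:R ^+ 2)^-1) ->
  (forall B, exists n, B <= \sum_(1 <= k < n) w k) ->
  forall B, exists n, B <= \sum_(1 <= k < n | P k) w k.
Proof.
move=> w0 wP wB B; have [n nP] := wB (B + 2); exists n.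
move: nP; rewrite (bigID P)/=.
have : \sum_(1 <= i < n | ~~ P i) w i <= 2.
  apply: le_trans (_ : \sum_(1 <= i < n.+1) (i%:R ^+ 2)^-1 <= _); last exact: sum_inv2_le.
  apply: (@le_trans _ _ (\sum_(1 <= i < n) (i%:R ^+ 2)^-1)); last first.
    have [->|n0] := posnP n; first by rewrite !big_geq.
    by rewrite [X in _ <= X]big_nat_recr//= lerDl invr_ge0 sqr_ge0.
  rewrite big_mkcond/=; apply: ler_sum_nat => i /andP[i1 _].
  by case: ifP => [|_]; [exact: wP|rewrite invr_ge0 sqr_ge0].
by lra.
Qed.

End Series.

(** * Upper density and counting by Chebyshev's inequality *)

Section Density.
Context {R : realType}.
Local Open Scope classical_set_scope.

Lemma limn_esup_ge (u : nat -> \bar R) (c : \bar R) :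
  (forall m, exists2 n, (m <= n)%N & (c <= u n)%E) -> (c <= limn_esup u)%E.
Proof.
move=> h; apply: le_ereal_inf_tmp => _ [V [m _ mV] <-].
have [n mn cn] := h m; apply: le_trans cn _.
by apply: ereal_sup_ubound; exists n => //; exact: mV.
Qed.

Lemma limn_esup_le (u : nat -> \bar R) (c : \bar R) (m : nat) :
  (forall n, (m <= n)%N -> (u n <= c)%E) -> (limn_esup u <= c)%E.
Proof.
move=> h; apply: (@le_trans _ _ (ereal_sup (u @` [set n | (m <= n)%N]))).
  by apply: ereal_inf_lbound; exists [set n | (m <= n)%N] => //; exists m.
by apply: ge_ereal_sup => _ [n mn <-]; exact: h.
Qed.

Lemma count_uptoE (A : set nat) (M : nat) :
  (count_upto A M)%:R = \sum_(1 <= n < M.+1) (if `[< A n >] then 1 else 0) :> R.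
Proof. by rewrite /count_upto natr_sum; apply: eq_bigr => n _; case: ifP. Qed.

(** Where the phase condition holds, the indicator of A is at least 1 - X_N^2 / B^2. The range of
    such N has about (1/2 - 3 eps) H elements, the squares cost another eps H, and 6 absorbs the
    rounding. *)
Lemma count_lower (A : set nat) (beta eps B : R) (H : nat) (X : nat -> R) :
  0 < eps -> eps <= 2^-1 -> 0 < beta -> H%:R * beta <= 1 - eps -> 1 - eps <= H.+1%:R * beta ->
  0 < B -> \sum_(0 <= N < H) X N ^+ 2 <= eps * B ^+ 2 * H%:R ->
  (forall N, (2 <= N < H)%N -> 2^-1 + eps <= (N%:R + 2^-1) * beta <= 1 - eps ->
     `|X N| <= B -> A N) ->
  (2^-1 - 4 * eps) * H%:R - 6 <= (count_upto A H)%:R.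
Proof.
move=> e0 e2 b0 Hb Hb' B0 XB AN.
pose N1 := Num.trunc ((2^-1 + eps) / beta).
have N1le : N1%:R <= (2^-1 + eps) / beta.
  by rewrite truncn_le divr_ge0 ?ltW// addr_gt0// invr_gt0.
have N1lt : (2^-1 + eps) / beta < N1.+1%:R by exact: truncnS_gt.
have N1H : N1%:R <= (2^-1 + 3 * eps) * H.+1%:R.
  apply: le_trans N1le _; rewrite ler_pdivrMr// -mulrA.
  apply: le_trans (ler_wpM2l _ Hb'); last by lra.
  by nra.
have [HN|NH] := leqP H (N1 + 3).
  apply: (@le_trans _ _ 0); last by [].
  move: N1H; have : H%:R <= N1%:R + 3 :> R by rewrite -natrD ler_nat.
  have : 0 <= eps * H%:R by rewrite mulr_ge0// ltW.
  rewrite -(natr1 H); move: (H%:R) (N1%:R) => h n h0 h1 h2; lra.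
rewrite count_uptoE.
apply: (@le_trans _ _ (\sum_(N1.+2 <= n < H) (1 - X n ^+ 2 / B ^+ 2))).
  rewrite sumrB sumr_const_nat -mulr_suml -[1 *+ _]/(_%:R) natrB; last by lia.
  have h1 : (\sum_(N1.+2 <= i < H) X i ^+ 2) / B ^+ 2 <= eps * H%:R.
    rewrite ler_pdivrMr ?exprn_gt0// mulrAC; apply: le_trans XB.
    rewrite [X in _ <= X](@big_cat_nat _ _ _ N1.+2)//=; last by lia.
    by rewrite lerDr; apply: sumr_ge0 => i _; rewrite sqr_ge0.
  move: h1 N1H; rewrite -(natr1 N1.+1) -(natr1 N1) -(natr1 H).
  move: (_ / _) (H%:R) (N1%:R) => s h n h1 h2; clear -h1 h2 e0 e2; lra.
apply: (@le_trans _ _ (\sum_(N1.+2 <= n < H) (if `[< A n >] then 1 else 0 : R))).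
  apply: ler_sum_nat => N /andP[N1N NHH].
  have q0 : 0 <= X N ^+ 2 / B ^+ 2 by rewrite divr_ge0 ?sqr_ge0.
  case: asboolP => [_|nA]; first by lra.
  have [XNB|XNB] := leP `|X N| B; last first.
    rewrite subr_le0 ler_pdivlMr ?exprn_gt0// mul1r -[X N ^+ 2]real_normK ?num_real//.
    by have B0' := ltW B0; rewrite ler_sqr ?nnegrE// ltW.
  exfalso; apply: nA; apply: AN => //.
    by rewrite NHH andbT (leq_trans _ N1N).
  apply/andP; split.
    rewrite -ler_pdivrMr//; apply: le_trans (ltW N1lt) _.
    by apply: le_trans (_ : N%:R <= _); [rewrite ler_nat ltnW|lra].
  apply: le_trans Hb; rewrite ler_pM2r//.
  have : N.+1%:R <= H%:R :> R by rewrite ler_nat.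
  rewrite -natr1; lra.
rewrite [X in _ <= X](@big_cat_nat _ _ _ N1.+2)//=; last by clear -NH; lia.
rewrite [X in _ <= _ + X](@big_cat_nat _ _ _ H)//=; last by clear -NH; lia.
have nn a b : 0 <= \sum_(a <= i < b) (if `[< A i >] then 1 else 0 : R).
  by apply: sumr_ge0 => i _; case: ifP.
have := nn 1%N N1.+2; have := nn H H.+1; lra.
Qed.

End Density.

(** * One good fraction yields one initial segment of density close to 1/2 *)

Section LowerBound.
Context {R : realType}.
Local Notation mu := (@lebesgue_measure R).
Local Open Scope classical_set_scope.

(** With T = K mx and q < 64^(k+1) one has q beta <= 4096/T, so the main term eps / (32 q beta) is
    at least eps T / 2^17. The condition on K lets it exceed psi(9k), |X_N| <= B k and the
    logarithmic error together, each being measured against mx. In the other direction q beta >=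
    1/(2T) gives H <= 128 K 64^k k^2, hence log H <= k + 6k + 2k = 9k. *)
Lemma lower_block (psi : R -> R) (alpha eps A0 B K mx : R) (k : nat) (x : rat) :
  (forall x y, 0 < x -> x <= y -> psi x <= psi y) ->
  0 < eps -> eps <= 2^-1 -> (1 <= k)%N -> k%:R <= mx -> psi (9 * k%:R) <= mx -> mx <= k%:R ^+ 2 ->
  2 ^+ 32 <= K -> 0 <= A0 -> 0 < B -> 1 + B + 300 * eps^-1 <= eps / 2 ^+ 17 * K ->
  200 * eps^-1 ^+ 4 * (A0 + 16) <= eps * B ^+ 2 -> ln (128 * K) <= k%:R ->
  approx_set A0 (fun=> K * mx) k x alpha ->
  exists2 H, (64 ^ k <= H)%N &
    (2^-1 - 4 * eps) * H%:R - 6 <= (count_upto (sudler_set psi alpha) H)%:R :> R.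
Proof.
move=> pm e0 e1 k1 kmx pmx mxk K32 A00 B0 BK AB lK.
rewrite /approx_set; case: ifP => // /andP[/andP[q1 q2] V] /=; rewrite in_itv/=.
have [z ez] : exists z, z = alpha - ratr x by eexists.
have [d ed] : exists d : R, d = 64 ^+ (2 * k) by eexists.
rewrite -ed => /andP[z1 z2].
have k1R : 1 <= k%:R :> R by rewrite ler1n.
have K0 : 0 < K by apply: lt_le_trans K32; rewrite exprn_gt0.
have mx1 : 1 <= mx by apply: le_trans kmx.
have T0 : 0 < K * mx by apply: mulr_gt0 => //; lra.
have d0 : 0 < d by rewrite ed; apply: exprn_gt0; lra.
set T := K * mx in T0 z1 z2.
have T32 : 2 ^+ 32 <= T.
  by apply: le_trans K32 _; rewrite /T -[X in X <= _]mulr1 ler_pM2l.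
set q := dn x in q1 q2.
have qgt : (1 < q)%N.
  by apply: leq_trans q1; rewrite -[2%N]expn1 (leq_trans (_ : _ <= 2 ^ k)%N) ?leq_exp2l// leq_exp2r.
have q0 : 0 < q%:R :> R by rewrite ltr0n ltnW.
have r0 : 0 < (d * T)^-1 by rewrite invr_gt0 mulr_gt0.
have z0 : 0 < z by rewrite ez; lra.
have {}z1 : (d * T)^-1 / 2 <= z by rewrite ez; lra.
have {}z2 : z <= (d * T)^-1 by rewrite ez; lra.
have q64 : 64 ^+ k <= q%:R :> R by rewrite -natrX ler_nat.
have q64' : q%:R <= 64 * 64 ^+ k :> R by rewrite -exprS -natrX ler_nat ltnW.
have e64 : d = 64 ^+ k * 64 ^+ k by rewrite ed mul2n -addnn exprD.
have g64 : 0 < 64 ^+ k :> R by apply: exprn_gt0; lra.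
have dq : d <= q%:R * q%:R.
  by rewrite e64; apply: ler_pM => //; apply: ltW.
have dq' : q%:R * q%:R <= 4096 * d.
  have := ler_pM (ltW q0) (ltW q0) q64' q64'; rewrite e64.
  by move: (64 ^+ k) => y; lra.
have eb : `|q%:R * alpha - (numq x)%:~R| = q%:R * z.
  have -> : q%:R * alpha - (numq x)%:~R = q%:R * z.
    by rewrite ez mulrBr ratrE mulrCA divff ?mulr1// gt_eqF.
  by rewrite ger0_norm// mulr_ge0// ltW.
have [beta ebeta] : exists beta, beta = q%:R * z by eexists.
have b0 : 0 < beta by rewrite ebeta mulr_gt0.
have dT : d * (d * T)^-1 = T^-1 by rewrite invfM mulrA divff ?mul1r// gt_eqF.
have Ti0 : 0 < T^-1 by rewrite invr_gt0.
have qb1 : q%:R * beta <= 4096 / T.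
  rewrite ebeta mulrA; apply: le_trans (ler_wpM2l _ z2) _; first by rewrite mulr_ge0// ltW.
  by rewrite -dT [4096 * _]mulrA; apply: ler_wpM2r => //; exact: ltW.
have qb2 : (2 * T)^-1 <= q%:R * beta.
  rewrite ebeta mulrA; apply: le_trans (_ : d * ((d * T)^-1 / 2) <= _).
    by rewrite [d * _]mulrA dT -invfM mulrC.
  by apply: ler_pM => //; [exact: ltW|rewrite divr_ge0// ltW].
have qb0 : 0 < q%:R * beta by rewrite mulr_gt0.
pose H := Num.trunc ((1 - eps) / beta).
have he : 0 <= (1 - eps) / beta by apply: divr_ge0; [clear -e1; lra|exact: ltW].
have /andP[] := truncn_itv he; rewrite -/H => Hb Hb'.
move: Hb Hb'; rewrite ler_pdivlMr// ltr_pdivrMr// => Hb /ltW Hb'.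
have qH : (8 * q <= H)%N.
  rewrite truncn_ge_nat// ler_pdivlMr// natrM -mulrA.
  have h : 4096 / T <= 16^-1.
    rewrite ler_pdivrMr//; have e32 : 2 ^+ 32 = 2 ^+ 16 * (16 * 4096) :> R by ring.
    have h16 : 1 <= 2 ^+ 16 :> R by apply: exprn_ege1; rewrite ler1n.
    move: T32; rewrite e32; move: (2 ^+ 16) h16 => y h16 T32; clear -h16 T32; lra.
  by clear -h qb1 e1; lra.
have H0 : (0 < H)%N by apply: leq_trans qH; rewrite muln_gt0 (ltnW qgt).
have HR : 0 < H%:R :> R by rewrite ltr0n.
have HT : H%:R <= 128 * K * 64 ^+ k * k%:R ^+ 2.
  have h1 : H%:R <= beta^-1 by rewrite -[beta^-1]mul1r ler_pdivlMr//; clear -Hb e0; lra.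
  have h2 : beta^-1 <= 2 * T * q%:R.
    rewrite -[beta^-1]mul1r ler_pdivrMr//.
    have := qb2; rewrite -[X in X <= _]mul1r ler_pdivrMr; last by rewrite mulr_gt0.
    have -> // : q%:R * beta * (2 * T) = 2 * T * q%:R * beta by ring.
  apply: le_trans h1 (le_trans h2 _).
  apply: (@le_trans _ _ (2 * (K * k%:R ^+ 2) * (64 * 64 ^+ k))).
    apply: ler_pM => //; first by rewrite mulr_ge0// ltW.
    by rewrite ler_pM2l// /T ler_pM2l.
  by rewrite le_eqVlt; apply/orP; left; apply/eqP; ring.
have lnH : ln H%:R <= 9 * k%:R :> R.
  have g0 : 0 < 128 * K by apply: mulr_gt0 => //; lra.
  have kk0 : 0 < k%:R :> R by rewrite ltr0n.
  apply: (@le_trans _ _ (ln (128 * K * 64 ^+ k * k%:R ^+ 2))).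
    by rewrite ler_ln ?posrE// !mulr_gt0// exprn_gt0.
  have -> : ln (128 * K * 64 ^+ k * k%:R ^+ 2) = ln (128 * K) + ln 64 * k%:R + ln k%:R * 2.
    have k20 : 0 < k%:R ^+ 2 :> R by rewrite exprn_gt0.
    rewrite (@lnM _ (128 * K * 64 ^+ k)) ?posrE ?mulr_gt0// (@lnM _ (128 * K)) ?posrE//.
    by rewrite !lnXn// -[X in _ + X + _]mulr_natr -[X in _ + X = _]mulr_natr.
  have l64 : ln 64 <= 6 :> R.
    rewrite (_ : 64 = 2 ^+ 6 :> R); last by ring.
    by rewrite lnXn// -[X in X <= _]mulr_natl; have := @ln2_le1 R; clear; lra.
  have lk : ln k%:R <= k%:R :> R by apply: ltW; exact: ln_sublinear.
  have := ler_wpM2r (ltW kk0) l64; move: lK lk; clear; lra.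
have cp : coprimez (numq x) q by exact: coprime_numq_dn.
have := @sudler_lower R alpha (numq x) q H eps (A0 * k%:R ^+ 2) qgt cp e0 e1.
rewrite eb -ebeta => /(_ b0 Hb Hb' qH V)[X [XB XL]].
exists H; first by apply: leq_trans q1 (leq_trans _ qH); rewrite leq_pmull.
apply: (@count_lower _ _ beta eps (B * k%:R) H X) => //.
- by rewrite mulr_gt0// ltr0n.
- apply: le_trans XB _; apply: ler_wpM2r; first exact: ltW.
  apply: (@le_trans _ _ (200 * eps^-1 ^+ 4 * (A0 + 16) * k%:R ^+ 2)); last first.
    by rewrite [(B * _) ^+ 2]exprMn [eps * (_ * _)]mulrA; apply: ler_wpM2r; rewrite ?sqr_ge0.
  rewrite -[X in _ <= X]mulrA; apply: ler_wpM2l.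
    by apply: mulr_ge0; [clear; lra|rewrite exprn_ge0// invr_ge0 ltW].
  have : 1 <= k%:R ^+ 2 :> R by apply: exprn_ege1.
  by rewrite mulrDl; move: (k%:R ^+ 2) => y; clear; lra.
move=> N /andP[N2 NH] /andP[ph1 ph2] XN; split => //.
have N0 : 0 < N%:R :> R by rewrite ltr0n; exact: leq_trans N2.
have lnN : 0 < ln N%:R :> R by rewrite ln_gt0// ltr1n.
apply: le_trans (pm _ (9 * k%:R) lnN _) _.
  by apply: le_trans lnH; rewrite ler_ln ?posrE// ler_nat ltnW.
have := XL N (ltnW NH); move=> /(_ ph1 ph2); apply: le_trans.
have main : eps / 2 ^+ 17 * K * mx <= eps / (32 * q%:R * beta).
  have qbT : q%:R * beta * T <= 4096 by rewrite -ler_pdivlMr.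
  have e17 : 2 ^+ 17 = 32 * 4096 :> R by ring.
  have [c ec] : exists c : R, c = 4096 := ex_intro _ _ erefl.
  have c0 : 0 < c by rewrite ec; clear; lra.
  rewrite ler_pdivlMr; last by rewrite -mulrA mulr_gt0.
  rewrite -ec in e17 qbT; rewrite e17.
  have -> : eps / (32 * c) * K * mx * (32 * q%:R * beta) = eps * (q%:R * beta * T / c).
    by rewrite /T; field; rewrite gt_eqF.
  by rewrite -[X in _ <= X]mulr1 ler_pM2l// ler_pdivrMr// mul1r.
have mx0 : 0 <= mx by apply: le_trans mx1.
have h1 := ler_wpM2r mx0 BK.
have ie0 : 0 < eps^-1 by rewrite invr_gt0.
have h2 : eps^-1 * (1 + ln H%:R) <= eps^-1 * (10 * k%:R).
  by rewrite ler_pM2l//; clear -lnH k1R; lra.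
have h3 : (B + 300 * eps^-1) * k%:R <= (B + 300 * eps^-1) * mx.
  by apply: ler_wpM2l kmx; clear -B0 ie0; lra.
have h4 : (1 + B + 300 * eps^-1) * mx = mx + (B + 300 * eps^-1) * mx by ring.
have h5 : (B + 300 * eps^-1) * k%:R = B * k%:R + 300 * (eps^-1 * k%:R) by ring.
have h6 : 30 * eps^-1 * (1 + ln H%:R) = 30 * (eps^-1 * (1 + ln H%:R)) by ring.
have h7 : eps^-1 * (10 * k%:R) = 10 * (eps^-1 * k%:R) by ring.
rewrite h6; rewrite h4 in h1; rewrite h5 in h3; rewrite h7 in h2.
move: main h1 h2 h3 XN pmx.
move: (eps^-1 * (1 + _)) (eps^-1 * k%:R) => a1 a2.
move: ((B + _) * mx) (B * k%:R) => a3 a4.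
move: (eps / 2 ^+ 17 * K * mx) (eps / (32 * q%:R * beta)) => a5 a6.
move: (`|X N|) (psi (9 * k%:R)) => a7 a8.
by clear; lra.
Qed.

End LowerBound.

(** * Upper density at least 1/2 for almost every alpha *)

Section PartA.
Context {R : realType}.
Local Notation mu := (@lebesgue_measure R).
Local Open Scope classical_set_scope.

Lemma ae_imply (P Q : R -> Prop) : (forall x, P x -> Q x) ->
  {ae mu, forall x, P x} -> {ae mu, forall x, Q x}.
Proof.
by move=> PQ [N [mN N0 PN]]; exists N; split => // x nQ; apply: PN => /= Px; exact/nQ/PQ.
Qed.

(** [approx_infinitely_often] with T k = K max(k, psi(9k)) on the scales with psi(9k) <= k^2.
    Divergence survives the dilation by 9, the minimum with 1/k, and the removal of the k with
    1/psi(9k) < 1/k^2. *)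
Lemma frequent_lower (psi : R -> R) (eps : R) :
  (forall x, 0 < x -> 0 < psi x) -> (forall x y, 0 < x -> x <= y -> psi x <= psi y) ->
  (\sum_(1 <= k <oo) ((psi k%:R)^-1)%:E = +oo)%E ->
  0 < eps -> eps <= 2^-1 ->
  {ae mu, forall alpha : R, forall m, exists2 H, (m <= H)%N &
    (2^-1 - 4 * eps) * H%:R - 6 <= (count_upto (sudler_set psi alpha) H)%:R}.
Proof.
move=> p0 pm pdiv e0 e1.
have [A0 A00 AI] := @approx_infinitely_often R.
(* B makes eps B^2 exceed the constant of the mean square, K makes eps K / 2^17 exceed 1 + B +
   300/eps, as [lower_block] requires. *)
have [B eB] : exists B : R, B = 1 + 200 * eps^-1 ^+ 5 * (A0 + 16) := ex_intro _ _ erefl.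
have [K eK] : exists K : R, K = 2 ^+ 32 + 2 ^+ 17 * eps^-1 * (1 + B + 300 * eps^-1) := ex_intro _ _ erefl.
have ie0 : 0 < eps^-1 by rewrite invr_gt0.
have [D eD] : exists D : R, D = 200 * eps^-1 ^+ 5 * (A0 + 16) := ex_intro _ _ erefl.
have D0 : 0 < D.
  rewrite eD; apply: mulr_gt0; last by clear -A00; lra.
  by apply: mulr_gt0; [clear; lra|exact: exprn_gt0].
have B1 : 1 < B by rewrite eB -eD; clear -D0; lra.
have B0 : 0 < B by apply: lt_trans B1.
have g17 : 0 < 2 ^+ 17 :> R by apply: exprn_gt0.
have K32 : 2 ^+ 32 <= K.
  rewrite eK lerDl; apply: mulr_ge0; first by rewrite mulr_ge0// ltW.
  by clear -B0 ie0; lra.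
have K0 : 0 < K by apply: lt_le_trans K32; apply: exprn_gt0.
have BK : 1 + B + 300 * eps^-1 <= eps / 2 ^+ 17 * K.
  have e32 : 0 <= eps / 2 ^+ 17 * 2 ^+ 32.
    by apply: mulr_ge0; [apply: divr_ge0; exact: ltW|apply: exprn_ge0].
  rewrite eK mulrDr; move: e32; move: (2 ^+ 32) => y e32.
  move: (2 ^+ 17) g17 e32 => w w0 e32.
  have -> : eps / w * (w * eps^-1 * (1 + B + 300 * eps^-1)) = 1 + B + 300 * eps^-1.
    by field; rewrite !gt_eqF.
  by rewrite lerDr.
have AB : 200 * eps^-1 ^+ 4 * (A0 + 16) <= eps * B ^+ 2.
  have -> : 200 * eps^-1 ^+ 4 * (A0 + 16) = eps * D.
    by rewrite eD exprS; field; rewrite gt_eqF.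
  rewrite ler_pM2l//; have : D <= B by rewrite eB -eD; clear; lra.
  by move=> /le_trans; apply; rewrite expr2 ler_pMl// ltW.
pose f (k : nat) : R := psi (9%:R * k%:R).
have f0 k : (0 < k)%N -> 0 < f k by move=> k0; apply: p0; rewrite mulr_gt0 ?ltr0n.
have fm k l : (0 < k)%N -> (k <= l)%N -> f k <= f l.
  by move=> k0 kl; apply: pm; rewrite ?mulr_gt0 ?ltr0n// ler_pM2l ?ltr0n// ler_nat.
pose mx (k : nat) : R := Num.max k%:R (f k).
pose S (k : nat) := (0 < k)%N && (f k <= k%:R ^+ 2).
have mx1 k : (0 < k)%N -> 1 <= mx k by move=> k0; rewrite le_max ler1n k0.
have mxm k l : (0 < k)%N -> (k <= l)%N -> mx k <= mx l.
  by move=> k0 kl; rewrite ge_max !le_max ler_nat kl fm// orbT.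
have T32 k : S k -> 2 ^+ 32 <= K * mx k.
  move=> /andP[k0 _]; apply: le_trans K32 _; rewrite -[X in X <= _]mulr1.
  by apply: ler_wpM2l; [exact: ltW|exact: mx1].
have Tm k l : S k -> S l -> (k <= l)%N -> K * mx k <= K * mx l.
  by move=> /andP[k0 _] _ kl; rewrite ler_pM2l// mxm.
have Tdiv b : exists n, b <= \sum_(0 <= k < n | S k) (K * mx k)^-1.
  (* The value at 0 is a placeholder: [f 0] is psi at 0, where positivity is not assumed. The sums
     start at 1. *)
  pose t k := if k is 0 then (f 1%N)^-1 else (f k)^-1.
  have t0 k : 0 <= t k by case: k => [|k] /=; rewrite invr_ge0 ltW// f0.
  have tm k l : (1 <= k)%N -> (k <= l)%N -> t l <= t k.
    case: k l => [//|k] [//|l] _ kl /=; rewrite lef_pV2 ?posrE ?f0//; exact: fm.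
  have tt n : \sum_(1 <= k < n) t k = \sum_(1 <= k < n) (psi (9%:R * k%:R))^-1.
    by apply: eq_big_nat => -[].
  have d1 := @nneseries_unbounded R (fun k => (psi k%:R)^-1).
  have d2 := @sum_dilate_unbounded R psi 9 isT p0 pm (d1 _ pdiv).
  have d3 : forall b, exists n, b <= \sum_(1 <= k < n) t k.
    move=> b'; have [|n nb] := d2 _ b'; last by exists n; rewrite tt.
    by move=> k k1; rewrite invr_ge0; apply/ltW/p0; rewrite ltr0n.
  have d4 := @sum_min_unbounded R t t0 tm d3.
  have d5 : forall b, exists n, b <= \sum_(1 <= k < n | f k <= k%:R ^+ 2) Num.min k%:R^-1 (t k).
    apply: (@sum_sparse_unbounded R (fun k => Num.min k%:R^-1 (t k)) (fun k => f k <= k%:R ^+ 2) _ _ d4).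
      by move=> k; rewrite le_min t0 invr_ge0 ler0n.
    move=> [//|k] _; rewrite -ltNge => kf; rewrite ge_min /=; apply/orP; right.
    by rewrite lef_pV2 ?posrE ?f0 ?exprn_gt0 ?ltr0n// ltW.
  have [n nb] := d5 (K * b); exists n.
  rewrite -(ler_pM2l K0); apply: le_trans nb _.
  rewrite mulr_sumr; have [->|n0] := posnP n; first by rewrite !big_geq.
  rewrite [X in _ <= X]big_ltn_cond//= /S /=.
  rewrite big_mkcond [X in _ <= X]big_mkcond/=; apply: ler_sum_nat => -[//|k] _ /=.
  case: ifP => // _; rewrite invfM mulrA divff ?gt_eqF// mul1r /mx /Num.min /Num.max.
  have h : ((k.+1%:R)^-1 < (f k.+1)^-1) = (f k.+1 < k.+1%:R).
    by rewrite ltf_pV2 ?posrE ?f0.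
  by rewrite h; case: ltgtP => // ->.
apply: ae_imply (AI (fun k => K * mx k) S T32 Tm Tdiv) => alpha h m.
have [k /andP[mk /andP[k0 fk]] [x xa]] := h (maxn m (Num.trunc (ln (128 * K))).+1).
move: mk; rewrite geq_max => /andP[mk lk].
have [] := @lower_block R psi alpha eps A0 B K (mx k) k x pm e0 e1 k0 _ _ _ K32 (ltW A00) B0 BK AB _ xa.
- by rewrite le_max lexx.
- by rewrite le_max /f lexx orbT.
- rewrite ge_max fk andbT -[X in X <= _]mulr1 expr2 ler_wpM2l// ler1n//.
- by apply: le_trans (ltW (truncnS_gt (ln (128 * K)))) _; rewrite ler_nat.
move=> H kH cH; exists H => //; apply: leq_trans kH; apply: leq_trans mk _.
by rewrite ltnW// ltn_expl.
Qed.

Lemma density_ge_half (psi : R -> R) :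
  (forall x, 0 < x -> 0 < psi x) -> (forall x y, 0 < x -> x <= y -> psi x <= psi y) ->
  (\sum_(1 <= k <oo) ((psi k%:R)^-1)%:E = +oo)%E ->
  {ae mu, forall alpha : R, ((1 / 2)%:E <= upper_density R (sudler_set psi alpha))%E}.
Proof.
move=> p0 pm pdiv.
have ae1 : {ae mu, forall alpha : R, forall n m, exists2 H, (m <= H)%N &
    (2^-1 - 4 * n.+2%:R^-1) * H%:R - 6 <= (count_upto (sudler_set psi alpha) H)%:R :> R}.
  apply: ae_foralln => n; apply: frequent_lower => //.
  by rewrite lef_pV2 ?posrE// ler_nat.
apply: ae_imply ae1 => alpha h; apply/lee_addgt0Pr => e e0.
(* With eps = 1/(n+2), four eps come from the density loss and a fifth covers the constant 6 once H
   >= 6(n+2). *)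
pose n := Num.trunc (5 / e).
have ne : 5 * n.+2%:R^-1 <= e.
  rewrite ler_pdivrMr ?ltr0n// -ler_pdivrMl// mulrC; apply: le_trans (ltW (truncnS_gt (5 / e))) _.
  by rewrite ler_nat.
rewrite -leeBlDr// -EFinB; apply: limn_esup_ge => m.
have [H mH cH] := h n (maxn m (6 * n.+2)).
move: mH; rewrite geq_max => /andP[mH nH]; exists H => //.
have H0 : (0 < H)%N by apply: leq_trans nH.
rewrite lee_fin ler_pdivlMr ?ltr0n//; apply: le_trans cH.
have : 6%:R <= n.+2%:R^-1 * H%:R :> R.
  by rewrite mulrC ler_pdivlMr ?ltr0n// -natrM ler_nat.
have : 5 * n.+2%:R^-1 * H%:R <= e * H%:R by apply: ler_wpM2r.
move: (n.+2%:R^-1) (H%:R) => x y; clear; lra.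
Qed.

End PartA.

(** * Density at most 1/2 *)

Section Scales.
Context {R : realType}.
Local Notation mu := (@lebesgue_measure R).
Local Open Scope classical_set_scope.

Definition root4 (j : nat) : R := Num.sqrt (Num.sqrt j%:R).

Lemma root4_expn j : root4 j ^+ 4 = j%:R.
Proof. by rewrite (exprM _ 2 2) !sqr_sqrtr// sqrtr_ge0. Qed.

Lemma root4_ge0 j : 0 <= root4 j.
Proof. exact: sqrtr_ge0. Qed.

Lemma root4_ge1 j : (0 < j)%N -> 1 <= root4 j.
Proof.
move=> j0; rewrite -sqrtr1 ler_sqrt// -[X in X <= _]sqrtr1 ler_sqrt//.
by rewrite ler1n.
Qed.

(* Telescoping, since 1/s - 1/t >= 1/(4 t^5) when t^4 = s^4 + 1. *)
Lemma sum_inv_root4_le n : \sum_(0 <= i < n) (root4 i.+1 ^+ 5)^-1 <= 5.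
Proof.
case: n => [|n]; first by rewrite big_geq.
suff : \sum_(0 <= i < n.+1) (root4 i.+1 ^+ 5)^-1 <= 5 - 4 * (root4 n.+1)^-1.
  have : 0 <= (root4 n.+1)^-1 by rewrite invr_ge0 root4_ge0.
  lra.
elim: n => [|n IH].
  by rewrite big_nat1 /root4 !sqrtr1 expr1n invr1; lra.
rewrite big_nat_recr//=; apply: le_trans (lerD IH (lexx _)) _.
have s1 := root4_ge1 n.+1 isT; have s2 := root4_ge1 n.+2 isT.
have e1 := root4_expn n.+1; have e2 := root4_expn n.+2.
have e3 : root4 n.+2 ^+ 4 = root4 n.+1 ^+ 4 + 1 by rewrite e1 e2 -natr1.
have ss : root4 n.+1 <= root4 n.+2 by rewrite ler_sqrt ?sqrtr_ge0// ler_sqrt// ler_nat.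
move: (root4 n.+1) (root4 n.+2) s1 s2 e3 ss => s t s1 s2 e3 st.
have s0 : 0 < s by lra.
have t0 : 0 < t by lra.
have h1 : 1 <= (t - s) * (4 * t ^+ 3).
  have e5 : (t - s) * (t ^+ 3 + t ^+ 2 * s + t * s ^+ 2 + s ^+ 3) = t ^+ 4 - s ^+ 4 by ring.
  have {}e5 : (t - s) * (t ^+ 3 + t ^+ 2 * s + t * s ^+ 2 + s ^+ 3) = 1 by rewrite e5 e3; ring.
  rewrite -[X in X <= _]e5.
  apply: ler_wpM2l; first by lra.
  have t0' := ltW t0; have s0' := ltW s0.
  have a1 : t ^+ 2 * s <= t ^+ 3 by rewrite (exprSr _ 2); apply: ler_wpM2l => //; rewrite exprn_ge0.
  have a2 : t * s ^+ 2 <= t ^+ 3.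
    by rewrite (exprS _ 2); apply: ler_wpM2l => //; apply: lerXn2r; rewrite ?nnegrE.
  have a3 : s ^+ 3 <= t ^+ 3 by apply: lerXn2r; rewrite ?nnegrE.
  by lra.
have h2 : (t ^+ 5)^-1 <= 4 * (s^-1 - t^-1).
  have -> : 4 * (s^-1 - t^-1) = 4 * (t - s) / (s * t) by field; rewrite !gt_eqF.
  rewrite ler_pdivlMr ?mulr_gt0// mulrC ler_pdivrMr ?exprn_gt0//.
  apply: (@le_trans _ _ (s * t * ((t - s) * (4 * t ^+ 3)))).
    by rewrite -[X in X <= _]mulr1 ler_wpM2l// mulr_ge0 ?ltW.
  have -> : s * t * ((t - s) * (4 * t ^+ 3)) = 4 * (t - s) * (s * t ^+ 4) by ring.
  apply: ler_wpM2l; first by rewrite mulr_ge0// subr_ge0.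
  by rewrite (exprS _ 4); apply: ler_wpM2r => //; rewrite exprn_ge0// ltW.
by lra.
Qed.

(** Denominators are sorted into dyadic classes k <= l with radii 1/(4^k tau) and 1/(4^l tau). Class
    k has at most (b - a + 3) 4^(k+1) fractions, and [pair_measure] gives 64/(4^k tau^2) for each,
    so a pair of classes costs 256 (b - a + 3)/tau^2 whatever k and l are. The interval is widened
    by 1 on both sides because the radii are at most 1. *)
Lemma near_pair_cover (a b tau : R) (K : nat) : a <= b -> 1 <= tau ->
  exists U : set R, [/\ measurable U,
    (mu U <= (256 * (b - a + 3) * K%:R ^+ 2 / tau ^+ 2)%:E)%E &
    forall alpha x y, a <= alpha <= b -> x != y -> (dn x < 2 ^ K)%N -> (dn y < 2 ^ K)%N ->
      `|alpha - ratr x| <= ((dn x)%:R ^+ 2 * tau)^-1 ->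
      `|alpha - ratr y| <= ((dn y)%:R ^+ 2 * tau)^-1 -> U alpha].
Proof.
move=> ab tau1; have tau0 : 0 < tau by apply: lt_le_trans tau1.
have /choice [sk skP] : forall k, exists s : seq rat, uniq s /\
    forall x, x \in s = (2 ^ k <= dn x < 2 ^ k.+1)%N && (a - 1 <= ratr x <= b + 1).
  move=> k; have [s [us sP]] := @rats_between R (a - 1) (b + 1) (2 ^ k.+1).
  exists [seq x <- s | (2 ^ k <= dn x)%N]; split; first by rewrite filter_uniq.
  by move=> x; rewrite mem_filter sP !andbA.
pose W x (r : R) : set R := `[(ratr x - r)%R, (ratr x + r)%R].
pose rho k : R := (4 ^+ k * tau)^-1.
have p4 k : 0 < 4 ^+ k :> R by apply: exprn_gt0.
have rho0 k : 0 < rho k by rewrite invr_gt0 mulr_gt0.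
pose V l x : set R := \big[setU/set0]_(y <- [seq y <- sk l | y != x]) W y (rho l).
have mV l x : measurable (V l x) by apply: bigsetU_measurable => y _; exact: measurable_itv.
pose m3 k : R := 64 / (4 ^+ k * tau ^+ 2).
have P3 k l x : (k <= l)%N -> x \in sk k -> (mu (W x (rho k) `&` V l x) <= (m3 k)%:E)%E.
  move=> kl; have [_ ->] := skP k => /andP[/andP[_ dx] _].
  have [us sP] := skP l.
  have D1 : (2 ^ k.+1)%:R <= (2 ^ l.+1)%:R :> R by rewrite ler_nat leq_exp2l.
  have D0 : 0 < (2 ^ k.+1)%:R :> R by rewrite ltr0n expn_gt0.
  have rr : rho l <= rho k.
    rewrite lef_pV2 ?posrE ?mulr_gt0//; apply: ler_wpM2r; first exact: ltW.
    by rewrite ler_weXn2l// ler1n.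
  have us' : uniq [seq y <- sk l | y != x] by rewrite filter_uniq.
  have PA y : y \in [seq y <- sk l | y != x] -> (dn y < 2 ^ l.+1)%N /\ y != x.
    by rewrite mem_filter sP => /andP[-> /andP[/andP[_ ->] _]].
  have PC : 1 <= 2 * rho k * (2 ^ k.+1)%:R * (2 ^ l.+1)%:R -> 1 <= 4 * rho k * (2 ^ l.+1)%:R ^+ 2.
    move: D0 D1 (rho0 k); move: ((2 ^ k.+1)%:R) ((2 ^ l.+1)%:R) (rho k) => d d' r D0 D1 r0.
    have q1 : 0 <= r * d' * (d' - d) by rewrite !mulr_ge0 ?subr_ge0// ltW// (lt_le_trans D0).
    have q2 : 0 <= r * d' ^+ 2 by rewrite mulr_ge0 ?sqr_ge0// ltW.
    by clear -q1 q2; nra.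
  apply: le_trans (pair_measure _ _ _ _ _ _ us' dx PA (rho0 l) rr PC) _.
  rewrite lee_fin /rho /m3 natrX -exprM mulnC exprM.
  have -> : 2 ^+ 2 = 4 :> R by ring.
  rewrite exprS le_eqVlt; apply/orP; left; apply/eqP.
  by field; rewrite !gt_eqF.
pose A3 k l : set R := if (k <= l)%N then \big[setU/set0]_(x <- sk k) (W x (rho k) `&` V l x) else set0.
pose m2 : R := 256 * (b - a + 3) / tau ^+ 2.
have m20 : 0 <= m2.
  by apply: divr_ge0 (sqr_ge0 _); clear -ab; lra.
have mA3 k l : measurable (A3 k l).
  rewrite /A3; case: ifP => // _; apply: bigsetU_measurable => x _.
  by apply: measurableI => //; exact: measurable_itv.
have A3m k l : (mu (A3 k l) <= m2%:E)%E.
  rewrite /A3; case: ifP => [kl|_]; last by rewrite measure0 lee_fin.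
  have [us sP] := skP k.
  have [_ h] := @measure_bigsetU_le R _ (sk k) (fun x => W x (rho k) `&` V l x) (fun=> m3 k)
    (fun x _ => measurableI _ _ (measurable_itv _) (mV l x)) (fun x xs => P3 k l x kl xs).
  apply: le_trans h _; rewrite lee_fin big_const_seq count_predT iter_addr_0.
  rewrite -[X in X <= _]mulr_natr.
  have sz : (size (sk k))%:R <= (b - a + 3) * 4 ^+ k.+1.
    have D0 : (0 < 2 ^ k.+1)%N by rewrite expn_gt0.
    have ab1 : a - 1 <= b + 1 by lra.
    have := @rat_count R (sk k) (a - 1) (b + 1) (2 ^ k.+1) us ab1 D0.
    move=> /(_ _) h2; apply: le_trans (h2 _) _.
      by move=> x; rewrite sP => /andP[/andP[_ ->] ->].
    rewrite natrX -exprM mulnC exprM.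
    have -> : 2 ^+ 2 = 4 :> R by ring.
    have : 1 <= 4 ^+ k.+1 :> R by apply: exprn_ege1; rewrite ler1n.
    by move: (4 ^+ k.+1) => y; lra.
  apply: le_trans (ler_wpM2l _ sz) _.
    by rewrite /m3 divr_ge0// mulr_ge0 ?sqr_ge0// ltW.
  rewrite /m3 /m2 [4 ^+ k.+1]exprS le_eqVlt; apply/orP; left; apply/eqP.
  by field; rewrite !gt_eqF.
pose A2 k : set R := \big[setU/set0]_(l <- iota 0 K) A3 k l.
have A2m k : (mu (A2 k) <= (m2 * K%:R)%:E)%E.
  have [_ h] := @measure_bigsetU_le R _ (iota 0 K) (A3 k) (fun=> m2) (fun l _ => mA3 k l) (fun l _ => A3m k l).
  apply: le_trans h _; rewrite lee_fin big_const_seq count_predT iter_addr_0 size_iota.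
  by rewrite -[X in X <= _]mulr_natr.
have mA2 k : measurable (A2 k) by apply: bigsetU_measurable.
have [mU Um] := @measure_bigsetU_le R _ (iota 0 K) A2 (fun=> m2 * K%:R) (fun k _ => mA2 k) (fun k _ => A2m k).
exists (\big[setU/set0]_(k <- iota 0 K) A2 k); split => //.
  apply: le_trans Um _; rewrite lee_fin big_const_seq count_predT iter_addr_0 size_iota.
  rewrite -[X in X <= _]mulr_natr /m2 le_eqVlt; apply/orP; left; apply/eqP.
  by field; rewrite !gt_eqF.
move=> alpha.
have key x : a <= alpha <= b -> (dn x < 2 ^ K)%N ->
    `|alpha - ratr x| <= ((dn x)%:R ^+ 2 * tau)^-1 ->
    exists k, [/\ k \in iota 0 K, x \in sk k & W x (rho k) alpha].
  move=> /andP[aa ba] xK xa.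
  have /andP[k1 k2] := trunc_log_bounds (isT : 1 < 2)%N (dn_gt0 x).
  pose k := trunc_log 2 (dn x); exists k.
  have d1 : 1 <= (dn x)%:R :> R by rewrite ler1n dn_gt0.
  have xr : `|alpha - ratr x| <= rho k.
    have d0 : 0 < (dn x)%:R :> R by apply: lt_le_trans d1.
    apply: le_trans xa _; rewrite lef_pV2 ?posrE ?mulr_gt0 ?exprn_gt0//.
    apply: ler_wpM2r; first exact: ltW.
    have -> : 4 ^+ k = (2 ^+ k) ^+ 2 :> R.
      by rewrite -exprM mulnC exprM; congr (_ ^+ k); ring.
    by rewrite ler_sqr ?nnegrE ?exprn_ge0// -natrX ler_nat.
  have r1 : rho k <= 1.
    rewrite invf_le1 ?mulr_gt0//; apply: mulr_ege1 => //.
    by apply: exprn_ege1; rewrite ler1n.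
  move: (xr); rewrite ler_norml => /andP[x1 x2]; split.
  - rewrite mem_iota /= add0n -(ltn_exp2l _ _ (isT : 1 < 2)%N).
    exact: leq_ltn_trans k1 xK.
  - by have [_ ->] := skP k; rewrite k1 k2 /=; apply/andP; split; lra.
  - by rewrite /W /= in_itv/=; apply/andP; split; lra.
move=> x y ab' xy xK yK xa ya.
have [k [kK xk Wx]] := key x ab' xK xa.
have [l [lK yl Wy]] := key y ab' yK ya.
have [kl|lk] := leqP k l.
  apply/mem_bigsetU; exists k => //; apply/mem_bigsetU; exists l => //.
  rewrite /A3 kl; apply/mem_bigsetU; exists x => //; split => //.
  by apply/mem_bigsetU; exists y => //; rewrite mem_filter eq_sym xy.
apply/mem_bigsetU; exists l => //; apply/mem_bigsetU; exists k => //.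
rewrite /A3 (ltnW lk); apply/mem_bigsetU; exists y => //; split => //.
by apply/mem_bigsetU; exists x => //; rewrite mem_filter xy.
Qed.

(** Scale j concerns M between 2^(2^j) and 2^(2^(j+1)); the bound here is the square of the upper
    end, large enough for the denominators up to 2M of Dirichlet's theorem. *)
Definition scale_size (j : nat) : nat := 2 ^ (2 ^ j.+2).
Definition scale_tau (j : nat) : R := 2 ^+ j * root4 j ^+ 3.

(** The lower bound 4^(-j) for h ||h alpha|| makes all these distances positive and forces H <= 4^j
    q, so that log(H/q) = O(j) in the upper bound. *)
Definition good_scale (eps : R) (j : nat) (alpha : R) : Prop := [/\
  forall h, (1 <= h <= scale_size j)%N -> (h%:R * 4 ^+ j)^-1 < dint (h%:R * alpha),
  forall x y : rat, (dn x <= scale_size j)%N -> (dn y <= scale_size j)%N ->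
      `|alpha - ratr x| <= ((dn x)%:R ^+ 2 * scale_tau j)^-1 ->
      `|alpha - ratr y| <= ((dn y)%:R ^+ 2 * scale_tau j)^-1 -> x = y &
  \sum_(1 <= h < (scale_size j).+1)
      (if (h%:R * dint (h%:R * alpha))^-1 <= scale_tau j
       then ((h%:R * dint (h%:R * alpha)) ^+ 2)^-1 else 0) <= eps * 4 ^+ j * j%:R ^+ 2].

Lemma scale_harmonic_le (j : nat) : \sum_(1 <= h < (scale_size j).+1) (h%:R : R)^-1 <= 1 + 4 * 2 ^+ j.
Proof.
apply: le_trans (sum_inv_le _) _; rewrite lerD2l.
rewrite /scale_size natrX lnXn// -[X in X <= _]mulr_natr natrX !exprS mulrA.
have : 0 < 2 ^+ j :> R by apply: exprn_gt0.
have := @ln2_le1 R; move: (2 ^+ j) (ln 2) => y z; nra.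
Qed.

(** Up to constants the three clauses fail on measure 2^-j, 4^j / tau^2, and tau 2^j / (eps 4^j
    j^2). For tau = 2^j j^a the last two are j^(-2a) and j^(a-2) / eps, summable exactly for 1/2 < a
    < 1; a = 3/4 gives j^(-3/2) and j^(-5/4), both bounded through [root4 j ^+ 5]. *)
Lemma scale_cover (a b eps : R) (j : nat) : a <= b -> 0 < eps -> (0 < j)%N ->
  exists U : set R, [/\ measurable U,
    (mu U <= ((2 ^+ 16 * (b - a + 3) * (1 + eps^-1)) * ((root4 j ^+ 5)^-1 + (2 ^+ j)^-1))%:E)%E &
    forall alpha, a <= alpha <= b -> ~ U alpha -> good_scale eps j alpha].
Proof.
move=> ab e0 j0.
have [L eL] : exists L, L = b - a := ex_intro _ _ erefl.
have L0 : 0 <= L by rewrite eL subr_ge0.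
have [c ec] : exists c, c = root4 j := ex_intro _ _ erefl.
have c1 : 1 <= c by rewrite ec root4_ge1.
have c0 : 0 < c by apply: lt_le_trans c1.
have [w ew] : exists w : R, w = 2 ^+ j := ex_intro _ _ erefl.
have w1 : 1 <= w by rewrite ew; apply: exprn_ege1; rewrite ler1n.
have w0 : 0 < w by apply: lt_le_trans w1.
have e4 : 4 ^+ j = w ^+ 2 :> R.
  by rewrite ew -exprM mulnC exprM; congr (_ ^+ j); ring.
have jc : j%:R = c ^+ 4 by rewrite ec root4_expn.
have c31 : 1 <= c ^+ 3 by apply: exprn_ege1.
have etau : scale_tau j = w * c ^+ 3 by rewrite /scale_tau -ew -ec.
have tau1 : 1 <= scale_tau j by rewrite etau; apply: mulr_ege1.
have tau0 : 0 < scale_tau j by apply: lt_le_trans tau1.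
have h4 h : 0 <= (h%:R * 4 ^+ j)^-1 :> R by rewrite invr_ge0 mulr_ge0// exprn_ge0.
have si h : h \in index_iota 1 (scale_size j).+1 -> (0 < h)%N by rewrite mem_index_iota => /andP[].
have [U1 [mU1 U1m U1P]] := @dint_cover_family R (index_iota 1 (scale_size j).+1) a b _ ab si h4.
have [U2 [mU2 U2m U2P]] := @near_pair_cover a b (scale_tau j) (2 ^ j.+2).+1 ab tau1.
have t0 : 0 < eps * 4 ^+ j * j%:R ^+ 2.
  by rewrite mulr_gt0 ?mulr_gt0 ?exprn_gt0 ?ltr0n.
have [U3 [mU3 U3m U3P]] := @truncated_cover R (scale_size j) a b (scale_tau j) _ ab tau0 t0.
have S : \sum_(1 <= h < (scale_size j).+1) ((b - a + 2 / h%:R) / h%:R) <= 5 * w * L + 4.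
  have -> : \sum_(1 <= h < (scale_size j).+1) ((b - a + 2 / h%:R) / h%:R) =
     L * \sum_(1 <= h < (scale_size j).+1) h%:R^-1 + 2 * \sum_(1 <= h < (scale_size j).+1) (h%:R ^+ 2)^-1.
    rewrite !mulr_sumr -big_split/=; apply: eq_bigr => h _.
    by rewrite -eL mulrDl -mulrA expr2 invfM.
  have := scale_harmonic_le j; have := @sum_inv2_le R (scale_size j); rewrite -ew.
  move: (\sum_(_ <= _ < _) _) (\sum_(_ <= _ < _) _) => x y hx hy.
  have : L * x <= L * (5 * w) by apply: ler_wpM2l => //; lra.
  by lra.
have G0 : 0 < L + 3 by lra.
have ie0 : 0 < eps^-1 by rewrite invr_gt0.
have m1 : (mu U1 <= (10 * (L + 3) * w^-1)%:E)%E.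
  apply: le_trans U1m _; rewrite lee_fin.
  have -> : \sum_(h <- index_iota 1 (scale_size j).+1) 2 * (h%:R * 4 ^+ j)^-1 * (b - a + 2 / h%:R) =
     2 / w ^+ 2 * \sum_(1 <= h < (scale_size j).+1) ((b - a + 2 / h%:R) / h%:R).
    by rewrite mulr_sumr; apply: eq_bigr => h _; rewrite invfM e4; ring.
  apply: le_trans (ler_wpM2l _ S) _; first by rewrite divr_ge0// sqr_ge0.
  have -> : 2 / w ^+ 2 * (5 * w * L + 4) = (10 * L + 8 / w) * w^-1 by field; rewrite gt_eqF.
  apply: ler_wpM2r; first by rewrite invr_ge0 ltW.
  have : w^-1 <= 1 by rewrite invf_le1.
  by lra.
have m2 : (mu U2 <= (2 ^+ 14 * (L + 3) * (c ^+ 5)^-1)%:E)%E.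
  apply: le_trans U2m _; rewrite lee_fin -eL etau.
  have K2 : (2 ^ j.+2).+1%:R ^+ 2 <= 64 * w ^+ 2.
    rewrite (_ : 64 * w ^+ 2 = (8 * w) ^+ 2); last by ring.
    rewrite ler_sqr ?nnegrE//; last by rewrite mulr_ge0// ltW.
    by rewrite -natr1 natrX !exprS -ew; lra.
  apply: (@le_trans _ _ (256 * (L + 3) * (64 * w ^+ 2) / (w * c ^+ 3) ^+ 2)).
    apply: ler_wpM2r; first by rewrite invr_ge0 sqr_ge0.
    by apply: ler_wpM2l K2; clear -G0; lra.
  have -> : 256 * (L + 3) * (64 * w ^+ 2) / (w * c ^+ 3) ^+ 2 = 2 ^+ 14 * (L + 3) * (c ^+ 6)^-1.
    by field; rewrite !gt_eqF.
  apply: ler_wpM2l; first by rewrite mulr_ge0 ?exprn_ge0// ltW.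
  rewrite lef_pV2 ?posrE ?exprn_gt0// (exprS _ 5) ler_peMl// exprn_ge0// ltW//.
have m3 : (mu U3 <= (40 * (L + 3) * eps^-1 * (c ^+ 5)^-1)%:E)%E.
  apply: le_trans U3m _; rewrite lee_fin.
  apply: le_trans (ler_wpM2l _ S) _.
    by apply: divr_ge0 (ltW t0); apply: mulr_ge0 (ltW tau0).
  rewrite etau e4 jc.
  have -> : 8 * (w * c ^+ 3) / (eps * w ^+ 2 * (c ^+ 4) ^+ 2) * (5 * w * L + 4) =
     (40 * L + 32 / w) * eps^-1 * (c ^+ 5)^-1 by field; rewrite !gt_eqF.
  apply: ler_wpM2r; first by rewrite invr_ge0 exprn_ge0// ltW.
  apply: ler_wpM2r; first exact: ltW.
  have : w^-1 <= 1 by rewrite invf_le1.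
  by lra.
exists (U1 `|` U2 `|` U3); split.
- by apply: measurableU => //; exact: measurableU.
- apply: (@le_trans _ _ (mu U1 + mu U2 + mu U3)%E).
    apply: (@le_trans _ _ (mu (U1 `|` U2) + mu U3)%E).
      by apply: measureU2 => //; exact: measurableU.
    by apply: leeD => //; exact: measureU2.
  apply: le_trans (leeD (leeD m1 m2) m3) _; rewrite -!EFinD lee_fin -eL -ec -ew.
  have : 0 < (c ^+ 5)^-1 by rewrite invr_gt0 exprn_gt0.
  have : 0 < w^-1 by rewrite invr_gt0.
  move: (c ^+ 5)^-1 (w^-1) => x y y0 x0.
  have g16 : 2 ^+ 16 = 4 * 2 ^+ 14 :> R by ring.
  have g14 : 40 <= 2 ^+ 14 :> R by rewrite -natrX ler_nat.
  rewrite g16; move: (2 ^+ 14) g14 => z z0.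
  move: (L + 3) G0 (eps^-1) ie0 => G G0 ie ie0.
  have z40 : 0 <= z - 40 by clear -z0; lra.
  have z0' : 0 <= z by clear -z0; lra.
  have G0' := ltW G0; have ie0' := ltW ie0; have x0' := ltW x0; have y0' := ltW y0.
  have q1 : 0 <= (z - 40) * G * y by rewrite !mulr_ge0.
  have q2 : 0 <= (z - 40) * G * ie * x by rewrite !mulr_ge0.
  have q3 : 0 <= z * G * y by rewrite !mulr_ge0.
  have q4 : 0 <= z * G * ie * x by rewrite !mulr_ge0.
  have q5 : 0 <= z * G * ie * y by rewrite !mulr_ge0.
  have q6 : 0 <= z * G * x by rewrite !mulr_ge0.
  have q7 : 0 <= G * y by rewrite !mulr_ge0.
  have -> : 4 * z * G * (1 + ie) * (x + y) =
     4 * (z * G * x) + 4 * (z * G * y) + 4 * (z * G * ie * x) + 4 * (z * G * ie * y) by ring.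
  move: q1 q2; have -> : (z - 40) * G * y = z * G * y - 40 * (G * y) by ring.
  have -> : (z - 40) * G * ie * x = z * G * ie * x - 40 * G * ie * x by ring.
  have -> : 10 * G * y = 10 * (G * y) by ring.
  by clear -q3 q4 q5 q6 q7; lra.
move=> alpha aab nU.
have nU1 : ~ U1 alpha by move=> h; apply: nU; left; left.
have nU2 : ~ U2 alpha by move=> h; apply: nU; left; right.
have nU3 : ~ U3 alpha by move=> h; apply: nU; right.
split.
- move=> h /andP[h1 h2]; rewrite ltNge; apply/negP => hd; apply: nU1; apply: U1P => //.
  by exists h => //; rewrite mem_index_iota h1.
- move=> x y xj yj xa ya; apply/eqP; apply: contrapT => /negP xy; apply: nU2.
  have lt z : (dn z <= scale_size j)%N -> (dn z < 2 ^ (2 ^ j.+2).+1)%N.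
    by move=> zj; apply: leq_ltn_trans zj _; rewrite /scale_size ltn_exp2l.
  by apply: (U2P alpha x y) => //; exact: lt.
rewrite leNgt; apply/negP => /ltW h; apply: nU3; exact: U3P.
Qed.

Lemma good_scale_ae : {ae mu, forall alpha : R, forall i : nat,
  exists j0, forall j, (j0 <= j)%N -> good_scale i.+1%:R^-1 j alpha}.
Proof.
suff H n : {ae mu, forall alpha : R, forall i : nat, exists j0, forall j, (j0 <= j)%N ->
    - n%:R <= alpha <= n%:R -> good_scale i.+1%:R^-1 j alpha}.
  apply: ae_imply (ae_foralln H) => alpha h i.
  have [j0 jP] := h (Num.trunc `|alpha|).+1 i; exists j0 => j jj; apply: jP => //.
  by rewrite -ler_norml ltW// truncnS_gt.
apply: ae_foralln => i.
have e0 : 0 < i.+1%:R^-1 :> R by rewrite invr_gt0.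
have nn : - n%:R <= n%:R :> R by rewrite ge0_cp.
have /choice [U UP] : forall j, exists V : set R, [/\ measurable V,
    (mu V <= ((2 ^+ 16 * (n%:R - - n%:R + 3) * (1 + (i.+1%:R^-1)^-1)) *
        ((root4 j.+1 ^+ 5)^-1 + (2 ^+ j.+1)^-1))%:E)%E &
    forall alpha, - n%:R <= alpha <= n%:R -> ~ V alpha -> good_scale i.+1%:R^-1 j.+1 alpha].
  by move=> j; exact: scale_cover.
set C : R := 2 ^+ 16 * _ * _ in UP.
have C0 : 0 <= C.
  by rewrite /C; apply: mulr_ge0; [apply: mulr_ge0; [exact: exprn_ge0|rewrite opprK !addr_ge0]|rewrite invrK addr_ge0].
have := @borel_cantelli R U (fun j => C * ((root4 j.+1 ^+ 5)^-1 + (2 ^+ j.+1)^-1)).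
move=> /(_ _ _ _ _) bc; apply: ae_imply (bc _ _ _ _).
- move=> alpha [j0 jP]; exists j0.+1 => -[//|j] jj ran.
  by have [_ _] := UP j; apply => //; exact: jP.
- by move=> j; have [] := UP j.
- by move=> j; rewrite mulr_ge0// addr_ge0// invr_ge0 exprn_ge0// root4_ge0.
- by move=> j; have [] := UP j.
exists (C * (5 + 2)) => k; rewrite -mulr_sumr; apply: ler_wpM2l => //.
rewrite big_split/=; apply: lerD; first exact: sum_inv_root4_le.
apply: le_trans (@sum_half_le R k); rewrite /index_iota subn0; apply: ler_sum => j _.
by rewrite lef_pV2 ?posrE ?exprn_gt0// ler_weXn2l// ler1n.
Qed.

End Scales.

(** * Counting the N in each half of the period *)

Section Phase.
Context {R : realType}.

(** The angle (2N+1) pi b reduced modulo 2 pi lies in [0, pi], the range of the Fejer-Jackson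
    inequality. *)
Definition low_phase (b : R) (N : nat) : Prop :=
  exists k : nat, k%:R <= (N%:R + 2^-1) * b <= k%:R + 2^-1.

(* The potential dint decreases by at most b at a step in low phase and, inside a period,
   decreases by exactly b at a step in high phase. *)
Lemma phase_potential (b : R) (n : nat) : 0 < b ->
  (\sum_(0 <= N < n) (if `[< low_phase b N >] then -1 else 1)) * b <=
  2 * b * (Num.trunc ((n%:R + 2^-1) * b))%:R - dint ((n%:R + 2^-1) * b) + b / 2.
Proof.
move=> b0; elim: n => [|n IH].
  rewrite big_geq// mul0r add0r.
  have := dint_le (2^-1 * b) 0; rewrite subr0 ger0_norm; last by rewrite mulr_ge0 ?invr_ge0// ltW.
  have : 0 <= 2 * b * (Num.trunc (2^-1 * b))%:R by rewrite !mulr_ge0// ltW.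
  lra.
rewrite big_nat_recr//= mulrDl; apply: le_trans (lerD IH (lexx _)) _.
have -> : (n.+1%:R + 2^-1) * b = (n%:R + 2^-1) * b + b by rewrite -natr1; ring.
have th0 : 0 <= (n%:R + 2^-1) * b by rewrite mulr_ge0 ?addr_ge0 ?invr_ge0// ltW.
have [th eth] : exists th, th = (n%:R + 2^-1) * b := ex_intro _ _ erefl.
have := dintD th b; rewrite (ger0_norm (ltW b0)) => lip.
have th0' : 0 <= th + b by rewrite eth addr_ge0// ltW.
have kk : (Num.trunc th <= Num.trunc (th + b))%N by apply: le_truncn; rewrite lerDl ltW.
have th00 : 0 <= th by rewrite eth.
have /andP[k1 k2] := truncn_itv th00.
rewrite -eth.
have kk1 : 2 * b * (Num.trunc th)%:R <= 2 * b * (Num.trunc (th + b))%:R.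
  by apply: ler_wpM2l; [rewrite mulr_ge0// ltW|rewrite ler_nat].
case: asboolP => [_|hi]; first by clear -lip kk1; lra.
have {}hi : (Num.trunc th)%:R + 2^-1 < th.
  by rewrite ltNge; apply/negP => h; apply: hi; exists (Num.trunc th); rewrite -eth k1.
have [klt|kge] := ltnP (Num.trunc th) (Num.trunc (th + b)).
  have : 2 * b * ((Num.trunc th)%:R + 1) <= 2 * b * (Num.trunc (th + b))%:R.
    by apply: ler_wpM2l; [rewrite mulr_ge0// ltW|rewrite natr1 ler_nat].
  by clear -lip; lra.
have ek : Num.trunc (th + b) = Num.trunc th by apply/eqP; rewrite eqn_leq kge.
have := truncn_itv th0'; rewrite ek => /andP[_ k3].
have d1 : dint th = (Num.trunc th)%:R + 1 - th.
  rewrite (@dint_small _ th (Num.trunc th).+1) -[(Posz _)%:~R]/((Num.trunc th).+1%:R) -natr1.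
    by rewrite ler0_norm; move: k2; rewrite -natr1; lra.
  by rewrite ler_norml; move: k2 hi; rewrite -natr1; clear; move=> *; apply/andP; split; lra.
have d2 : dint (th + b) <= (Num.trunc th)%:R + 1 - (th + b).
  apply: le_trans (dint_le _ (Num.trunc th).+1) _.
  rewrite -[(Posz _)%:~R]/((Num.trunc th).+1%:R) -natr1 ler0_norm; move: k3; rewrite -natr1; lra.
by rewrite d1; move: d2; clear; lra.
Qed.

(** After division by b, [phase_potential] bounds the excess of high over low phases by twice the
    number of completed periods plus 1/2, and there are at most (n + 1/2) b such periods. *)
Lemma high_phase_count (b : R) (n : nat) : 0 < b ->
  \sum_(0 <= N < n) (if `[< low_phase b N >] then 0 else 1 : R) <= n%:R / 2 + (n%:R + 1) * b + 1.
Proof.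
move=> b0; have := phase_potential b n b0.
have -> : \sum_(0 <= N < n) (if `[< low_phase b N >] then -1 else 1 : R) =
   2 * \sum_(0 <= N < n) (if `[< low_phase b N >] then 0 else 1 : R) - n%:R.
  have -> : n%:R = \sum_(0 <= N < n) (1 : R) by rewrite sumr_const_nat subn0.
  rewrite mulr_sumr -sumrB; apply: eq_bigr => N _; case: ifP => _; lra.
have := dint_ge0 ((n%:R + 2^-1) * b).
have th0 : 0 <= (n%:R + 2^-1) * b by rewrite mulr_ge0 ?addr_ge0 ?invr_ge0// ltW.
have : (Num.trunc ((n%:R + 2^-1) * b))%:R <= (n%:R + 2^-1) * b by rewrite truncn_le.
move: (dint _) ((Num.trunc _)%:R) (\sum_(_ <= _ < _) _) => d t s t1 d0 h.
have h1 : (2 * s - n%:R) * b <= (2 * ((n%:R + 2^-1) * b) + 2^-1) * b.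
  have : 2 * b * t <= 2 * b * ((n%:R + 2^-1) * b) by rewrite ler_wpM2l// mulr_ge0// ltW.
  by move: h d0; clear; lra.
by move: h1; rewrite ler_pM2r//; clear -b0; lra.
Qed.

(** Pointwise the indicator of A is at most that of N < N0, plus that of a high phase, plus X_N^2 /
    B^2. *)
Lemma count_upper (A : set nat) (b B : R) (M N0 : nat) (X : nat -> R) : 0 < b -> 0 < B ->
  (forall N, (N0 <= N <= M)%N -> low_phase b N -> `|X N| <= B -> ~ A N) ->
  (count_upto A M)%:R <= N0%:R + (M.+1%:R / 2 + (M.+1%:R + 1) * b + 1) +
     (\sum_(0 <= N < M.+1) X N ^+ 2) / B ^+ 2.
Proof.
move=> b0 B0 AN; rewrite count_uptoE.
apply: (@le_trans _ _ (\sum_(0 <= N < M.+1) (if `[< A N >] then 1 else 0 : R))).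
  by rewrite [X in _ <= X]big_ltn// lerDr; case: ifP.
have n0 : \sum_(0 <= N < M.+1) (if (N < N0)%N then 1 else 0 : R) <= N0%:R.
  have -> : N0%:R = \sum_(0 <= N < N0) (1 : R) by rewrite sumr_const_nat subn0.
  rewrite -big_mkcond/=; have [h|h] := leqP M.+1 N0.
    rewrite [X in _ <= X](@big_cat_nat _ _ _ M.+1)//= big_mkcond/=.
    apply: le_trans (_ : _ <= \sum_(0 <= i < M.+1) (1 : R)) _.
      by apply: ler_sum => i _; case: ifP.
    by rewrite lerDl sumr_ge0.
  rewrite (@big_cat_nat _ _ _ N0)//=; last exact: ltnW.
  rewrite [X in _ + X]big_nat_cond [X in _ + X]big_pred0 ?addr0.
    by rewrite big_mkcond/=; apply: ler_sum => i _; case: ifP.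
  by move=> i; apply/negP => /andP[/andP[h1 _]]; rewrite ltnNge h1.
apply: le_trans (lerD (lerD n0 (high_phase_count b M.+1 b0)) (lexx _)).
rewrite mulr_suml -!big_split/=; apply: ler_sum_nat => N /andP[_ NM].
have q0 : 0 <= X N ^+ 2 / B ^+ 2 by rewrite divr_ge0 ?sqr_ge0.
case: ifPn => [/asboolP AAN|_]; last first.
  by rewrite !addr_ge0//; case: ifP.
case: ifPn => [_|]; first by case: asboolP => _; move: q0; lra.
rewrite -leqNgt => NN; case: asboolP => [lp|_]; last by move: q0; lra.
rewrite !add0r ler_pdivlMr ?exprn_gt0// mul1r leNgt; apply/negP => XB.
apply: (AN N _ lp _ AAN); first by rewrite NN.
by rewrite -ler_sqr ?nnegrE ?(ltW B0)// real_normK ?num_real// ltW.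
Qed.

End Phase.

(** * The upper bound for log P_N at a good scale *)

Section UpperScale.
Context {R : realType}.
Local Open Scope classical_set_scope.

Lemma reduced_fraction (h : nat) (a : int) : (0 < h)%N ->
  let z : rat := a%:~R / h%:R in exists2 g : nat, h = (g * dn z)%N & a = g%:Z * numq z.
Proof.
move=> h0 z.
have cross : numq z * h%:Z = a * (dn z)%:Z.
  apply/eqP; rewrite -(eqr_int rat) !rmorphM/=.
  have hz : h%:R != 0 :> rat by rewrite pnatr_eq0 -lt0n.
  have dz : (dn z)%:R != 0 :> rat by rewrite pnatr_eq0 -lt0n dn_gt0.
  have e : z = (numq z)%:~R / (dn z)%:R.
    by rewrite -[(dn z)%:R]/((dn z)%:Z%:~R) /dn absz_denq divq_num_den.
  by rewrite -[(h%:Z)%:~R]/(h%:R) -[((dn z)%:Z)%:~R]/((dn z)%:R) -eqr_div// -e.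
have dvd : (dn z %| h)%N.
  have : (dn z %| numq z * h%:Z)%Z by rewrite cross dvdz_mull.
  by rewrite Gauss_dvdzr// coprimez_sym coprime_numq_dn.
exists (h %/ dn z)%N; first by rewrite divnK.
have dz : (dn z)%:Z != 0 by rewrite eqz_nat -lt0n dn_gt0.
by apply: (mulIf dz); rewrite -cross mulrAC -PoszM divnK// mulrC.
Qed.

Lemma scale_size_ge (j M : nat) : (M < 2 ^ (2 ^ j.+1))%N -> (2 * M <= scale_size j)%N.
Proof.
move=> Mj; apply: (@leq_trans (2 ^ (2 ^ j.+1).+1)).
  by rewrite expnS leq_mul2l ltnW.
by rewrite /scale_size leq_exp2l// [(2 ^ j.+2)%N]expnS mul2n -addnn -add1n leq_add2r expn_gt0.
Qed.

Lemma double_exp_ge (j : nat) : (0 < j)%N -> (4 ^ j <= 2 ^ (2 ^ j))%N.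
Proof.
case: j => // j _; rewrite (_ : 4 = 2 ^ 2)%N// -expnM leq_exp2l// [(2 ^ j.+1)%N]expnS leq_mul2l.
by rewrite ltn_expl.
Qed.

(** Dirichlet's theorem with denominators up to 2M gives x = p/q with beta <= 1/(2M), so that all N
    <= M are within H. The phase is governed by a fraction y = n1/m that need not be x, and b = |m
    alpha - n1|. In the bound, log H = O(2^j) and (1 + log q)(3 + log(H/q)) = O(2^j j), the same
    size as tau allows. *)
Lemma upper_scale (eps : R) (j M : nat) (alpha : R) : good_scale eps j alpha ->
  (0 < j)%N -> (2 ^ (2 ^ j) <= M < 2 ^ (2 ^ j.+1))%N ->
  exists2 b : R, 0 < b & exists X : nat -> R, [/\
    M%:R * b <= M%:R / 2 ^+ j + 1, b <= 1,
    \sum_(0 <= N < M.+1) X N ^+ 2 <= 1026 * M.+1%:R * (eps * 4 ^+ j * j%:R ^+ 2) &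
    forall N, (N <= M)%N -> low_phase b N ->
      ln (sudler N alpha) <= `|X N| + 600 * (2 ^+ j * j%:R)].
Proof.
move=> [G1 G2 G3] j0 /andP[Mj1 Mj2].
have M0 : (0 < M)%N by apply: leq_trans Mj1; rewrite expn_gt0.
have QX := scale_size_ge j M Mj2.
have Q0 : (0 < 2 * M)%N by rewrite muln_gt0.
have [x [xQ xa]] := @dirichlet_approximation R alpha (2 * M) Q0.
set X0 := scale_size j in QX G1 G2 G3.
have [w ew] : exists w : R, w = 2 ^+ j := ex_intro _ _ erefl.
have w1 : 1 <= w by rewrite ew; apply: exprn_ege1; rewrite ler1n.
have w0 : 0 < w by apply: lt_le_trans w1.
have e4 : 4 ^+ j = w ^+ 2 :> R.
  by rewrite ew -exprM mulnC exprM; congr (_ ^+ j); ring.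
have jR : 1 <= j%:R :> R by rewrite ler1n.
have c1 : 1 <= root4 j :> R by rewrite root4_ge1.
have c31 : 1 <= root4 j ^+ 3 :> R by apply: exprn_ege1.
have c3 : root4 j ^+ 3 <= j%:R :> R.
  by rewrite -root4_expn (exprS _ 3) ler_peMl// exprn_ge0// (le_trans ler01).
set tau : R := scale_tau j in G2 G3.
have tauw : w <= tau by rewrite /tau /scale_tau -ew ler_peMr// ltW.
have tauj : tau <= w * j%:R by rewrite /tau /scale_tau -ew ler_pM2l.
have tau0 : 0 < tau by apply: lt_le_trans tauw.
set q := dn x in xQ xa.
have qX : (q <= X0)%N by apply: leq_trans xQ QX.
have q0 : (0 < q)%N by exact: dn_gt0.
have qR : 0 < q%:R :> R by rewrite ltr0n.
have MR : 0 < M%:R :> R by rewrite ltr0n.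
have nE y : `|(dn y)%:R * alpha - (numq y)%:~R| = (dn y)%:R * `|alpha - ratr y|.
  have d0 : 0 < (dn y)%:R :> R by rewrite ltr0n dn_gt0.
  have -> : (dn y)%:R * alpha - (numq y)%:~R = (dn y)%:R * (alpha - ratr y).
    by rewrite mulrBr ratrE mulrCA divff ?mulr1// gt_eqF.
  by rewrite normrM normr_nat.
have low y : (dn y <= X0)%N -> ((dn y)%:R * 4 ^+ j)^-1 < `|(dn y)%:R * alpha - (numq y)%:~R|.
  move=> yX; apply: lt_le_trans (dint_le _ (numq y)); apply: G1.
  by rewrite dn_gt0.
have p4 : 0 < 4 ^+ j :> R by apply: exprn_gt0.
have [beta eb] : exists beta, beta = `|q%:R * alpha - (numq x)%:~R| := ex_intro _ _ erefl.
have blow : (q%:R * 4 ^+ j)^-1 < beta by rewrite eb; exact: low.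
have b0 : 0 < beta by apply: lt_trans blow; rewrite invr_gt0 mulr_gt0.
have bup : beta <= (2 * M%:R)^-1.
  rewrite eb nE; apply: le_trans (ler_wpM2l (ltW qR) xa) _.
  by rewrite invfM mulrA divff ?gt_eqF// mul1r natrM.
(* For q = 1 one would have 4^(-j) < beta <= 1/(2M), against M >= 2^(2^j) >= 4^j. *)
have q1 : (1 < q)%N.
  rewrite ltn_neqAle q0 andbT eq_sym; apply/eqP => q1.
  move: (lt_le_trans blow bup); rewrite q1 mul1r ltf_pV2 ?posrE ?mulr_gt0//.
  apply/negP; rewrite -leNgt -natrX -natrM ler_nat.
  by apply: leq_trans (double_exp_ge j j0) _; apply: leq_trans Mj1 _; rewrite leq_pmull.
pose H := Num.trunc (2 * beta)^-1.
have hb0 : 0 <= (2 * beta)^-1 by rewrite invr_ge0 mulr_ge0// ltW.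
have /andP[Hb Hb'] := truncn_itv hb0; rewrite -/H in Hb Hb'.
have Hb1 : H%:R * beta <= 2^-1.
  by move: Hb; rewrite invfM ler_pdivlMr.
have Hb2 : 2^-1 <= H.+1%:R * beta.
  by move: (ltW Hb'); rewrite invfM ler_pdivrMr.
have MH : (M <= H)%N.
  rewrite truncn_ge_nat// invfM ler_pdivlMr//.
  apply: le_trans (ler_wpM2l (ltW MR) bup) _.
  by rewrite invfM mulrCA divff ?mulr1// gt_eqF.
have qH : (q <= 2 * H)%N by apply: leq_trans xQ _; rewrite leq_mul2l MH orbT.
have H0 : (0 < H)%N by apply: leq_trans MH.
have Hup : H%:R <= q%:R * w ^+ 2.
  apply: le_trans Hb _; rewrite -e4.
  rewrite -[X in _ <= X]invrK lef_pV2 ?posrE ?invr_gt0 ?mulr_gt0//.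
  by apply: le_trans (ltW blow) _; move: b0; clear; lra.
pose Pr (z : rat) := (dn z <= X0)%N /\ `|alpha - ratr z| <= ((dn z)%:R ^+ 2 * tau)^-1.
(* A good scale has at most one z satisfying [Pr]. It is taken for y if it exists; otherwise y = x
   serves and [yP] is vacuous. *)
have [y [yX yP yx]] : exists y, [/\ (dn y <= X0)%N, forall z, Pr z -> z = y & y = x \/ Pr y].
  have [[z [zX za]]|nz] := pselect (exists z, Pr z).
    exists z; split => //; last by right.
    by move=> z' [zX' za']; apply: G2.
  by exists x; split => //; [move=> z Pz; exfalso; apply: nz; exists z|left].
pose m := dn y; pose n1 := numq y.
have m0 : (0 < m)%N by exact: dn_gt0.
have mR : 1 <= m%:R :> R by rewrite ler1n.
have [b1 eb1] : exists b1, b1 = `|m%:R * alpha - n1%:~R| := ex_intro _ _ erefl.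
have b10 : 0 < b1.
  by apply: le_lt_trans (_ : (m%:R * 4 ^+ j)^-1 < _); [rewrite invr_ge0 mulr_ge0// ltW|rewrite eb1; exact: low].
have qm : (m = q /\ n1 = numq x) \/ (q%:R * beta)^-1 <= tau.
  have [exy|yx'] := eqVneq y x; [by left; rewrite /m /n1 exy|right].
  have nP : ~ Pr x by move=> /yP xy; move: yx'; rewrite xy eqxx.
  have : (q%:R ^+ 2 * tau)^-1 < `|alpha - ratr x|.
    by rewrite ltNge; apply/negP => h; apply: nP; split.
  rewrite eb nE -/q => h.
  rewrite -[tau]invrK lef_pV2 ?posrE ?invr_gt0// ?mulr_gt0//; last first.
    by apply: lt_trans h; rewrite invr_gt0 mulr_gt0// exprn_gt0.
  move: (ltW h); rewrite invfM -[_ * tau^-1]mulrC ler_pdivrMr ?exprn_gt0//.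
  by rewrite mulrC expr2 mulrA.
pose main h := (m %| h)%N && ((h %/ m)%N%:R * b1 <= 2^-1).
(* If h ||h alpha|| < 1/tau, the integer nearest to h alpha divided by h reduces to a fraction
   satisfying [Pr], that is to y. Then h = g m and g b1 = ||h alpha|| <= 1/2, so h is a main index.
   All other terms occur in the truncated sum of [good_scale]. *)
have Zb : \sum_(1 <= h < (q %/ 2).+1 | ~~ main h) ((h%:R * dint (h%:R * alpha)) ^+ 2)^-1
    <= eps * 4 ^+ j * j%:R ^+ 2.
  apply: le_trans G3.
  have qq : (q %/ 2 <= X0)%N by apply: leq_trans qX; exact: leq_div.
  rewrite [X in _ <= X](@big_cat_nat _ _ _ (q %/ 2).+1)//=.
  apply: le_trans (_ : _ <= \sum_(1 <= h < (q %/ 2).+1)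
    (if (h%:R * dint (h%:R * alpha))^-1 <= tau then ((h%:R * dint (h%:R * alpha)) ^+ 2)^-1 else 0)) _; last first.
    by rewrite lerDl sumr_ge0// => i _; case: ifP => // _; rewrite invr_ge0 sqr_ge0.
  rewrite big_mkcond/=; apply: ler_sum_nat => h /andP[h1 hq].
  have hX : (h <= X0)%N by apply: leq_trans qq; rewrite -ltnS.
  have hd : 0 < dint (h%:R * alpha).
    apply: le_lt_trans (G1 h _); last by rewrite h1.
    by rewrite invr_ge0 mulr_ge0// ltW.
  have hR : 0 < h%:R :> R by rewrite ltr0n.
  case: ifPn => [nm|_]; last by case: ifP => // _; rewrite invr_ge0 sqr_ge0.
  case: ifPn => //; rewrite -ltNge => ex; exfalso; move/negP: nm; apply.
  have [a ea] := dint_ex (h%:R * alpha).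
  have [g hg ag] := reduced_fraction h a h1.
  set z : rat := _ / _ in hg ag.
  have g0 : (0 < g)%N by move: h1; rewrite {1}hg muln_gt0 => /andP[].
  have gR : 1 <= g%:R :> R by rewrite ler1n.
  have dz : 0 < (dn z)%:R :> R by rewrite ltr0n dn_gt0.
  have ed : dint (h%:R * alpha) = g%:R * `|(dn z)%:R * alpha - (numq z)%:~R|.
    rewrite ea {1}hg ag intrM natrM -mulrA -[(g%:Z)%:~R]/(g%:R) -mulrBr normrM normr_nat//.
  have Pz : Pr z.
    split; first by apply: leq_trans hX; rewrite hg leq_pmull.
    have {}ex : h%:R * dint (h%:R * alpha) < tau^-1.
      by rewrite -[X in X < _]invrK ltf_pV2 ?posrE ?invr_gt0// mulr_gt0.
    rewrite ed nE in ex.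
    rewrite invfM ler_pdivlMl ?exprn_gt0//; apply: le_trans (ltW ex).
    rewrite [in X in _ <= X]hg natrM expr2.
    have n0 : 0 <= `|alpha - ratr z| by [].
    apply: (@le_trans _ _ (g%:R * (g%:R * ((dn z)%:R * (dn z)%:R * `|alpha - ratr z|)))).
      have s0 : 0 <= (dn z)%:R * (dn z)%:R * `|alpha - ratr z|.
        by rewrite mulr_ge0// mulr_ge0// ltW.
      have s1 : (dn z)%:R * (dn z)%:R * `|alpha - ratr z| <=
          g%:R * ((dn z)%:R * (dn z)%:R * `|alpha - ratr z|) by rewrite ler_peMl.
      by apply: le_trans s1 _; rewrite ler_peMl// mulr_ge0// (le_trans ler01).
    by rewrite le_eqVlt; apply/orP; left; apply/eqP; ring.
  have zy := yP z Pz.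
  have mh : h = (g * m)%N by rewrite {1}hg zy.
  rewrite /main mh dvdn_mull//= mulnK// eb1 /m /n1 -zy -ed.
  exact: dint_le_half.
have Lm : (q <= 2 * M.+1)%N by apply: leq_trans xQ _; rewrite leq_mul2l leqnSn orbT.
have cp : coprimez (numq x) q by exact: coprime_numq_dn.
have := @sudler_upper R alpha (numq x) n1 q m H M.+1 tau (eps * 4 ^+ j * j%:R ^+ 2).
rewrite -eb -eb1 => /(_ q1 cp b0 Hb1 Hb2 qH m0 b10 (ltW tau0) qm Zb isT Lm)[X [XB XL]].
(* The period 1/b is long in both cases: y satisfies [Pr] and b1 <= 1/tau <= 2^(-j), or y = x and b1
   = beta. *)
have bM : b1 <= tau^-1 \/ b1 <= (2 * M%:R)^-1.
  case: yx => [exy|[_ ya]]; last first.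
    left; rewrite eb1 nE -/m; apply: le_trans (ler_wpM2l _ ya) _; first by rewrite (le_trans ler01).
    have m0' : 0 < m%:R :> R by rewrite ltr0n.
    rewrite -/m expr2 -mulrA invfM mulrA divff ?gt_eqF// mul1r.
    have mt : tau <= m%:R * tau by apply: ler_peMl mR; exact: ltW.
    by rewrite lef_pV2 ?posrE//; apply: lt_le_trans mt.
  by right; rewrite eb1 /m /n1 exy -/q -eb.
exists b1 => //; exists X; split => //.
- rewrite -ew; case: bM => h.
    apply: le_trans (ler_wpM2l (ltW MR) h) _.
    have : M%:R / tau <= M%:R / w by rewrite ler_pM2l// lef_pV2 ?posrE.
    clear; lra.
  apply: le_trans (ler_wpM2l (ltW MR) h) _.
  have -> : M%:R * (2 * M%:R)^-1 = 2^-1 :> R by field; rewrite gt_eqF.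
  have : 0 <= M%:R / w by rewrite divr_ge0// ltW.
  clear; lra.
- case: bM => /le_trans; apply.
    by rewrite invf_le1//; apply: le_trans tauw.
  by rewrite invf_le1 ?mulr_gt0//; have : 1 <= M%:R :> R by [rewrite ler1n]; clear; lra.
move=> N NM lp; apply: le_trans (XL N (leq_trans NM MH) lp) _.
have wj : w <= w * j%:R by rewrite ler_peMr// ltW.
have lq : ln q%:R <= 4 * w :> R.
  apply: (@le_trans _ _ (ln X0%:R)); first by rewrite ler_ln ?posrE ?ltr0n ?ler_nat// (leq_trans q0).
  rewrite /X0 /scale_size natrX lnXn// -[X in X <= _]mulr_natr natrX !exprS -ew mulrA.
  by have := @ln2_le1 R; move: (ln 2) => z hz; clear -hz w0; nra.
have lw : ln w <= j%:R :> R.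
  by rewrite ew lnXn// -[X in X <= _]mulr_natr; have := @ln2_le1 R; clear -jR; nra.
have lH : ln H%:R <= 4 * w + 2 * j%:R :> R.
  apply: (@le_trans _ _ (ln (q%:R * w ^+ 2))).
    by rewrite ler_ln ?posrE ?ltr0n// mulr_gt0// exprn_gt0.
  rewrite lnM ?posrE ?exprn_gt0// lnXn// -[ln w *+ 2]mulr_natr; clear -lq lw; lra.
have lHq : ln (H %/ q)%N%:R <= 2 * j%:R :> R.
  have [->|hq] := posnP (H %/ q); first by rewrite ln0// mulr_ge0// (le_trans ler01).
  apply: (@le_trans _ _ (ln (w ^+ 2))).
    rewrite ler_ln ?posrE ?ltr0n ?exprn_gt0//.
    rewrite -(ler_pM2l qR); apply: le_trans Hup; rewrite -natrM ler_nat mulnC.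
    exact: leq_trunc_div.
  by rewrite lnXn// -[ln w *+ 2]mulr_natr; clear -lw; lra.
have jw : j%:R <= w by rewrite ew -natrX ler_nat ltnW// ltn_expl.
have lq0 : 0 <= ln q%:R :> R by rewrite ln_ge0// ler1n.
have P1 : (1 + ln q%:R) * (3 + ln (H %/ q)%N%:R) <= (5 * w) * (5 * j%:R).
  apply: (@le_trans _ _ ((1 + ln q%:R) * (5 * j%:R))).
    by apply: ler_wpM2l; lra.
  by apply: ler_wpM2r; lra.
rewrite -ew; move: P1 tauj lH wj jw.
have -> : 5 * w * (5 * j%:R) = 25 * (w * j%:R) by ring.
rewrite -[4 * (1 + ln q%:R) * _]mulrA.
move: (_ * (3 + _)) (w * j%:R) (ln H%:R) (`|X N|) => u v l xx; clear -w1; lra.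
Qed.

End UpperScale.

(** * Upper density at most 1/2 for almost every alpha *)

Section PartB.
Context {R : realType}.
Local Notation mu := (@lebesgue_measure R).
Local Open Scope classical_set_scope.

Lemma limn_einf_eventually (u : nat -> \bar R) (c : \bar R) : (c < limn_einf u)%E ->
  exists m, forall k, (m <= k)%N -> (c <= u k)%E.
Proof.
rewrite /limn_einf lteNr => /ereal_inf_lt[_ [V [m _ mV] <-] h]; exists m => k mk.
rewrite -leeN2; apply: le_trans (ltW h); apply: ereal_sup_ubound.
by exists k => //; exact: mV.
Qed.

Lemma ln2_ge_half : 2^-1 <= ln 2 :> R.
Proof.
have := @le_ln1Dx R (- 2^-1); rewrite (_ : 1 + - 2^-1 = 2^-1); last by field.
by rewrite lnV ?posrE// => h; have := h ltac:(lra); lra.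
Qed.

Lemma double_exp_bracket (J M : nat) : (2 ^ (2 ^ J) <= M)%N ->
  exists2 j, (J <= j)%N & (2 ^ (2 ^ j) <= M < 2 ^ (2 ^ j.+1))%N.
Proof.
move=> JM; have M0 : (0 < M)%N by apply: leq_trans JM; rewrite expn_gt0.
have /andP[l1 l2] := trunc_log_bounds (isT : 1 < 2)%N M0.
set l := trunc_log 2 M in l1 l2.
have l0 : (0 < l)%N.
  rewrite -ltnS -(ltn_exp2l _ _ (isT : 1 < 2)%N); apply: leq_ltn_trans l2.
  by apply: leq_trans JM; rewrite leq_exp2l// expn_gt0.
have /andP[j1 j2] := trunc_log_bounds (isT : 1 < 2)%N l0.
set j := trunc_log 2 l in j1 j2.
have Mj : (M < 2 ^ (2 ^ j.+1))%N by apply: leq_trans l2 _; rewrite leq_exp2l.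
exists j; last by rewrite Mj andbT; apply: leq_trans l1; rewrite leq_exp2l.
by have := leq_ltn_trans JM Mj; rewrite !ltn_exp2l.
Qed.

(** For N >= N0 = 2^(2^(j+1)), log 2 >= 1/2 gives log N >= 2^j, an integer at which the growth
    hypothesis can be used: psi(log N) >= 2^14 2^j log(2^j) >= 2^13 2^j j. If |X_N| <= B = 2^(j+2)
    (j+2) <= 8 * 2^j j, then log P_N <= 601 B <= 4808 * 2^j j, which is smaller. *)
Lemma density_scale_le (psi : R -> R) (eps : R) (j M k0 : nat) (alpha : R) :
  (forall x y, 0 < x -> x <= y -> psi x <= psi y) ->
  (forall k, (k0 <= k)%N -> 2 ^+ 14 * (k%:R * ln k%:R) <= psi k%:R) ->
  good_scale eps j.+2 alpha -> (2 <= j)%N -> (k0 <= 2 ^ j)%N ->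
  (2 ^+ j.+2)^-1 <= eps -> (2 ^ (2 ^ j.+2) <= M < 2 ^ (2 ^ j.+3))%N ->
  (count_upto (sudler_set psi alpha) M)%:R <= (2^-1 + 2060 * eps) * M%:R :> R.
Proof.
move=> pm pk G j2 kj je Mj.
have [b b0 [X [Mb b1 XB XL]]] := upper_scale eps j.+2 M alpha G isT Mj.
have [w ew] : exists w : R, w = 2 ^+ j.+2 := ex_intro _ _ erefl.
have w0 : 0 < w by rewrite ew; apply: exprn_gt0.
have [B eB] : exists B : R, B = w * j.+2%:R := ex_intro _ _ erefl.
have B0 : 0 < B by rewrite eB mulr_gt0.
pose N0 := (2 ^ (2 ^ j.+1))%N.
have N00 : 0 < N0%:R :> R by rewrite ltr0n expn_gt0.
case/andP: Mj => Mj1 Mj2.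
have M0 : (0 < M)%N by apply: leq_trans Mj1; rewrite expn_gt0.
have MR : 0 < M%:R :> R by rewrite ltr0n.
have AN N : (N0 <= N <= M)%N -> low_phase b N -> `|X N| <= B -> ~ sudler_set psi alpha N.
  move=> /andP[N0N NM] lp XN [_ pN].
  have := le_trans pN (XL N NM lp); rewrite -ew -eB; apply/negP; rewrite -ltNge.
  have NR : 0 < N%:R :> R by apply: lt_le_trans N00 _; rewrite ler_nat.
  have g0 : 0 < (2 ^ j)%:R :> R by rewrite ltr0n expn_gt0.
  have lnN : (2 ^ j)%:R <= ln N%:R :> R.
    apply: le_trans (_ : ln N0%:R <= _); last by rewrite ler_ln ?posrE// ler_nat.
    have -> : N0%:R = 2 ^+ (2 ^ j.+1) :> R by rewrite natrX.
    rewrite lnXn// -[X in _ <= X]mulr_natl expnS natrM.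
    by have := ln2_ge_half; move: (ln 2) => z; clear -g0; nra.
  apply: lt_le_trans (pm _ _ g0 lnN); apply: lt_le_trans (pk _ kj).
  have -> : ln (2 ^ j)%:R = j%:R * ln 2 :> R.
    by rewrite natrX lnXn// -[X in X = _]mulr_natl.
  have jR : 2 <= j%:R :> R by rewrite ler_nat.
  have e1 : w = 4 * (2 ^ j)%:R by rewrite ew natrX !exprS; ring.
  have e2 : j.+2%:R <= 2 * j%:R :> R by rewrite -natrM ler_nat; clear -j2; lia.
  have h1 : B <= 8 * ((2 ^ j)%:R * j%:R).
    rewrite eB e1; apply: le_trans (ler_wpM2l _ e2) _; first by rewrite mulr_ge0// ltW.
    by clear; lra.
  have v0 : 0 < (2 ^ j)%:R * j%:R :> R by rewrite mulr_gt0//; clear -jR; lra.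
  have h2 : (2 ^ j)%:R * j%:R * 2^-1 <= (2 ^ j)%:R * (j%:R * ln 2) :> R.
    by rewrite mulrA; apply: ler_wpM2l; [exact: ltW|exact: ln2_ge_half].
  have h3 : 2 ^+ 14 = 16384 :> R by ring.
  rewrite h3; move: XN h1 v0 h2; move: ((2 ^ j)%:R * (j%:R * ln 2)) ((2 ^ j)%:R * j%:R) (`|X N|) => y v x.
  by clear; lra.
(* Here 1026 (M+1) eps <= 2052 M eps, while N0, the terms with b and the constants are together at
   most 8 M/w <= 8 M eps; hence 2060. *)
have := @count_upper R (sudler_set psi alpha) b B M N0 X b0 B0 AN.
have h1 : (\sum_(0 <= N < M.+1) X N ^+ 2) / B ^+ 2 <= 1026 * M.+1%:R * eps.
  rewrite ler_pdivrMr ?exprn_gt0//; apply: le_trans XB _.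
  have -> : 4 ^+ j.+2 = w ^+ 2.
    by rewrite ew -exprM mulnC exprM; congr (_ ^+ _); ring.
  by rewrite eB le_eqVlt; apply/orP; left; apply/eqP; ring.
have e0 : 0 <= eps by apply: le_trans je; rewrite invr_ge0 exprn_ge0.
rewrite -ew in je Mb.
have v1 : 1 <= M%:R / w.
  rewrite ler_pdivlMr// mul1r ew -natrX ler_nat; apply: leq_trans Mj1.
  by rewrite leq_exp2l// ltnW// ltn_expl.
have ve : M%:R / w <= M%:R * eps by apply: ler_wpM2l => //; exact: ltW.
have N0v : N0%:R <= 2 * (M%:R / w).
  rewrite mulrA ler_pdivlMr// ew -natrX -!natrM ler_nat.
  rewrite [(2 ^ j.+2)%N]expnS mulnCA leq_mul2l /=; apply: leq_trans Mj1.
  rewrite (expnS 2 j.+1) mul2n -addnn expnD leq_mul2l.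
  by apply/orP; right; rewrite leq_exp2l// ltnW// ltn_expl.
have Me : 1 <= M%:R :> R by rewrite ler1n.
have Mee : eps <= M%:R * eps by rewrite ler_peMl.
have eM : M.+1%:R = M%:R + 1 :> R by rewrite natr1.
rewrite eM in h1 *; move: h1 ve v1 N0v Mb.
have -> : 1026 * (M%:R + 1) * eps = 1026 * (M%:R * eps) + 1026 * eps by ring.
rewrite [M%:R * b]mulrC.
have -> : (M%:R + 1 + 1) * b = b * M%:R + 2 * b by ring.
have -> : (2^-1 + 2060 * eps) * M%:R = 2^-1 * M%:R + 2060 * (M%:R * eps) by ring.
move: (M%:R / w) (M%:R * eps) Mee (b * M%:R) (_ / B ^+ 2) => v me Mee bm x.
by clear -Mee b1; lra.
Qed.

Lemma density_le_half (psi : R -> R) :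
  (forall x y, 0 < x -> x <= y -> psi x <= psi y) ->
  ((2 ^+ 15)%:E <= limn_einf (fun k : nat => (psi k%:R / (k%:R * ln k%:R))%:E))%E ->
  {ae mu, forall alpha : R, (upper_density R (sudler_set psi alpha) <= (1 / 2)%:E)%E}.
Proof.
move=> pm pl.
(* A lower limit of at least 2^15 keeps the quotient above the strictly smaller 2^14 from some k
   on. *)
have [k1 k1P] : exists m, forall k, (m <= k)%N -> ((2 ^+ 14)%:E <= (psi k%:R / (k%:R * ln k%:R))%:E)%E.
  apply: limn_einf_eventually; apply: lt_le_trans pl; rewrite lte_fin (exprS _ 14).
  by rewrite ltr_pMl ?exprn_gt0// ltr1n.
have pk k : (maxn k1 2 <= k)%N -> 2 ^+ 14 * (k%:R * ln k%:R) <= psi k%:R.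
  rewrite geq_max => /andP[kk k2]; have := k1P k kk; rewrite lee_fin ler_pdivlMr//.
  by rewrite mulr_gt0 ?ltr0n ?ln_gt0 ?ltr1n// ltnW.
apply: ae_imply good_scale_ae => alpha G; apply/lee_addgt0Pr => e e0.
have [c ec] : exists c : R, c = 2060 := ex_intro _ _ erefl.
pose i := Num.trunc (c / e).
have ie : c * i.+1%:R^-1 <= e.
  by rewrite ler_pdivrMr ?ltr0n// -ler_pdivrMl// mulrC ltW// truncnS_gt.
have [j0 jP] := G i.
pose J := maxn (maxn j0 i.+1) (maxn k1 2).
apply: (@limn_esup_le _ _ _ (2 ^ (2 ^ J.+2))) => M JM.
have [j Jj Mj] := double_exp_bracket _ _ JM.
have M0 : 0 < M%:R :> R by rewrite ltr0n (leq_trans _ JM)// expn_gt0.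
rewrite -EFinD lee_fin ler_pdivrMr//.
case: j Jj Mj => [//|[//|j]]; rewrite !ltnS => Jj Mj.
move: (Jj); rewrite !geq_max => /andP[/andP[jj ij] /andP[kj j2]].
apply: le_trans (@density_scale_le psi i.+1%:R^-1 j M (maxn k1 2) alpha pm pk _ j2 _ _ Mj) _.
- by apply: jP; apply: leq_trans jj _; rewrite ltnW// ltnW.
- by rewrite geq_max (leq_trans kj) ?(leq_trans j2)// ltnW// ltn_expl.
- rewrite lef_pV2 ?posrE ?exprn_gt0 ?ltr0n// -natrX ler_nat.
  by apply: leq_trans ij _; rewrite ltnW// (leq_trans (ltn_expl j (isT : 1 < 2)%N))// leq_exp2l// ltnW.
apply: ler_wpM2r; first exact: ltW.
rewrite -ec; move: ie; move: (i.+1%:R^-1) => z; move: (c * z) => t; clear; lra.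
Qed.

End PartB.

Theorem theorem2 (R : realType) :
  (forall (psi : R -> R),
     (forall x, 0 < x -> 0 < psi x) ->
     (forall x y, 0 < x -> x <= y -> psi x <= psi y) ->
     (\sum_(1 <= k <oo) ((psi k%:R)^-1)%:E = +oo)%E ->
     {ae (@lebesgue_measure R), forall alpha : R,
        ((1 / 2)%:E <= upper_density R (sudler_set psi alpha))%E})
  /\
  (exists C : R, 0 < C /\
     forall (psi : R -> R),
     (forall x, 0 < x -> 0 < psi x) ->
     (forall x y, 0 < x -> x <= y -> psi x <= psi y) ->
     (\sum_(1 <= k <oo) ((psi k%:R)^-1)%:E = +oo)%E ->
     (C%:E <= limn_einf (fun k : nat => (psi k%:R / (k%:R * ln k%:R))%:E))%E ->
     {ae (@lebesgue_measure R), forall alpha : R,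
        upper_density R (sudler_set psi alpha) = (1 / 2)%:E}).
Proof.
split; first exact: density_ge_half.
exists (2 ^+ 15); split; first by apply: exprn_gt0.
move=> psi p0 pm pdiv pl.
(* The two almost sure bounds are intersected as a countable family. *)
have H : {ae (@lebesgue_measure R), forall alpha : R, forall n : nat,
    if n is 0 then ((1 / 2)%:E <= upper_density R (sudler_set psi alpha))%E
    else (upper_density R (sudler_set psi alpha) <= (1 / 2)%:E)%E}.
  by apply: ae_foralln => -[|n]; [exact: density_ge_half|exact: density_le_half].
apply: ae_imply H => alpha h; apply/eqP; rewrite eq_le.
by rewrite (h 0%N) (h 1%N).
Qed.
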